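(* Let $v$ be a finite place of $K$. For every weight $s \in \mathbb{S}$, type $m \in \mathbb{Z}/(q-1)\mathbb{Z}$ and $r \geqslant 0$, the operator $\Theta^r$ maps $\mathcal{M}_s^m$ into $\mathcal{M}_{s+2r}^{m+r}$.
   Context: $A = \mathbb{F}_q[\theta]$ ($q$ a power of the prime $p$), $K = \mathbb{F}_q(\theta)$, $\mathbb{C}_\infty$ the completion of an algebraic closure of $\mathbb{F}_q((1/\theta))$, $\Omega=\mathbb{C}_\infty\setminus\mathbb{F}_q((1/\theta))$. Let $[i]=\theta^{q^i}-\theta$, $D_0=1$, $D_i=[i]D_{i-1}^q$, $e_C(x)=\sum_{i\ge0}x^{q^i}/D_i$ the Carlitz exponential with kernel $A\tilde\pi$, and $u(z)=1/e_C(\tilde\pi z)$. Goss polynomials $G_k(t)$ are defined by $\sum_{k\ge1}G_k(t)x^k = tx/(1-te_C(x))$, and $\beta_{r,j}\in K$ by $G_{r+1}(t)=\sum_{j=0}^r\beta_{r,j}t^{j+1}$. On power series, $\Theta^r(f) := \sum_{j=0}^r \beta_{r,j}u^{j+1}\partial_u^j(u^{j-1}f)$, i.e. $\Theta^r(\sum_n c_nu^n) = \sum_n c_n\sum_{j=0}^r\binom{n+j-1}{j}\beta_{r,j}u^{n+j}$ (this agrees with $(-\tilde\pi)^{-r}\partial_z^r$ on $u$-expansions of functions, $\partial_z^r$ the $r$-th hyperderivative). $v$ is a finite place with monic irreducible generator $\wp$ of degree $d$, completions $A_v,K_v$; $K\otimes_AA_v[[u]]$ denotes power series over $K_v$ with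 bounded denominators, $\mathrm{ord}_v(\sum c_nu^n)=\min\mathrm{ord}_v(c_n)$, $\|f\|_v=q^{-\mathrm{ord}_vf}$. $\mathbb{S}=\mathbb{Z}/(q^d-1)\mathbb{Z}\times\mathbb{Z}_p$ with $\mathbb{Z}\hookrightarrow\mathbb{S}$, $n\mapsto(n\bmod q^d-1,n)$. Drinfeld modular forms of weight $k$, type $m\in\mathbb{Z}/(q-1)\mathbb{Z}$: rigid analytic $f$ on $\Omega$ with $f(\gamma z)=(\det\gamma)^{-m}(cz+d)^kf(z)$ for $\gamma\in\mathrm{GL}_2(A)$ and with a $u$-expansion; $M_k^m(K)$ those with coefficients in $K$. A $v$-adic modular form of weight $s\in\mathbb{S}$ and type $m$ is $f\in K\otimes_AA_v[[u]]$ such that there exist $f_i\in M_{k_i}^{m}(K)$ with $\|f_i-f\|_v\to0$ and $k_i\to s$ in $\mathbb{S}$; $\mathcal{M}_s^m$ is the space of these. *)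

(* Defs.v *)
From HB Require Import structures.
From mathcomp Require Import all_boot all_order all_algebra all_field.
From mathcomp Require Import all_classical all_reals all_analysis.

Set Implicit Arguments.
Unset Strict Implicit.
Unset Printing Implicit Defensive.

Import Order.TTheory GRing.Theory Num.Theory.
Import numFieldNormedType.Exports.

Local Open Scope classical_set_scope.
Local Open Scope ring_scope.

(* The additive group Z/NZ for N >= 1.  Unlike 'Z_N it is the trivial group
   when N = 1, which occurs for Z/(q-1)Z when q = 2 and for Z/(q^d-1)Z when
   q = 2, d = 1. *)
Definition Zmod (N : nat) : zmodType := 'I_N.-1.+1.

Definition Zmod_of_int (N : nat) (n : int) : Zmod N := (inZp 1 : Zmod N) *~ n.

Definition Zmod_reduce (M N : nat) (x : Zmod M) : Zmod N :=
  inZp (x : 'I_M.-1.+1).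

(* Z_p as the inverse limit of the Z/p^n. *)
Record padic_int (p : nat) := PadicInt {
  residue : forall n, Zmod (p ^ n);
  residue_compat : forall n, Zmod_reduce (p ^ n) (residue n.+1) = residue n
}.

Section PadicIntGroup.
Variable p : nat.

Lemma padic_intP (x y : padic_int p) :
  (forall n, residue x n = residue y n) -> x = y.
Proof.
case: x y => [x xP] [y yP] /= xy.
have {}xy : x = y by apply: functional_extensionality_dep.
by move: xP yP; rewrite xy => xP yP; congr PadicInt; exact: Prop_irrelevance.
Qed.

Lemma dvd_pow_pred n : ((p ^ n).-1.+1 %| (p ^ n.+1).-1.+1)%N.
Proof.
case: (posnP p) => [->|p0]; first by case: n => [|n] //; rewrite !exp0n.
by rewrite !prednK ?expn_gt0 ?p0// expnS dvdn_mull.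
Qed.

Lemma Zmod_reduceD n (x y : Zmod (p ^ n.+1)) :
  Zmod_reduce (p ^ n) (x + y) = Zmod_reduce (p ^ n) x + Zmod_reduce (p ^ n) y.
Proof.
by apply: val_inj; rewrite /= modn_dvdm ?dvd_pow_pred// modnDm.
Qed.

Lemma Zmod_reduce0 n : Zmod_reduce (p ^ n) (0 : Zmod (p ^ n.+1)) = 0.
Proof. by apply: val_inj; rewrite /= mod0n. Qed.

Lemma Zmod_reduceN n (x : Zmod (p ^ n.+1)) :
  Zmod_reduce (p ^ n) (- x) = - Zmod_reduce (p ^ n) x.
Proof.
by apply/eqP; rewrite -addr_eq0 -Zmod_reduceD addNr Zmod_reduce0.
Qed.

Lemma Zmod_reduce_int n (k : int) :
  Zmod_reduce (p ^ n) (Zmod_of_int (p ^ n.+1) k) = Zmod_of_int (p ^ n) k.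
Proof.
have nat_case (m : nat) : Zmod_reduce (p ^ n) (Zmod_of_int (p ^ n.+1) m%:Z)
    = Zmod_of_int (p ^ n) m%:Z.
  rewrite /Zmod_of_int -!pmulrn; elim: m => [|m IH].
    by rewrite !mulr0n Zmod_reduce0.
  rewrite !mulrS Zmod_reduceD IH; congr (_ + _).
  by apply: val_inj; rewrite /= modn_dvdm ?dvd_pow_pred.
case: k => m; first exact: nat_case.
by rewrite NegzE /Zmod_of_int !mulrNz Zmod_reduceN; congr (- _); exact: nat_case.
Qed.

Definition padic_zero : padic_int p :=
  @PadicInt p (fun n => 0) (fun n => Zmod_reduce0 n).

Lemma padic_opp_compat (x : padic_int p) n :
  Zmod_reduce (p ^ n) (- residue x n.+1) = - residue x n.
Proof. by rewrite Zmod_reduceN residue_compat. Qed.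

Definition padic_opp (x : padic_int p) : padic_int p :=
  @PadicInt p (fun n => - residue x n) (padic_opp_compat x).

Lemma padic_add_compat (x y : padic_int p) n :
  Zmod_reduce (p ^ n) (residue x n.+1 + residue y n.+1) =
  residue x n + residue y n.
Proof. by rewrite Zmod_reduceD !residue_compat. Qed.

Definition padic_add (x y : padic_int p) : padic_int p :=
  @PadicInt p (fun n => residue x n + residue y n) (padic_add_compat x y).

Definition padic_of_int (k : int) : padic_int p :=
  @PadicInt p (fun n => Zmod_of_int (p ^ n) k) (fun n => Zmod_reduce_int n k).

Lemma padic_addA : associative padic_add.
Proof. by move=> x y z; apply: padic_intP => n /=; rewrite addrA. Qed.

Lemma padic_addC : commutative padic_add.
Proof. by move=> x y; apply: padic_intP => n /=; rewrite addrC. Qed.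

Lemma padic_add0 : left_id padic_zero padic_add.
Proof. by move=> x; apply: padic_intP => n /=; rewrite add0r. Qed.

Lemma padic_addN : left_inverse padic_zero padic_opp padic_add.
Proof. by move=> x; apply: padic_intP => n /=; rewrite addNr. Qed.

HB.instance Definition _ := gen_eqMixin (padic_int p).
HB.instance Definition _ := gen_choiceMixin (padic_int p).
HB.instance Definition _ := GRing.isZmodule.Build (padic_int p)
  padic_addA padic_addC padic_add0 padic_addN.

End PadicIntGroup.

(* The weight space Z/(q^d-1)Z x Z_p. *)
Definition weight_space (p q d : nat) : zmodType :=
  (Zmod (q ^ d).-1 * padic_int p)%type.

Definition weight_of_int (p q d : nat) (n : int) : weight_space p q d :=
  (Zmod_of_int (q ^ d).-1 n, padic_of_int p n).

(* Discrete topology on the first factor, p-adic topology on the second. *)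
Definition weight_cvg (p q d : nat) (k : nat -> weight_space p q d)
    (s : weight_space p q d) : Prop :=
  (\forall i \near \oo, (k i).1 = s.1) /\
  forall n, \forall i \near \oo, residue (k i).2 n = residue s.2 n.

Section FormalPowerSeries.
Variable R : comNzRingType.

Definition fps_mul (f g : nat -> R) (n : nat) : R :=
  \sum_(i < n.+1) f i * g (n - i)%N.

Fixpoint fps_exp (f : nat -> R) (n : nat) : nat -> R :=
  if n is m.+1 then fps_mul (fps_exp f m) f else fun i => (i == 0%N)%:R.

(* 1 / (1 - f) for f without constant term; see fps_geomP. *)
Definition fps_geom (f : nat -> R) (k : nat) : R :=
  \sum_(n < k.+1) fps_exp f n k.

Lemma fps_exp_lt (f : nat -> R) n k :
  f 0%N = 0 -> (k < n)%N -> fps_exp f n k = 0.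
Proof.
move=> f0; elim: n k => [//|n IH] k kn /=; rewrite /fps_mul big1// => i _.
have [ik|ik] := ltnP i n; first by rewrite IH ?mul0r.
have ->: (k - i = 0)%N.
  by apply/eqP; rewrite subn_eq0; apply: leq_trans ik; rewrite -ltnS.
by rewrite f0 mulr0.
Qed.

Lemma fps_geomP (f : nat -> R) : f 0%N = 0 ->
  forall k, fps_mul (fps_geom f) (fun i => (i == 0%N)%:R - f i) k =
            (k == 0%N)%:R.
Proof.
move=> f0 k; rewrite /fps_mul.
transitivity (\sum_(n < k.+1) (fps_exp f n k - fps_exp f n.+1 k)); last first.
  rewrite -(big_mkord xpredT (fun n => fps_exp f n k - fps_exp f n.+1 k)).
  under eq_bigr do rewrite -opprB.
  rewrite sumrN telescope_sumr// opprB (fps_exp_lt f0 (ltnSn k)) subr0.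
  by [].
under eq_bigr => i _.
  rewrite /fps_geom (big_ord_widen k.+1 (fun n => fps_exp f n i))//.
  rewrite big_mkcond/= (eq_bigr (fun n : 'I_k.+1 => fps_exp f n i)); last first.
    by move=> n _; case: ltnP => // ni; rewrite fps_exp_lt.
  rewrite mulr_suml; over.
rewrite exchange_big/=; apply: eq_bigr => n _.
under eq_bigr do rewrite mulrBr.
rewrite sumrB; congr (_ - _).
rewrite (bigD1 ord_max)//= subnn eqxx mulr1 big1 ?addr0// => i ik.
have -> : (k - i == 0)%N = false; last by rewrite mulr0.
apply/negbTE; rewrite subn_eq0 -ltnNge ltn_neqAle -ltnS ltn_ord andbT.
by apply: contra ik => /eqP ik; apply/eqP/val_inj.
Qed.

End FormalPowerSeries.

(* K = F_q(theta) with A = F_q[theta] = {poly Fq}, theta = 'X. *)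
Notation ratfun Fq := {fraction {poly Fq}}.

Section Carlitz.
Variable Fq : finFieldType.
Local Notation q := #|Fq|.
Local Notation A := {poly Fq}.
Local Notation K := (ratfun Fq).

Definition bracket (i : nat) : A := 'X^(q ^ i) - 'X.

Fixpoint carlitz_D (i : nat) : A :=
  if i is j.+1 then bracket i * carlitz_D j ^+ q else 1.

Definition carlitz_D_inv (i : nat) : K := (FracField.tofrac (carlitz_D i))^-1.

(* The coefficient of x^n in e_C(x). *)
Definition carlitz_exp_fps (n : nat) : K :=
  \sum_(i < n.+1 | (q ^ i)%N == n) carlitz_D_inv i.

(* The coefficient of x^k in t x / (1 - t e_C(x)), where t = 'X : {poly K}. *)
Definition goss (k : nat) : {poly K} :=
  fps_mul (fun i => if i == 1%N then 'X else 0)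
          (fps_geom (fun n => 'X * (carlitz_exp_fps n)%:P)) k.

Definition goss_coef (r j : nat) : K := (goss r.+1)`_j.+1.

Lemma carlitz_exp_fps0 : carlitz_exp_fps 0 = 0.
Proof.
rewrite /carlitz_exp_fps big1// => i /eqP iE.
by move: (expn_gt0 q i); rewrite iE (cardD1 (0 : Fq)).
Qed.

Lemma goss0 : goss 0 = 0.
Proof. by rewrite /goss /fps_mul big_ord1/= mul0r. Qed.

Lemma gossS k :
  goss k.+1 = 'X * fps_geom (fun n => 'X * (carlitz_exp_fps n)%:P) k.
Proof.
rewrite /goss /fps_mul !big_ord_recl/= mul0r add0r subSS subn0.
by rewrite big1 ?addr0// => i _; rewrite mul0r.
Qed.

Lemma gossP k :
  fps_mul goss (fun n => (n == 0%N)%:R - 'X * (carlitz_exp_fps n)%:P) k =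
  if k == 1%N then 'X else 0.
Proof.
case: k => [|k]; first by rewrite /fps_mul big_ord1 goss0 mul0r.
rewrite /fps_mul big_ord_recl goss0 mul0r add0r.
under eq_bigr do rewrite lift0 gossS subSS -mulrA.
rewrite -mulr_sumr.
have e0 : 'X * (carlitz_exp_fps 0)%:P = 0 :> {poly K}.
  by rewrite carlitz_exp_fps0 mulr0.
have /= := @fps_geomP {poly K} (fun n => 'X * (carlitz_exp_fps n)%:P) e0 k.
rewrite /fps_mul => ->.
by rewrite mulr_natr mulrb eqSS.
Qed.

Lemma goss_coefP r :
  goss r.+1 = \sum_(j < r.+1) goss_coef r j *: 'X^(j.+1).
Proof.
have expE n k : fps_exp (fun i => 'X * (carlitz_exp_fps i)%:P) n k =
    (fps_exp carlitz_exp_fps n k) *: 'X^n :> {poly K}.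
  elim: n k => [|n IH] k /=; first by case: (k == 0%N); rewrite ?scale0r ?scale1r.
  rewrite /fps_mul scaler_suml; apply: eq_bigr => i _.
  by rewrite IH -scalerAl mulrA -exprSr mulrC mul_polyC scalerA.
have gE : goss r.+1 = \sum_(j < r.+1) fps_exp carlitz_exp_fps j r *: 'X^(j.+1).
  rewrite gossS /fps_geom mulr_sumr; apply: eq_bigr => i _.
  by rewrite expE -scalerAr -exprS.
rewrite [LHS]gE; apply: eq_bigr => j _; congr (_ *: _).
rewrite /goss_coef gE coef_sum (bigD1 j)//= coefZ coefXn eqxx mulr1.
rewrite big1 ?addr0// => i ij; rewrite coefZ coefXn eqSS.
by rewrite eq_sym (inj_eq val_inj) (negbTE ij) mulr0.
Qed.

(* Theta^r on u-expansions with coefficients in an extension L of K: u^l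
   receives the contributions of u^n with n = l - j. *)
Definition Theta (L : fieldType) (iota : {rmorphism K -> L}) (r : nat)
    (c : nat -> L) (l : nat) : L :=
  \sum_(j < r.+1 | (j <= l)%N)
    c (l - j)%N * 'C((l - j) + j - 1, j)%:R * iota (goss_coef r j).

End Carlitz.

Section ValuedFields.
Variables (R : realType) (F : fieldType) (abs : F -> R).

Definition cvg_abs (x : nat -> F) (l : F) : Prop :=
  (fun n => abs (x n - l)) @ \oo --> (0 : R).

Definition lim_abs (x : nat -> F) : F := xget 0 [set l | cvg_abs x l].

Record nonarchimedean_abs : Prop := NonarchimedeanAbs {
  abs_ge0 : forall x, 0 <= abs x;
  abs_eq0 : forall x, abs x = 0 <-> x = 0;
  abs_mul : forall x y, abs (x * y) = abs x * abs y;
  abs_ultra : forall x y, abs (x + y) <= Num.max (abs x) (abs y)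
}.

Definition complete_abs : Prop :=
  forall x : nat -> F,
    (forall e, 0 < e -> exists N, forall m n, (N <= m)%N -> (N <= n)%N ->
       abs (x m - x n) < e) ->
    exists l, cvg_abs x l.

Definition closure_abs (S : set F) : set F :=
  [set x | forall e, 0 < e -> exists2 y, S y & abs (x - y) < e].

End ValuedFields.

Section InfinitePlace.
Variables (R : realType) (Fq : finFieldType).
Local Notation q := #|Fq|.
Local Notation A := {poly Fq}.
Local Notation K := (ratfun Fq).
Variables (C : fieldType) (abs : C -> R) (iota : {rmorphism K -> C}).

Definition iotaA (a : A) : C := iota (FracField.tofrac a).

(* F_q((1/theta)) inside C: the completion of K for the degree valuation. *)
Definition Kinf : set C := closure_abs abs (range iota).

Definition algebraic_over_Kinf : set C :=
  [set x | exists2 P : {poly C}, P != 0 /\ (forall i, Kinf P`_i) & root P x].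

(* C, with absolute value normalized by |theta| = q, is the completion of an
   algebraic closure of F_q((1/theta)). *)
Record is_Cinf : Prop := IsCinf {
  Cinf_abs : nonarchimedean_abs abs;
  Cinf_norm : forall a : A, a != 0 -> abs (iotaA a) = q%:R ^+ (size a).-1;
  Cinf_complete : complete_abs abs;
  Cinf_closed : forall P : {poly C}, (1 < size P)%N ->
    (forall i, algebraic_over_Kinf P`_i) ->
    exists2 x, algebraic_over_Kinf x & root P x;
  Cinf_dense : closure_abs abs algebraic_over_Kinf = setT
}.

Definition Omega : set C := ~` Kinf.

Definition carlitz_exp (x : C) : C :=
  lim_abs abs (fun n => \sum_(i < n) iota (carlitz_D_inv Fq i) * x ^+ (q ^ i)).

Definition is_carlitz_period (ptilde : C) : Prop :=
  forall x, carlitz_exp x = 0 <-> exists a : A, x = iotaA a * ptilde.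

Definition u_param (ptilde z : C) : C := (carlitz_exp (ptilde * z))^-1.

(* The standard exhaustion of Omega by connected affinoids. *)
Definition Omega_aff (n : nat) : set C :=
  [set z | abs z <= q%:R ^+ n /\ forall x, Kinf x -> q%:R ^- n <= abs (z - x)].

(* Functions on Omega are represented by total functions whose values outside
   Omega are irrelevant. *)
Definition rigid_analytic (f : C -> C) : Prop :=
  forall (n : nat) (e : R), 0 < e -> exists P Q : {poly C},
    forall z, Omega_aff n z -> Q.[z] != 0 /\ abs (f z - P.[z] / Q.[z]) <= e.

(* The expansion holds on some {z | |z|_i >= B}, where
   |z|_i = inf_{x in K_oo} |z - x|. *)
Definition has_u_expansion (ptilde : C) (f : C -> C) (c : nat -> C) : Prop :=
  exists2 B : R, 0 < B & forall z, (forall x, Kinf x -> B <= abs (z - x)) ->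
    cvg_abs abs (fun n => \sum_(i < n) c i * u_param ptilde z ^+ i) (f z).

Definition modular_transform (k : int) (m : Zmod q.-1) (f : C -> C) : Prop :=
  forall (g : 'M[A]_2) (z : C), g \in unitmx -> Omega z ->
    let a := iotaA (g 0 0) in let b := iotaA (g 0 1) in
    let c := iotaA (g 1 0) in let d := iotaA (g 1 1) in
    f ((a * z + b) / (c * z + d)) =
    iotaA (\det g) ^- (m : 'I_q.-1.-1.+1) * (c * z + d) ^ k * f z.

Record drinfeld_modular_form (ptilde : C) (k : int) (m : Zmod q.-1)
    (f : C -> C) : Prop := DrinfeldModularForm {
  dmf_analytic : rigid_analytic f;
  dmf_transform : modular_transform k m f;
  dmf_u_expansion : exists c, has_u_expansion ptilde f c
}.

(* M_k^m(K), through the u-expansions of its elements. *)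
Definition modular_form_K (ptilde : C) (k : int) (m : Zmod q.-1)
    (c : nat -> K) : Prop :=
  exists2 f, drinfeld_modular_form ptilde k m f &
             has_u_expansion ptilde f (iota \o c).

End InfinitePlace.

Section FinitePlace.
Variables (R : realType) (Fq : finFieldType) (wp : {poly Fq}).
Local Notation q := #|Fq|.
Local Notation A := {poly Fq}.
Local Notation K := (ratfun Fq).

(* For a != 0 and wp nonconstant. *)
Definition ordA (a : A) : nat := \max_(n < size a | wp ^+ n %| a) n.

Variables (Kv : fieldType) (abs : Kv -> R) (iota : {rmorphism K -> Kv}).

(* Kv is the completion of K at wp, with |x| = q^(- ord_v x). *)
Record is_completion_at : Prop := IsCompletionAt {
  Kv_abs : nonarchimedean_abs abs;
  Kv_norm : forall a : A, a != 0 ->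
    abs (iota (FracField.tofrac a)) = q%:R ^- ordA a;
  Kv_complete : complete_abs abs;
  Kv_dense : closure_abs abs (range iota) = setT
}.

(* K (x)_A A_v[[u]] inside Kv[[u]]. *)
Definition bounded_denominators (c : nat -> Kv) : Prop :=
  exists B : R, forall n, abs (c n) <= B.

(* q^(- min_n ord_v c_n), which is +oo without bounded denominators. *)
Definition gauss_norm (c : nat -> Kv) : \bar R :=
  ereal_sup (range (fun n => (abs (c n))%:E)).

End FinitePlace.

Definition vadic_modular_form (R : realType) (Fq : finFieldType) (p : nat)
    (C : fieldType) (absC : C -> R) (iotaC : {rmorphism ratfun Fq -> C})
    (ptilde : C) (wp : {poly Fq}) (Kv : fieldType) (absv : Kv -> R)
    (iotav : {rmorphism ratfun Fq -> Kv})
    (s : weight_space p #|Fq| (size wp).-1) (m : Zmod #|Fq|.-1)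
    (f : nat -> Kv) : Prop :=
  bounded_denominators absv f /\
  exists (k : nat -> int) (F : nat -> nat -> ratfun Fq),
    [/\ forall i, modular_form_K absC iotaC ptilde (k i) m (F i),
        (fun i => gauss_norm absv (fun n => iotav (F i n) - f n)) @ \oo
          --> (0 : \bar R)%E
      & weight_cvg (fun i => weight_of_int p #|Fq| (size wp).-1 (k i)) s].

(* Main.v *)
(* Let F be a Drinfeld modular form of weight K with K = 1 - r modulo p^M > r.
   By an analogue of Bol's identity its r-th hyperderivative is modular of
   weight K + 2r, so Theta^r F is a modular form of type m + r. For a form f of
   arbitrary weight k one twists by the normalized Eisenstein series g of weight
   q^k' - 1 with k' divisible by d = deg wp. Its expansion is
     1 - sum_(a != 0) sum_(i < k') (l_i / l_k') u(a z)^(q^k' - q^i),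
   with l_i the coefficients of the Carlitz logarithm. As l_i / l_k' is a
   product of the brackets -[j], i < j <= k', and wp divides [d s], the series g is
   1 modulo wp and, for k' large, a power series in u^(q^r) modulo wp^N. Hence
   g^(p^M) is close to 1, and multiplication by g commutes with Theta^r modulo
   wp^N because n |-> binomial(n + j - 1, j) modulo p has period q^r for j <= r.
   Choosing x = k + r - 1 modulo p^M and x + y = p^M, the series
   g^y Theta^r (f g^x) is a modular form of weight k + 2r + p^M (q^k' - 1)
   close to Theta^r f; this weight is close to k + 2r in the weight space. *)
Require Import Defs.
From HB Require Import structures.
From mathcomp Require Import all_boot all_order all_algebra all_field.
From mathcomp Require Import all_classical all_reals all_analysis.
From mathcomp Require pgroup abelian.
From mathcomp Require Import ring lra zify.
Import Order.TTheory GRing.Theory Num.Theory.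
Import numFieldNormedType.Exports.
Set Implicit Arguments.
Unset Strict Implicit.
Unset Printing Implicit Defensive.
Local Open Scope ring_scope.


(** Derivatives of modular forms are in general only quasi-modular; the congruence on the weight in
    Bol's identity removes the correction terms, and the twist by g serves to reach it: the weight
    of g is -1 modulo p^M, so a suitable power of g repairs the weight modulo p^M. Two blocks are
    shaped by the concrete definitions. A rigid analytic function is known only as a uniform limit
    of rational functions on affinoids, so its hyperderivatives require Cauchy estimates. These come
    from factoring polynomials over C_oo, which is therefore first shown to be algebraically closed.
    The expansion of the Eisenstein series comes from finite sums over the polynomials b of degree
    less than D: the Carlitz polynomial satisfies e_D(x - b) = e_D(x), and dividing this by powers
    of x - b gives identities that survive the limit in D. The same limit fixes the (q-1)-st power
    of the period, and the Carlitz logarithm enters as the inverse of e_C. Convergence in u rests on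
    one bound: the coefficient of u^n in u(a z) has degree at most n in theta. *)

Lemma sum_ord_sub (V : zmodType) (t : nat -> V) m n : (m <= n)%N ->
  \sum_(i < n) t i - \sum_(i < m) t i = \sum_(m <= i < n) t i.
Proof.
move=> mn; apply/eqP; rewrite subr_eq addrC -!(big_mkord xpredT).
by apply/eqP; exact: big_cat_nat.
Qed.

(** * Nonarchimedean absolute values *)

Section NonArch.
Variables (R : realType) (C : fieldType) (abs : C -> R).
Hypothesis absC : nonarchimedean_abs abs.

Lemma abs_nonneg x : 0 <= abs x. Proof. exact: abs_ge0. Qed.

Lemma abs0 : abs 0 = 0. Proof. exact/(abs_eq0 absC). Qed.

Lemma abs_gt0 x : x != 0 -> 0 < abs x.
Proof.
move=> x0; rewrite lt_neqAle abs_nonneg andbT eq_sym.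
by apply/eqP => /(abs_eq0 absC) /eqP; apply/negP.
Qed.

Lemma abs_neq0 x : 0 < abs x -> x != 0.
Proof. by apply: contraTneq => ->; rewrite abs0 ltxx. Qed.

Lemma abs1 : abs 1 = 1.
Proof.
have /eqP : abs 1 * abs 1 = abs 1 by rewrite -(abs_mul absC) mulr1.
rewrite -subr_eq0 -{3}[abs 1]mulr1 -mulrBr mulf_eq0 subr_eq0 => /orP[|/eqP//].
by move/eqP/(abs_eq0 absC)/eqP; rewrite oner_eq0.
Qed.

Lemma absX x n : abs (x ^+ n) = abs x ^+ n.
Proof. by elim: n => [|n IH]; rewrite ?expr0 ?abs1// !exprS (abs_mul absC) IH. Qed.

Lemma absN x : abs (- x) = abs x.
Proof.
have : abs (-1) ^+ 2 = 1 by rewrite -absX sqrrN expr1n abs1.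
move/eqP; rewrite sqrf_eq1 => /orP[/eqP N1|/eqP N1].
  by rewrite -mulN1r (abs_mul absC) N1 mul1r.
by have := abs_nonneg (-1); rewrite N1 ler0N1.
Qed.

Lemma abs_distC x y : abs (x - y) = abs (y - x).
Proof. by rewrite -absN opprB. Qed.

Lemma absV x : abs x^-1 = (abs x)^-1.
Proof.
have [->|x0] := eqVneq x 0; first by rewrite invr0 abs0 invr0.
by apply: (mulfI (lt0r_neq0 (abs_gt0 x0))); rewrite -(abs_mul absC) !divff ?abs1 ?lt0r_neq0 ?abs_gt0.
Qed.

Lemma absD_le x y M : abs x <= M -> abs y <= M -> abs (x + y) <= M.
Proof.
by move=> xM yM; apply: le_trans (abs_ultra absC x y) _; rewrite ge_max xM.
Qed.

Lemma absD_lt x y M : abs x < M -> abs y < M -> abs (x + y) < M.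
Proof.
by move=> xM yM; apply: le_lt_trans (abs_ultra absC x y) _; rewrite gt_max xM.
Qed.

Lemma absB_le x y M : abs x <= M -> abs y <= M -> abs (x - y) <= M.
Proof. by move=> xM yM; apply: absD_le; rewrite ?absN. Qed.

Lemma absB_lt x y M : abs x < M -> abs y < M -> abs (x - y) < M.
Proof. by move=> xM yM; apply: absD_lt; rewrite ?absN. Qed.

Lemma abs_sum_le I (s : seq I) (P : pred I) (F : I -> C) M : 0 <= M ->
  (forall i, P i -> abs (F i) <= M) -> abs (\sum_(i <- s | P i) F i) <= M.
Proof.
move=> M0 FM; elim/big_rec: _ => [|i x Pi xM]; first by rewrite abs0.
by apply: absD_le => //; exact: FM.
Qed.

Lemma abs_sum_le_in (I : eqType) (s : seq I) (F : I -> C) M : 0 <= M ->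
  {in s, forall i, abs (F i) <= M} -> abs (\sum_(i <- s) F i) <= M.
Proof.
move=> M0 FM; rewrite big_seq_cond; apply: abs_sum_le => // i.
by rewrite andbT; exact: FM.
Qed.

Lemma abs_isosceles x y : abs y < abs x -> abs (x + y) = abs x.
Proof.
move=> yx; apply: le_anti; rewrite absD_le ?(ltW yx)//= leNgt; apply/negP => xyx.
by have := absB_lt xyx yx; rewrite addrK ltxx.
Qed.

Lemma abs_nat_le1 n : abs n%:R <= 1.
Proof.
by elim: n => [|n IH]; rewrite ?abs0// -addn1 natrD absD_le// abs1.
Qed.

Lemma abs_sign n x : abs ((-1) ^+ n * x) = abs x.
Proof. by rewrite (abs_mul absC) absX absN abs1 expr1n mul1r. Qed.

Lemma absB_isosceles x y : abs y < abs x -> abs (x - y) = abs x.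
Proof. by move=> yx; apply: abs_isosceles; rewrite absN. Qed.

Lemma abs_prod I (s : seq I) (P : pred I) (F : I -> C) :
  abs (\prod_(i <- s | P i) F i) = \prod_(i <- s | P i) abs (F i).
Proof.
by elim/big_rec2: _ => [|i x y _ <-]; rewrite ?abs1// (abs_mul absC).
Qed.

(** * Limits and series *)

Lemma cvg_absP (x : nat -> C) l : cvg_abs abs x l <->
  forall e, 0 < e -> exists N, forall n, (N <= n)%N -> abs (x n - l) < e.
Proof.
split=> [h e e0|h].
  move/cvgrPdist_lt: h => /(_ e e0) [N _ hN]; exists N => n Nn.
  by have := hN n Nn; rewrite sub0r normrN ger0_norm ?abs_nonneg.
apply/cvgrPdist_lt => e e0; have [N hN] := h e e0; exists N => // n Nn.
by rewrite sub0r normrN ger0_norm ?abs_nonneg// hN.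
Qed.

Lemma eq_abs0 x : (forall e, 0 < e -> abs x <= e) -> x = 0.
Proof.
move=> h; apply/eqP; apply: contraT => x0.
have := h (abs x / 2) (divr_gt0 (abs_gt0 x0) (ltr0Sn _ _)).
rewrite ler_pdivlMr// mulr_natr mulr2n gerDl => /le_lt_trans/(_ (abs_gt0 x0)).
by rewrite ltxx.
Qed.

Lemma cvg_abs_unique x l l' : cvg_abs abs x l -> cvg_abs abs x l' -> l = l'.
Proof.
move=> /cvg_absP xl /cvg_absP xl'; apply/eqP; rewrite -subr_eq0; apply/eqP.
apply: eq_abs0 => e e0; have [N hN] := xl e e0; have [N' hN'] := xl' e e0.
have -> : l - l' = (x (maxn N N') - l') - (x (maxn N N') - l) by ring.
by apply: absB_le; apply: ltW; [apply: hN'|apply: hN]; rewrite ?leq_maxl ?leq_maxr.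
Qed.

Lemma lim_absE x l : cvg_abs abs x l -> lim_abs abs x = l.
Proof.
move=> xl; have := @xgetPex _ 0 [set l' | cvg_abs abs x l']%classic (ex_intro _ l xl).
by move=> /= h; exact: cvg_abs_unique h xl.
Qed.

Lemma cvg_abs_near x y l N : (forall n, (N <= n)%N -> x n = y n) ->
  cvg_abs abs x l -> cvg_abs abs y l.
Proof.
move=> xy /cvg_absP h; apply/cvg_absP => e e0; have [M hM] := h e e0.
exists (maxn N M) => n; rewrite geq_max => /andP[Nn Mn].
by rewrite -xy// hM.
Qed.

Lemma eq_cvg_abs x y l : x =1 y -> cvg_abs abs x l -> cvg_abs abs y l.
Proof. by move=> xy; apply: (@cvg_abs_near _ _ _ 0%N). Qed.

Lemma cvg_abs_cst c : cvg_abs abs (fun=> c) c.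
Proof. by apply/cvg_absP => e e0; exists 0%N => n _; rewrite subrr abs0. Qed.

Lemma cvg_absD x y l l' : cvg_abs abs x l -> cvg_abs abs y l' ->
  cvg_abs abs (fun n => x n + y n) (l + l').
Proof.
move=> /cvg_absP xl /cvg_absP yl; apply/cvg_absP => e e0.
have [N hN] := xl e e0; have [N' hN'] := yl e e0.
exists (maxn N N') => n; rewrite geq_max => /andP[Nn Mn].
have -> : x n + y n - (l + l') = (x n - l) + (y n - l') by ring.
by apply: absD_lt; [exact: hN|exact: hN'].
Qed.

Lemma cvg_abs_bounded x l : cvg_abs abs x l ->
  exists M, forall n, abs (x n) <= M.
Proof.
move=> /cvg_absP xl; have [N hN] := xl 1 ltr01.
exists (Num.max (\sum_(i < N) abs (x i)) (Num.max 1 (abs l))) => n.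
have [nN|Nn] := ltnP n N.
  rewrite le_max; apply/orP; left; rewrite (bigD1 (Ordinal nN))//= lerDl.
  by apply: sumr_ge0 => i _; exact: abs_nonneg.
rewrite le_max; apply/orP; right; rewrite -[x n](subrK l).
by apply: le_trans (abs_ultra absC _ _) _; rewrite ge_max !le_max lexx (ltW (hN _ Nn)) orbT.
Qed.

Lemma cvg_absM x y l l' : cvg_abs abs x l -> cvg_abs abs y l' ->
  cvg_abs abs (fun n => x n * y n) (l * l').
Proof.
move=> xl yl; have [M hM] := cvg_abs_bounded xl.
move/cvg_absP: xl => xl; move/cvg_absP: yl => yl; apply/cvg_absP => e e0.
pose B := Num.max M (abs l') + 1.
have B0 : 0 < B by apply: ltr_wpDl => //; rewrite le_max abs_nonneg orbT.
have [N hN] := xl (e / B) (divr_gt0 e0 B0); have [N' hN'] := yl (e / B) (divr_gt0 e0 B0).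
exists (maxn N N') => n; rewrite geq_max => /andP[Nn Mn].
have -> : x n * y n - l * l' = x n * (y n - l') + (x n - l) * l' by ring.
apply: absD_lt; rewrite (abs_mul absC).
  apply: (@le_lt_trans _ _ (B * abs (y n - l'))); last first.
    by rewrite mulrC -ltr_pdivlMr// hN'.
  by apply: ler_wpM2r; [exact: abs_nonneg|apply: le_trans (hM n) _; rewrite ler_wpDr// le_max lexx].
apply: (@le_lt_trans _ _ (abs (x n - l) * B)); last by rewrite -ltr_pdivlMr// hN.
by apply: ler_wpM2l; [exact: abs_nonneg|rewrite ler_wpDr// le_max lexx orbT].
Qed.

Lemma cvg_absZ c x l : cvg_abs abs x l -> cvg_abs abs (fun n => c * x n) (c * l).
Proof. by apply: cvg_absM; exact: cvg_abs_cst. Qed.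

Lemma cvg_absN x l : cvg_abs abs x l -> cvg_abs abs (fun n => - x n) (- l).
Proof. by move/(cvg_absZ (-1)); rewrite mulN1r; apply: eq_cvg_abs => n; rewrite mulN1r. Qed.

Lemma cvg_absB x y l l' : cvg_abs abs x l -> cvg_abs abs y l' ->
  cvg_abs abs (fun n => x n - y n) (l - l').
Proof. by move=> xl yl; apply: cvg_absD => //; exact: cvg_absN. Qed.

Lemma cvg_absX x l k : cvg_abs abs x l -> cvg_abs abs (fun n => x n ^+ k) (l ^+ k).
Proof.
move=> xl; elim: k => [|k IH]; first exact: cvg_abs_cst.
by rewrite exprS; apply: eq_cvg_abs (cvg_absM xl IH) => n; rewrite exprS.
Qed.

Lemma cvg_abs_sum I (s : seq I) (P : pred I) (x : I -> nat -> C) l :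
  (forall i, P i -> cvg_abs abs (x i) (l i)) ->
  cvg_abs abs (fun n => \sum_(i <- s | P i) x i n) (\sum_(i <- s | P i) l i).
Proof.
move=> xl; elim: s => [|i s IH].
  by rewrite big_nil; apply: eq_cvg_abs (cvg_abs_cst 0) => n; rewrite big_nil.
rewrite big_cons; case: ifPn => Pi; last first.
  by apply: eq_cvg_abs IH => n; rewrite big_cons (negbTE Pi).
by apply: eq_cvg_abs (cvg_absD (xl i Pi) IH) => n; rewrite big_cons Pi.
Qed.

(** A term closer to [l] than |l| has absolute value |l| by the isosceles property, so a bound on
    the terms passes to the limit without loss. *)
Lemma cvg_abs_le x l N M : (forall n, (N <= n)%N -> abs (x n) <= M) ->
  cvg_abs abs x l -> abs l <= M.
Proof.
move=> xM /cvg_absP xl; rewrite leNgt; apply/negP => Ml.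
have l0 : 0 < abs l by apply: le_lt_trans Ml; apply: le_trans (xM N _); rewrite ?abs_nonneg.
have [N' hN'] := xl _ l0; have h := hN' (maxn N N') (leq_maxr _ _).
have := xM (maxn N N') (leq_maxl _ _).
by rewrite -[x _](subrK l) addrC abs_isosceles// leNgt Ml.
Qed.

Lemma cvg_abs_ge x l N M : (forall n, (N <= n)%N -> M <= abs (x n)) ->
  cvg_abs abs x l -> M <= abs l.
Proof.
move=> xM /cvg_absP xl; rewrite leNgt; apply/negP => lM.
have M0 : 0 < M by apply: le_lt_trans lM; exact: abs_nonneg.
have [N' hN'] := xl _ M0; have h1 := hN' (maxn N N') (leq_maxr _ _).
have := absD_lt h1 lM; rewrite subrK ltNge xM//.
exact: leq_maxl.
Qed.

Lemma cvg_absV x l : l != 0 -> cvg_abs abs x l ->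
  cvg_abs abs (fun n => (x n)^-1) l^-1.
Proof.
move=> l0 /cvg_absP xl; apply/cvg_absP => e e0; have al := abs_gt0 l0.
have [N hN] := xl _ al; have [N' hN'] := xl (e * abs l ^+ 2) (mulr_gt0 e0 (exprn_gt0 _ al)).
exists (maxn N N') => n; rewrite geq_max => /andP[/hN h1 /hN' h2].
have xl_eq : abs (x n) = abs l by rewrite -[x n](subrK l) addrC abs_isosceles.
have xn0 : x n != 0 by apply: abs_neq0; rewrite xl_eq.
have -> : (x n)^-1 - l^-1 = (l - x n) / (x n * l) by field; rewrite xn0 l0.
by rewrite (abs_mul absC) absV (abs_mul absC) xl_eq abs_distC ltr_pdivrMr ?mulr_gt0// -expr2.
Qed.

Lemma cvg_abs_poly (p : {poly C}) x l : cvg_abs abs x l ->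
  cvg_abs abs (fun n => p.[x n]) p.[l].
Proof.
move=> xl; rewrite horner_coef.
apply: eq_cvg_abs (@cvg_abs_sum _ _ _ (fun (i : 'I_(size p)) n => p`_i * x n ^+ i) _ _).
  by move=> n; rewrite horner_coef.
by move=> i _; apply: cvg_absZ; exact: cvg_absX.
Qed.

Definition vanish (t : nat -> C) :=
  forall e, 0 < e -> exists N, forall n, (N <= n)%N -> abs (t n) < e.

Definition csum (t : nat -> C) (s : C) := cvg_abs abs (fun n => \sum_(i < n) t i) s.

Lemma csum_vanish t s : csum t s -> vanish t.
Proof.
move=> /cvg_absP h e e0; have [N hN] := h e e0; exists N => n Nn.
have -> : t n = (\sum_(i < n.+1) t i - s) - (\sum_(i < n) t i - s).
  by rewrite big_ord_recr /=; ring.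
by apply: absB_lt; apply: hN => //; exact: leqW.
Qed.

Lemma vanish_bounded t : vanish t -> exists2 M, 0 < M & forall n, abs (t n) <= M.
Proof.
move=> tv; have /cvg_abs_bounded[M hM] : cvg_abs abs t 0.
  by apply/cvg_absP => e e0; have [N hN] := tv e e0; exists N => n /hN; rewrite subr0.
by exists (Num.max M 1) => [|n]; rewrite ?lt_max ?ltr01 ?orbT// le_max hM.
Qed.

Lemma eq_csum t t' s : t =1 t' -> csum t s -> csum t' s.
Proof. by move=> tt; apply: eq_cvg_abs => n; apply: eq_bigr => i _; rewrite tt. Qed.

Lemma csum_unique t s s' : csum t s -> csum t s' -> s = s'.
Proof. exact: cvg_abs_unique. Qed.

Lemma csumD t t' s s' : csum t s -> csum t' s' -> csum (fun n => t n + t' n) (s + s').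
Proof. by move=> h h'; apply: eq_cvg_abs (cvg_absD h h') => n; rewrite big_split. Qed.

Lemma csumZ c t s : csum t s -> csum (fun n => c * t n) (c * s).
Proof. by move/(cvg_absZ c); apply: eq_cvg_abs => n; rewrite mulr_sumr. Qed.

Lemma csum_bigsum I (r : seq I) (P : pred I) (t : I -> nat -> C) s :
  (forall i, P i -> csum (t i) (s i)) ->
  csum (fun n => \sum_(i <- r | P i) t i n) (\sum_(i <- r | P i) s i).
Proof.
move=> h; apply: eq_cvg_abs (@cvg_abs_sum _ r P (fun j n => \sum_(i < n) t j i) s h) => n.
by rewrite exchange_big.
Qed.

Lemma csum_tail t s N M : 0 <= M -> csum t s -> (forall n, (N <= n)%N -> abs (t n) <= M) ->
  abs (s - \sum_(i < N) t i) <= M.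
Proof.
move=> M0 h tM; apply: (@cvg_abs_le (fun n => \sum_(i < n) t i - \sum_(i < N) t i) _ N); last first.
  by apply: cvg_absB => //; exact: cvg_abs_cst.
move=> n Nn; rewrite sum_ord_sub//.
rewrite big_seq_cond; apply: abs_sum_le => // i; rewrite mem_index_iota andbT => /andP[Ni _].
exact: tM.
Qed.

Lemma csum_le t s M : 0 <= M -> csum t s -> (forall n, abs (t n) <= M) -> abs s <= M.
Proof.
by move=> M0 h tM; have := csum_tail (N := 0) M0 h (fun n _ => tM n); rewrite big_ord0 subr0.
Qed.

Lemma csum_shift t s k : csum t s ->
  csum (fun n => if (k <= n)%N then t (n - k)%N else 0) s.
Proof.
move=> /cvg_absP h; apply/cvg_absP => e e0; have [N hN] := h e e0.
exists (N + k)%N => n Nn; rewrite -(big_mkord xpredT (fun i => if (k <= i)%N then t (i - k)%N else 0)).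
rewrite (@big_cat_nat _ _ _ k)//=; last first.
  by apply: leq_trans Nn; rewrite leq_addl.
rewrite big_nat_cond big1 ?add0r => [|i /andP[/andP[_ ik] _]]; last by rewrite leqNgt ik.
rewrite -{1}[k]add0n big_addn.
under eq_bigr do rewrite leq_addl addnK.
by rewrite big_mkord; apply: hN; rewrite leq_subRL ?(addnC k)//; lia.
Qed.

Lemma csum_fin t N : (forall n, (N <= n)%N -> t n = 0) -> csum t (\sum_(i < N) t i).
Proof.
move=> t0; apply: (@cvg_abs_near (fun=> \sum_(i < N) t i) _ _ N); last exact: cvg_abs_cst.
move=> n Nn; apply/esym/eqP; rewrite -subr_eq0 sum_ord_sub// big_nat_cond big1//.
by move=> i /andP[/andP[/t0]].
Qed.

(* Terms of the Cauchy product that are missing from its partial sum have one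
   index at least N/2, so ultrametricity makes them uniformly small. *)
Lemma csumM a b s s' : csum a s -> csum b s' -> csum (fps_mul a b) (s * s').
Proof.
move=> ha hb; have := cvg_absM ha hb.
move=> hP; suff h0 : cvg_abs abs (fun n => \sum_(i < n) fps_mul a b i -
    (\sum_(i < n) a i) * (\sum_(i < n) b i)) 0.
  by have := cvg_absD h0 hP; rewrite add0r; apply: eq_cvg_abs => n; rewrite subrK.
have av := csum_vanish ha; have bv := csum_vanish hb.
have [A A0 hA] := vanish_bounded av; have [B B0 hB] := vanish_bounded bv.
apply/cvg_absP => e e0.
have [N hN] := av (e / B) (divr_gt0 e0 B0); have [M hM] := bv (e / A) (divr_gt0 e0 A0).
exists (N + M)%N => n NMn; rewrite subr0 -absN opprB.
have small i j : (n <= i + j)%N -> abs (a i * b j) < e.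
  move=> nij; rewrite (abs_mul absC); have [Ni|iN] := leqP N i.
    apply: (@le_lt_trans _ _ (abs (a i) * B)); first by rewrite ler_wpM2l ?abs_nonneg.
    by rewrite -ltr_pdivlMr// hN.
  apply: (@le_lt_trans _ _ (A * abs (b j))); first by rewrite ler_wpM2r ?abs_nonneg.
  by rewrite mulrC -ltr_pdivlMr// hM//; lia.
have -> : \sum_(i < n) fps_mul a b i = \sum_(i < n) \sum_(j < n | (i + j < n)%N) a i * b j.
  transitivity (\sum_(k < n) \sum_(i < n | (i <= k)%N) a i * b (k - i)%N).
    apply: eq_bigr => k _; rewrite /fps_mul.
    by rewrite (big_ord_widen_cond n xpredT (fun i => a i * b (k - i)%N)) //=; exact: ltn_ord.
  rewrite (exchange_big_dep xpredT)//=; apply: eq_bigr => i _.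
  rewrite -(big_mkord (fun k => (i <= k)%N) (fun k => a i * b (k - i)%N)).
  rewrite -(big_mkord (fun j => (i + j < n)%N) (fun j => a i * b j)).
  rewrite (@big_cat_nat _ _ _ i)//= ?(ltnW (ltn_ord i))//.
  rewrite big_nat_cond big1 ?add0r; last by move=> k /andP[/andP[_ ki]]; rewrite leqNgt ki.
  rewrite -{1}[val i]add0n big_addn.
  under eq_bigl do rewrite leq_addl.
  under eq_bigr do rewrite addnK.
  rewrite [RHS](@big_cat_nat _ _ _ (n - i))//= ?leq_subr//.
  rewrite [X in _ = _ + X]big_nat_cond [X in _ = _ + X]big1 ?addr0; last first.
    by move=> k /andP[/andP[h1 h2] h3]; exfalso; lia.
  by rewrite [RHS]big_nat_cond big_nat_cond; apply: eq_bigl => k; have := ltn_ord i; lia.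
rewrite mulr_suml -sumrB; apply: (@le_lt_trans _ _ (Num.max 0 (\big[Num.max/0]_(i < n) \big[Num.max/0]_(j < n | ~~ (i + j < n)%N) abs (a i * b j)))).
  apply: abs_sum_le => [|i _]; first by rewrite le_max lexx.
  rewrite mulr_sumr (bigID (fun j : 'I_n => (i + j < n)%N))/= addrC addrK.
  apply: abs_sum_le => [|j ij]; first by rewrite le_max lexx.
  rewrite le_max; apply/orP; right; apply: le_trans (le_bigmax _ _ i).
  exact: (le_bigmax_cond _ (fun j : 'I_n => abs (a i * b j))).
rewrite gt_max e0/=; apply: bigmax_lt => // i _; apply: bigmax_lt => // j ij.
by apply: small; rewrite leqNgt.
Qed.

Hypothesis complC : complete_abs abs.

(** A block of consecutive terms is no larger than its largest term, so the partial sums are Cauchy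
    as soon as the terms tend to 0. *)
Lemma vanish_csum t : vanish t -> exists s, csum t s.
Proof.
move=> tv; apply: complC => e e0; have [N hN] := tv e e0.
have le_case m n : (N <= m)%N -> (m <= n)%N -> abs (\sum_(i < m) t i - \sum_(i < n) t i) < e.
  move=> Nm mn; rewrite abs_distC sum_ord_sub//.
  apply: (@le_lt_trans _ _ (\big[Num.max/0]_(m <= i < n) abs (t i))).
    rewrite big_seq_cond; apply: abs_sum_le => [|i /andP[im _]]; first exact: bigmax_ge_id.
    exact: le_bigmax_seq im _.
  rewrite big_nat_cond; apply: bigmax_lt => // i /andP[/andP[mi _] _].
  by apply: hN; exact: leq_trans mi.
exists N => m n Nm Nn; have [mn|/ltnW nm] := leqP m n; first exact: le_case.
by rewrite abs_distC; exact: le_case.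
Qed.

End NonArch.

(** * Unconditional summation *)

Section USum.
Variables (R : realType) (C : fieldType) (abs : C -> R).
Hypothesis absC : nonarchimedean_abs abs.

(* Unconditional summation: the limit of the net of finite partial sums. *)
Definition usum (I : eqType) (t : I -> C) (s : C) :=
  forall e, 0 < e -> exists S0 : seq I, forall S, uniq S -> {subset S0 <= S} ->
    abs (\sum_(i <- S) t i - s) <= e.

Lemma usum_unique (I : eqType) (t : I -> C) s s' : usum t s -> usum t s' -> s = s'.
Proof.
move=> h h'; apply/eqP; rewrite -subr_eq0; apply/eqP; apply: (eq_abs0 absC) => e e0.
have [S0 hS] := h e e0; have [S1 hS'] := h' e e0.
pose S := undup (S0 ++ S1).
have -> : s - s' = (\sum_(i <- S) t i - s') - (\sum_(i <- S) t i - s) by ring.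
apply: (absB_le absC); [apply: hS'|apply: hS]; rewrite ?undup_uniq// => i iS;
  by rewrite mem_undup mem_cat iS ?orbT.
Qed.

Lemma eq_usum (I : eqType) (t t' : I -> C) s : t =1 t' -> usum t s -> usum t' s.
Proof.
move=> tt h e e0; have [S0 hS] := h e e0; exists S0 => S Su SS.
by under eq_bigr do rewrite -tt; exact: hS.
Qed.

Lemma usum_approx (I : eqType) (t : I -> C) s (S : seq I) M : 0 < M -> usum t s ->
  uniq S -> (forall i, i \notin S -> abs (t i) <= M) -> abs (\sum_(i <- S) t i - s) <= M.
Proof.
move=> M0 h Su tM; have [S0 hS] := h M M0.
pose S' := [seq i <- undup S0 | i \notin S].
have S'S : {in S', forall i, i \notin S} by move=> i; rewrite mem_filter => /andP[].
have -> : \sum_(i <- S) t i - s = (\sum_(i <- S ++ S') t i - s) - \sum_(i <- S') t i.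
  by rewrite big_cat/=; ring.
apply: (absB_le absC); last first.
  by apply: (abs_sum_le_in absC) => [|i /S'S]; [exact: ltW|exact: tM].
apply: hS => [|i iS0].
  rewrite cat_uniq Su filter_uniq ?undup_uniq//= andbT.
  by apply/hasPn => i /S'S.
by rewrite mem_cat mem_filter mem_undup iS0 andbT orbN.
Qed.

Lemma usum_reindex (I J : eqType) (h : I -> J) (g : J -> I) (t : J -> C) s :
  cancel h g -> cancel g h -> usum t s -> usum (t \o h) s.
Proof.
move=> hg gh ht e e0; have [S0 hS] := ht e e0; exists (map g S0) => S Su SS.
have -> : \sum_(i <- S) (t \o h) i = \sum_(i <- map h S) t i by rewrite big_map.
apply: hS; first by rewrite map_inj_uniq//; exact: can_inj hg.
move=> i iS; rewrite -[i]gh; apply/map_f/SS; exact: map_f.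
Qed.

Lemma usumZ (I : eqType) (t : I -> C) c s : usum t s -> usum (fun i => c * t i) (c * s).
Proof.
move=> h e e0; have [c0|c0] := eqVneq c 0.
  exists [::] => S _ _; rewrite big1 => [|i _]; last by rewrite c0 mul0r.
  by rewrite c0 mul0r subrr (abs0 absC) ltW.
have ac := abs_gt0 absC c0.
have [S0 hS] := h (e / abs c) (divr_gt0 e0 ac); exists S0 => S Su SS.
by rewrite -mulr_sumr -mulrBr (abs_mul absC) mulrC -ler_pdivlMr// hS.
Qed.

(** Fubini. For a finite set [S] of rows that contains those of [S0], one finite set [U] of columns
    is large enough for all rows of [S] and for [S0]; the sum over the rectangle [S] x [U] is then
    close both to [s] and to the sum of the row values. *)
Lemma usum_rows (I J : eqType) (t : I * J -> C) (row : I -> C) s :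
  usum t s -> (forall i, usum (fun j => t (i, j)) (row i)) -> usum row s.
Proof.
move=> h hrow e e0; have [S0 hS] := h e e0.
exists (map fst S0) => S Su SS.
have /choice[T hT] : forall i, exists T : seq J, forall T', uniq T' -> {subset T <= T'} ->
  abs (\sum_(j <- T') t (i, j) - row i) <= e by move=> i; exact: hrow.
pose U := undup (map snd S0 ++ flatten (map T S)).
have Uu : uniq U by exact: undup_uniq.
have -> : \sum_(i <- S) row i - s = (\sum_(i <- [seq (i, j) | i <- S, j <- U]) t i - s)
    - \sum_(i <- S) (\sum_(j <- U) t (i, j) - row i).
  by rewrite sumrB big_allpairs/=; ring.
apply: (absB_le absC).
  apply: hS => [|[i j] ijS].
    by apply: allpairs_uniq => // -[a b] [c d] _ _ [-> ->].
  apply/allpairsP; exists (i, j); split => //=.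
    by apply: SS; apply: (map_f fst ijS).
  by rewrite mem_undup mem_cat (map_f snd ijS).
apply: (abs_sum_le_in absC) => [|i iS]; first exact: ltW.
apply: hT => // j jT; rewrite mem_undup mem_cat; apply/orP; right.
by apply/flattenP; exists (T i) => //; exact: map_f.
Qed.

(** Passage from limits along an exhaustion by boxes, in which the lattice sums are computed, to
    unconditional sums, which can be reindexed and summed by rows. *)
Lemma cvg_usum (I : eqType) (t : I -> C) s (box : nat -> seq I) :
  (forall D, uniq (box D)) -> (forall D D', (D <= D')%N -> {subset box D <= box D'}) ->
  (forall e, 0 < e -> exists D, forall i, i \notin box D -> abs (t i) <= e) ->
  cvg_abs abs (fun D => \sum_(i <- box D) t i) s -> usum t s.
Proof.
move=> bu bmono tv /(cvg_absP absC) hc e e0.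
have [D1 hD1] := tv e e0; have [D2 hD2] := hc e e0.
pose D := maxn D1 D2; exists (box D) => S Su SS.
have -> : \sum_(i <- S) t i - s = \sum_(i <- [seq i <- S | i \notin box D]) t i + (\sum_(i <- box D) t i - s).
  rewrite big_filter addrA; congr (_ - _).
  rewrite (bigID (fun i => i \in box D))/= addrC; congr (_ + _).
  rewrite -big_filter; apply: perm_big; apply: uniq_perm; rewrite ?filter_uniq// => i.
  by rewrite mem_filter; case: (boolP (i \in box D)) => // /SS ->.
apply: (absD_le absC); last by apply/ltW/hD2; exact: leq_maxr.
apply: (abs_sum_le_in absC) => [|i]; first exact: ltW.
rewrite mem_filter => /andP[iD _]; apply: hD1; apply: contra iD.
by apply: bmono; exact: leq_maxl.
Qed.

Hypothesis complC : complete_abs abs.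

Lemma box_usum (I : eqType) (t : I -> C) (box : nat -> seq I) :
  (forall D, uniq (box D)) -> (forall D D', (D <= D')%N -> {subset box D <= box D'}) ->
  (forall e, 0 < e -> exists D, forall i, i \notin box D -> abs (t i) <= e) ->
  exists s, usum t s.
Proof.
move=> bu bmono tv.
have [s hs] : exists s, cvg_abs abs (fun D => \sum_(i <- box D) t i) s.
  apply: complC => e e0; have e20 : 0 < e / 2 by exact: divr_gt0.
  have [D hD] := tv _ e20; exists D.
  have key D' : (D <= D')%N -> abs (\sum_(i <- box D') t i - \sum_(i <- box D) t i) <= e / 2.
    move=> DD'; have -> : \sum_(i <- box D') t i - \sum_(i <- box D) t i =
        \sum_(i <- [seq i <- box D' | i \notin box D]) t i.
      apply/eqP; rewrite subr_eq big_filter addrC (bigID (fun i => i \in box D))/=.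
      rewrite -big_filter; apply/eqP; congr (_ + _).
      apply: perm_big; apply: uniq_perm; rewrite ?filter_uniq// => i.
      by rewrite mem_filter; case: (boolP (i \in box D)) => // /(bmono _ _ DD') ->.
    apply: (abs_sum_le_in absC) => [|i]; first exact: ltW.
    by rewrite mem_filter => /andP[/hD].
  move=> m n Dm Dn; apply: (@le_lt_trans _ _ (e / 2)).
    have -> : \sum_(i <- box m) t i - \sum_(i <- box n) t i =
      (\sum_(i <- box m) t i - \sum_(i <- box D) t i) - (\sum_(i <- box n) t i - \sum_(i <- box D) t i) by ring.
    by apply: (absB_le absC); exact: key.
  by rewrite ltr_pdivrMr// mulr_natr mulr2n ltrDl.
by exists s; exact: cvg_usum hs.
Qed.

End USum.

(** * The field [C_oo] is algebraically closed *)

(** Stated relative to a subset [S] in order to serve twice: for the elements algebraic over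
    F_q((1/theta)), where the existence of roots is part of [is_Cinf], and for the whole field once
    [Cinf_root] is available. *)
Lemma root_split (L : fieldType) (S : L -> Prop) :
  (forall p : {poly L}, (1 < size p)%N -> (forall i, S p`_i) ->
     exists2 x, S x & root p x) ->
  S 0 -> (forall x y, S x -> S y -> S (x + y)) -> (forall x y, S x -> S y -> S (x * y)) ->
  forall p : {poly L}, p != 0 -> (forall i, S p`_i) ->
  exists2 s, (forall x, x \in s -> S x) & p = lead_coef p *: \prod_(z <- s) ('X - z%:P).
Proof.
move=> rootS S0 SD SM p; have [n] := ubnP (size p); elim: n p => // n IH p pn p0 pS.
have [p1|p1] := leqP (size p) 1.
  exists [::] => //; rewrite big_nil; have -> := size1_polyC p1.
  by rewrite lead_coefC alg_polyC.
have [x xS px] := rootS p p1 pS.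
have [q pq] := factor_theorem p x px.
have q0 : q != 0 by apply: contraNneq p0 => q0; rewrite pq q0 mul0r.
have sq : size p = (size q).+1 by rewrite pq size_Mmonic ?monicXsubC// size_XsubC addn2.
have qE i : q`_i = p`_i.+1 + x * q`_i.+1.
  by rewrite {1}pq mulrBr coefB coefMX/= coefMC mulrC subrK.
(* Horner's scheme yields the coefficients of the quotient from the top down, using only sums and
   products. *)
have qS i : S q`_i.
  have [k] := ubnP (size q - i)%N; elim: k i => // k IHk i ki.
  have [iq|qi] := ltnP i (size q); last by rewrite nth_default.
  by rewrite qE; apply: SD => //; apply: SM => //; apply: IHk; lia.
have [|s sS qs] := IH q _ q0 qS; first by rewrite -ltnS -sq.
exists (x :: s) => [y|]; first by rewrite inE => /orP[/eqP ->|/sS].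
rewrite big_cons {1}pq {1}qs -scalerAl mulrC [in RHS]pq.
by rewrite lead_coef_Mmonic ?monicXsubC.
Qed.

Lemma prod_gt_expr (R : realType) (I : eqType) (t : seq I) (F : I -> R) c :
  0 < c -> t != [::] -> {in t, forall y, c < F y} -> c ^+ size t < \prod_(y <- t) F y.
Proof.
move=> c0; elim: t => // y t IH _ h; rewrite big_cons exprS.
have cy : c < F y by apply: h; exact: mem_head.
case: (eqVneq t [::]) => [->|t0]; first by rewrite expr0 big_nil !mulr1.
apply: ltr_pM; rewrite ?ltW ?exprn_gt0//; apply: IH => // z zt.
by apply: h; rewrite inE zt orbT.
Qed.

(** F_q((1/theta)) as a type of its own, so that the closure of algebraic elements under sums and
    products can be taken from [algebraicOver]. The proof [hC] is a parameter because the field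
    structure on this type is derived from it. *)
Record Kinf_type (R : realType) (Fq : finFieldType) (C : fieldType) (abs : C -> R)
    (iota : {rmorphism ratfun Fq -> C}) (hC : is_Cinf abs iota) :=
  InKinf { Kinf_val : C; Kinf_valP : Kinf_val \in [pred x | `[< Kinf abs iota x >]] }.

Section AlgClosed.
Variables (R : realType) (Fq : finFieldType) (C : fieldType) (abs : C -> R).
Variable (iota : {rmorphism ratfun Fq -> C}).
Hypothesis hC : is_Cinf abs iota.
Let absC := Cinf_abs hC.

Definition Kinf_pred of is_Cinf abs iota : {pred C} := [pred x | `[< Kinf abs iota x >]].

Lemma Kinf_iota x : Kinf abs iota (iota x).
Proof. by move=> e e0; exists (iota x); [exists x|rewrite subrr (abs0 absC)]. Qed.

Lemma KinfB x y : Kinf abs iota x -> Kinf abs iota y -> Kinf abs iota (x - y).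
Proof.
move=> hx hy e e0; have [_ [a _ <-] xa] := hx e e0; have [_ [b _ <-] yb] := hy e e0.
exists (iota (a - b)); first by exists (a - b).
have -> : x - y - iota (a - b) = (x - iota a) - (y - iota b) by rewrite rmorphB; ring.
exact: (absB_lt absC).
Qed.

Lemma Kinf_div x y : Kinf abs iota x -> Kinf abs iota y -> Kinf abs iota (x / y).
Proof.
move=> hx hy; have [->|y0] := eqVneq y 0.
  by rewrite invr0 mulr0; have := Kinf_iota 0; rewrite rmorph0.
have ay := abs_gt0 absC y0 => e e0.
pose B := Num.max (abs x) (abs y).
have B0 : 0 < B by rewrite lt_max ay orbT.
(* Since x/y - a/b = (y (x - a) - x (y - b)) / (y b) and |b| = |y|, this precision for a and b
   suffices. *)
pose e' := e * abs y ^+ 2 / B.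
have e'0 : 0 < e' by rewrite divr_gt0// mulr_gt0// exprn_gt0.
have [_ [a _ <-] xa] := hx e' e'0.
have [|_ [b _ <-] yb] := hy (Num.min e' (abs y)); first by rewrite lt_min e'0.
move: yb; rewrite lt_min => /andP[yb yb'].
have aby : abs (iota b) = abs y.
  have -> : iota b = y - (y - iota b) by ring.
  exact: (absB_isosceles absC).
have b0 : iota b != 0 by apply: (abs_neq0 absC); rewrite aby.
exists (iota (a / b)); first by exists (a / b).
have -> : x / y - iota (a / b) = (y * (x - iota a) - x * (y - iota b)) / (y * iota b).
  by rewrite fmorph_div; field; rewrite y0 b0.
rewrite (abs_mul absC) (absV absC) (abs_mul absC) aby -expr2 ltr_pdivrMr ?exprn_gt0//.
by apply: (absB_lt absC); rewrite (abs_mul absC);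
  (apply: (@le_lt_trans _ _ (B * _)); first (by apply: ler_wpM2r; [exact: (abs_nonneg absC)|rewrite /B le_max lexx ?orbT]));
  rewrite mulrC -ltr_pdivlMr.
Qed.

Lemma Kinf_divring_closed : divring_closed (Kinf_pred hC).
Proof.
have KP x : (x \in Kinf_pred hC) = `[< Kinf abs iota x >] by [].
split=> [|x y|x y]; rewrite !KP.
- by apply/asboolP; have := Kinf_iota 1; rewrite rmorph1.
- by move=> /asboolP hx /asboolP hy; apply/asboolP; exact: KinfB.
- by move=> /asboolP hx /asboolP hy; apply/asboolP; exact: Kinf_div.
Qed.
End AlgClosed.

HB.instance Definition _ (R : realType) (Fq : finFieldType) (C : fieldType) (abs : C -> R)
    (iota : {rmorphism ratfun Fq -> C}) (hC : is_Cinf abs iota) :=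
  GRing.isDivringClosed.Build C (Kinf_pred hC) (Kinf_divring_closed hC).

Section KinfField.
Variables (R : realType) (Fq : finFieldType) (C : fieldType) (abs : C -> R).
Variable (iota : {rmorphism ratfun Fq -> C}).
Variable hC : is_Cinf abs iota.
Local Notation KT := (Kinf_type hC).
HB.instance Definition _ := [isSub of KT for (@Kinf_val R Fq C abs iota hC)].
HB.instance Definition _ := [Choice of KT by <:].
HB.instance Definition _ :=
  GRing.SubChoice_isSubIntegralDomain.Build C (Kinf_pred hC) KT (Kinf_divring_closed hC).
HB.instance Definition _ := [SubIntegralDomain_isSubField of KT by <:].
End KinfField.

Section AlgClosed2.
Variables (R : realType) (Fq : finFieldType) (C : fieldType) (abs : C -> R).
Variable (iota : {rmorphism ratfun Fq -> C}).
Hypothesis hC : is_Cinf abs iota.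
Let absC := Cinf_abs hC.
Local Notation KT := (Kinf_type hC).
Local Notation valK := (val : {rmorphism KT -> C}).

Lemma algebraic_over_KinfP x : algebraic_over_Kinf abs iota x <-> algebraicOver valK x.
Proof.
split=> [[P [P0 PK] Px]|[P P0 Px]].
  pose k i : KT := @InKinf _ _ _ _ _ hC P`_i (introT (asboolP _) (PK i)).
  exists (\poly_(i < size P) k i).
    apply: contra_neq P0 => /polyP P0; apply/polyP => i; rewrite coef0.
    have := congr1 val (P0 i); rewrite coef_poly coef0; case: ltnP => //= iP _.
    by rewrite nth_default.
  suff -> : map_poly valK (\poly_(i < size P) k i) = P by [].
  apply/polyP => i; rewrite coef_map coef_poly; case: ltnP => //= iP.
  by rewrite nth_default.
exists (map_poly valK P) => //; split=> [|i]; first by rewrite map_poly_eq0.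
by rewrite coef_map; exact/asboolP/(valP P`_i).
Qed.

Local Notation T := (algebraic_over_Kinf abs iota).

Lemma algebraicD x y : T x -> T y -> T (x + y).
Proof. by move=> /algebraic_over_KinfP hx /algebraic_over_KinfP hy; apply/algebraic_over_KinfP/algebraic_add. Qed.

Lemma algebraicM x y : T x -> T y -> T (x * y).
Proof. by move=> /algebraic_over_KinfP hx /algebraic_over_KinfP hy; apply/algebraic_over_KinfP/algebraic_mul. Qed.

Lemma algebraic_zero : T 0.
Proof. exact/algebraic_over_KinfP/algebraic0. Qed.

Lemma poly_lipschitz (p : {poly C}) (B : R) : exists2 M, 0 < M &
  forall x y, abs x <= B -> abs y <= B -> abs (p.[x] - p.[y]) <= M * abs (x - y).
Proof.
elim/poly_ind: p => [|p c [M M0 IH]].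
  by exists 1 => // x y _ _; rewrite !horner0 subrr (abs0 absC) mul1r (abs_nonneg absC).
pose B' := Num.max B 1.
have [N N0 hN] : exists2 N, 0 < N & forall x, abs x <= B -> abs p.[x] <= N.
  have BB x : abs x <= B -> abs p.[x] <= Num.max (abs p.[0]) (M * B').
    move=> xB; rewrite -[p.[x]](subrK p.[0]) addrC.
    apply: le_trans (abs_ultra absC _ _) _; rewrite ge_max le_max lexx/=.
    rewrite le_max; apply/orP; right; apply: le_trans (IH x 0 xB _) _.
      by rewrite (abs0 absC); apply: le_trans xB; exact: (abs_nonneg absC).
    by rewrite subr0 ler_wpM2l ?(ltW M0)// /B' le_max xB.
  exists (Num.max (abs p.[0]) (M * B')) => //.
  by rewrite lt_max mulr_gt0 ?orbT// lt_max ltr01 orbT.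
exists (Num.max (M * B') N) => [|x y xB yB]; first by rewrite lt_max N0 orbT.
rewrite !hornerMXaddC.
have -> : p.[x] * x + c - (p.[y] * y + c) = (p.[x] - p.[y]) * x + p.[y] * (x - y) by ring.
apply: (absD_le absC); rewrite (abs_mul absC).
  apply: (@le_trans _ _ (M * abs (x - y) * B')).
    apply: ler_pM; rewrite ?(abs_nonneg absC) ?IH//.
    by rewrite le_max xB.
  by rewrite mulrAC ler_wpM2r ?(abs_nonneg absC)// le_max lexx.
by rewrite ler_wpM2r ?(abs_nonneg absC)// le_max hN ?orbT.
Qed.

Lemma horner_le (p : {poly C}) x M : (forall i, abs (p`_i * x ^+ i) <= M) -> 0 <= M ->
  abs p.[x] <= M.
Proof. by move=> pM M0; rewrite horner_coef; apply: (abs_sum_le absC). Qed.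

Lemma monic_root_bound (p : {poly C}) B x : 1 <= B -> p \is monic ->
  (forall i, abs p`_i <= B) -> root p x -> abs x <= B.
Proof.
move=> B1 pm pB /rootP px; rewrite leNgt; apply/negP => Bx.
have p0 := monic_neq0 pm; have x0 : 0 < abs x by apply: lt_trans Bx; apply: lt_le_trans B1.
have x1 : 1 <= abs x by apply: ltW; apply: le_lt_trans Bx.
move: px; rewrite horner_coef -(prednK (n := size p)) ?size_poly_gt0// big_ord_recr/=.
move/eqP; rewrite addrC addr_eq0 -lead_coefE (monicP pm) mul1r => /eqP h.
have : abs (x ^+ (size p).-1) < abs x ^+ (size p).-1.
  rewrite h (absN absC); case E: (size p).-1 => [|n].
    by rewrite big_ord0 (abs0 absC) expr0.
  apply: (@le_lt_trans _ _ (B * abs x ^+ n)); last by rewrite exprS ltr_pM2r ?exprn_gt0.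
  apply: (abs_sum_le absC) => [|i _]; first by rewrite mulr_ge0 ?exprn_ge0 ?(ltW x0)// (le_trans ler01).
  rewrite (abs_mul absC) (absX absC); apply: ler_pM; rewrite ?(abs_nonneg absC) ?exprn_ge0 ?(ltW x0)//.
  by apply: ler_weXn2l => //; have := ltn_ord i; lia.
by rewrite (absX absC) ltxx.
Qed.

(* Successive roots of ever better algebraic approximations of p can be chosen
   close to each other, hence converge to a root of p. *)
Theorem Cinf_root (P : {poly C}) : (1 < size P)%N -> exists x, root P x.
Proof.
move=> P1; have P0 : P != 0 by rewrite -size_poly_gt0; apply: leq_trans P1.
pose p := (lead_coef P)^-1 *: P.
have lP0 : lead_coef P != 0 by rewrite lead_coef_eq0.
have pm : p \is monic by rewrite monicE lead_coefZ mulVf.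
suff [x px] : exists x, root p x by exists x; move: px; rewrite rootZ ?invr_eq0.
have sp : size p = size P by rewrite size_scale ?invr_eq0.
pose n := (size p).-1; have spn : size p = n.+1 by rewrite /n prednK// sp (ltn_trans _ P1).
have n0 : (0 < n)%N by rewrite /n sp; case: (size P) P1 => [|[]].
pose B := \big[Num.max/1]_(i < n.+1) abs p`_i.
have B1 : 1 <= B by exact: bigmax_ge_id.
have B0 : 0 < B by exact: lt_le_trans B1.
have pB i : abs p`_i <= B.
  have [ni|ni] := ltnP i n.+1; last by rewrite nth_default ?spn// (abs0 absC) ltW.
  exact: (le_bigmax 1 (fun i : 'I_n.+1 => abs p`_i) (Ordinal ni)).
(* With this precision [Q m.+1] has absolute value at most 2^(-mn) at a root x of [Q m]; being a
   product of n linear factors there, it has a root within 2^(-m) of x. *)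
pose dl m : R := (2^-1 ^+ m) ^+ n / B ^+ n.
have dl0 m : 0 < dl m by rewrite divr_gt0 ?exprn_gt0 ?invr_gt0.
have dl1 m : dl m <= 1.
  rewrite ler_pdivrMr ?exprn_gt0// mul1r; apply: (@le_trans _ _ 1).
    by rewrite exprn_ile1 ?exprn_ge0 ?invr_ge0// exprn_ile1 ?invr_ge0// invf_le1// ler1n.
  exact: exprn_ege1.
have dlmono m m' : (m <= m')%N -> dl m' <= dl m.
  move=> mm; rewrite ler_wpM2r ?invr_ge0 ?exprn_ge0 ?(ltW B0)// lerXn2r ?nnegrE ?exprn_ge0 ?invr_ge0//.
  by rewrite ler_wiXn2l ?invr_ge0// invf_le1// ler1n.
have T1 : T 1 by apply/algebraic_over_KinfP/algebraic1.
have /choice[Q hQ] : forall m, exists q : {poly C},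
    [/\ q \is monic, size q = n.+1, forall i, T q`_i & forall i, abs (q`_i - p`_i) < dl m].
  move=> m; have /choice[c hc] : forall i, exists y, T y /\ abs (p`_i - y) < dl m.
    move=> i; have : (closure_abs abs T) p`_i by rewrite (Cinf_dense hC).
    by move=> /(_ _ (dl0 m))[y Ty yp]; exists y.
  pose d i := if i == n then 1 else c i.
  have pn1 : p`_n = 1 by have := monicP pm; rewrite lead_coefE spn.
  have sq : size (\poly_(i < n.+1) d i) = n.+1 by rewrite size_poly_eq// /d eqxx oner_neq0.
  exists (\poly_(i < n.+1) d i); split=> //.
  - by rewrite monicE lead_coefE sq/= coef_poly ltnSn /d eqxx.
  - move=> i; rewrite coef_poly; case: ifP => _; last exact: algebraic_zero.
    by rewrite /d; case: eqP => // _; have [] := hc i.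
  - move=> i; rewrite coef_poly /d; case: eqP => [->|_].
      by rewrite ltnSn pn1 subrr (abs0 absC).
    case: ltnP => [_|ni]; first by rewrite (abs_distC absC); have [] := hc i.
    by rewrite [p`_i]nth_default ?spn// subrr (abs0 absC).
have QB m i : abs (Q m)`_i <= B.
  have [_ _ _ /(_ i) h] := hQ m; rewrite -[(Q m)`_i](subrK p`_i).
  by apply: (absD_le absC) => //; apply: le_trans (ltW h) (le_trans (dl1 m) B1).
have close m m' x : root (Q m) x -> (m <= m')%N -> abs (Q m').[x] <= dl m * B ^+ n.
  move=> qx mm; have [qm sq _ hq] := hQ m; have [qm' sq' _ hq'] := hQ m'.
  have xB := monic_root_bound B1 qm (QB m) qx.
  have -> : (Q m').[x] = (Q m' - Q m).[x] by rewrite hornerD hornerN (rootP qx) subr0.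
  apply: horner_le => [i|]; last by rewrite mulr_ge0 ?exprn_ge0 ?ltW.
  rewrite (abs_mul absC) (absX absC) coefB.
  have [ni|ni] := ltnP n i.
    by rewrite !nth_default ?sq ?sq'// subrr (abs0 absC) mul0r mulr_ge0 ?exprn_ge0 ?ltW.
  apply: ler_pM; rewrite ?(abs_nonneg absC) ?exprn_ge0 ?(abs_nonneg absC)//.
    have -> : (Q m')`_i - (Q m)`_i = ((Q m')`_i - p`_i) - ((Q m)`_i - p`_i) by ring.
    by apply: (absB_le absC); [apply: le_trans (ltW (hq' i)) (dlmono _ _ mm)|exact: ltW].
  apply: le_trans (_ : B ^+ i <= _); first by rewrite lerXn2r ?nnegrE ?(abs_nonneg absC)// ltW.
  exact: ler_weXn2l.
have next m x : root (Q m) x -> exists y, root (Q m.+1) y /\ abs (x - y) <= 2^-1 ^+ m.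
  move=> qx; have [qm sq qT hq] := hQ m.+1.
  have [s sT qs] := root_split (Cinf_closed hC) algebraic_zero algebraicD algebraicM (monic_neq0 qm) qT.
  move: qs; rewrite (monicP qm) scale1r => qs.
  have ss : size s = n.
    by apply: succn_inj; rewrite -sq qs size_prod_seq ?size_XsubC => [|i _]; rewrite ?polyXsubC_eq0//;
      under eq_bigr do rewrite size_XsubC; rewrite big_const_seq count_predT iter_addn_0; lia.
  have := close m m.+1 x qx (leqnSn m); rewrite /dl divfK ?expf_neq0 ?gt_eqF//.
  rewrite {1}qs horner_prod (abs_prod absC) => small.
  have [y ys xy] : exists2 y, y \in s & abs (x - y) <= 2^-1 ^+ m.
    apply: contrapT => hno; move: small; apply/negP; rewrite -ltNge -ss.
    under [X in _ < X]eq_bigr do rewrite hornerXsubC.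
    have s0 : s != [::] by case: (s) ss n0 => // <-.
    have p0' : (0 : R) < 2^-1 ^+ m by rewrite exprn_gt0 ?invr_gt0.
    apply: (prod_gt_expr p0' s0) => y ys.
    by rewrite ltNge; apply/negP => h; apply: hno; exists y.
  by exists y; split=> //; rewrite qs root_prod_XsubC.
have [x0 qx0] : exists x, root (Q 0%N) x.
  have [qm sq qT _] := hQ 0%N; have Q1 : (1 < size (Q 0%N))%N by rewrite sq.
  by have [x _ qx] := Cinf_closed hC Q1 qT; exists x.
have /choice[nx hnx] : forall mx : nat * C, exists y, root (Q mx.1) mx.2 ->
    root (Q mx.1.+1) y /\ abs (mx.2 - y) <= 2^-1 ^+ mx.1.
  move=> [m x]; have [qx|qx] := boolP (root (Q m) x); last by exists 0 => h; case/negP: qx.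
  by have [y hy] := next m x qx; exists y.
pose xs := fix xs m := if m is m'.+1 then nx (m', xs m') else x0.
have xsr m : root (Q m) (xs m) by elim: m => [//|m IH]; exact: (hnx (m, xs m) IH).1.
have xsc m : abs (xs m - xs m.+1) <= 2^-1 ^+ m by exact: (hnx (m, xs m) (xsr m)).2.
have pw e : 0 < e -> exists N, forall m, (N <= m)%N -> (2^-1 : R) ^+ m < e.
  move=> e0; have /cvgrPdist_lt/(_ e e0)[N _ hN] : ((fun m => (2^-1 : R) ^+ m) @ \oo --> (0 : R))%classic.
    by apply: cvg_expr; rewrite ger0_norm ?invr_ge0// invf_lt1// ltr1n.
  by exists N => m Nm; have := hN m Nm; rewrite sub0r normrN ger0_norm ?exprn_ge0 ?invr_ge0.
have xsc' N m : (N <= m)%N -> abs (xs m - xs N) <= 2^-1 ^+ N.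
  move=> /subnK <-; elim: (m - N)%N => [|k IH].
    by rewrite subrr (abs0 absC) exprn_ge0 ?invr_ge0.
  rewrite addSn -[xs (k + N).+1](subrK (xs (k + N)%N)) -addrA; apply: (absD_le absC) => //.
  rewrite (abs_distC absC); apply: le_trans (xsc _) _.
  by rewrite ler_wiXn2l ?invr_ge0 ?leq_addl// invf_le1// ler1n.
have [x xl] : exists x, cvg_abs abs xs x.
  apply: (Cinf_complete hC) => e e0; have [N hN] := pw e e0; exists N => i j Ni Nj.
  have -> : xs i - xs j = (xs i - xs N) - (xs j - xs N) by ring.
  by apply: (absB_lt absC); apply: le_lt_trans (xsc' _ _ _) (hN N _).
exists x; apply/rootP/(cvg_abs_unique absC (cvg_abs_poly absC p xl)).
apply/(cvg_absP absC) => e e0; have [N hN] := pw _ (divr_gt0 e0 (exprn_gt0 n B0)).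
exists N => m Nm; rewrite subr0.
have [qm sq _ hq] := hQ m; have xB := monic_root_bound B1 qm (QB m) (xsr m).
have -> : p.[xs m] = (p - Q m).[xs m] by rewrite hornerD hornerN (rootP (xsr m)) subr0.
apply: (@le_lt_trans _ _ (dl m * B ^+ n)).
  apply: horner_le => [i|]; last by rewrite mulr_ge0 ?exprn_ge0 ?ltW.
  rewrite (abs_mul absC) (absX absC) coefB.
  have [ni|ni] := ltnP n i.
    by rewrite !nth_default ?sq ?spn// subrr (abs0 absC) mul0r mulr_ge0 ?exprn_ge0 ?ltW.
  apply: ler_pM; rewrite ?(abs_nonneg absC) ?exprn_ge0 ?(abs_nonneg absC)//.
    by rewrite (abs_distC absC) ltW.
  apply: le_trans (_ : B ^+ i <= _); first by rewrite lerXn2r ?nnegrE ?(abs_nonneg absC)// ltW.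
  exact: ler_weXn2l.
rewrite -ltr_pdivlMr ?exprn_gt0//; apply: le_lt_trans (hN m Nm).
rewrite /dl ler_pdivrMr ?exprn_gt0//.
apply: (@le_trans _ _ (2^-1 ^+ m * 1)).
  rewrite mulr1 -(prednK n0) exprS ler_piMr ?exprn_ge0 ?invr_ge0//.
  by rewrite exprn_ile1 ?exprn_ge0 ?invr_ge0// exprn_ile1 ?invr_ge0// invf_le1// ler1n.
by rewrite ler_pM2l ?exprn_gt0 ?invr_gt0// exprn_ege1.
Qed.

Lemma Cinf_split (p : {poly C}) : p != 0 ->
  exists s, p = lead_coef p *: \prod_(z <- s) ('X - z%:P).
Proof.
move=> p0; have [] := @root_split C (fun=> True) _ I _ _ p p0 (fun=> I) => // [q q1 _|s _ ps].
  by have [x qx] := Cinf_root q1; exists x.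
by exists s.
Qed.

Lemma Cinf_surjX n (a : C) : (0 < n)%N -> exists x, x ^+ n = a.
Proof.
move=> n0; have [|x] := @Cinf_root ('X^n - a%:P).
  by rewrite size_XnsubC.
by rewrite rootE !hornerE subr_eq0 => /eqP xa; exists x.
Qed.

End AlgClosed2.

(** * Hyperderivatives of rigid analytic functions *)

Section Jets.
Variables (R : realType) (Fq : finFieldType) (C : fieldType) (abs : C -> R).
Variable (iota : {rmorphism ratfun Fq -> C}).
Hypothesis hC : is_Cinf abs iota.
Let absC := Cinf_abs hC.
Local Notation q := #|Fq|.

Lemma card_Fq_gt1 : (1 < q)%N.
Proof. exact: finRing_gt1. Qed.

Lemma card_Fq_gt1R : 1 < q%:R :> R.
Proof. by rewrite ltr1n card_Fq_gt1. Qed.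

Lemma card_Fq_gt0R : 0 < q%:R :> R.
Proof. exact: lt_trans card_Fq_gt1R. Qed.

Lemma abs_theta : abs (iotaA iota 'X) = q%:R.
Proof. by rewrite (Cinf_norm hC) ?polyX_eq0// size_polyX expr1. Qed.

(** Integral powers of theta have n-th roots in the algebraically closed field, so all rational
    powers of q are absolute values, and these are dense. *)
Lemma abs_dense a b : 0 <= a -> a < b -> exists x, a < abs x < b.
Proof.
wlog a0 : a / 0 < a.
  move=> H; rewrite le_eqVlt => /orP[/eqP <-|a0] ab; last exact: H (ltW a0) ab.
  have b2 : 0 < b / 2 by exact: divr_gt0.
  have [|x /andP[x1 x2]] := H (b / 2) b2 (ltW b2).
    by rewrite ltr_pdivrMr// mulr_natr mulr2n ltrDl.
  by exists x; rewrite x2 andbT (lt_trans b2).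
move=> _ ab; have b0 := lt_trans a0 ab.
have lq : 0 < ln (q%:R : R) by rewrite ln_gt0// card_Fq_gt1R.
have [|c] := @rat_in_itvoo R (ln a / ln q%:R) (ln b / ln q%:R).
  by rewrite ltr_pM2r ?invr_gt0// ltr_ln.
rewrite in_itv/= ltr_pdivrMr// ltr_pdivlMr// => /andP[ac cb].
pose n := `|denq c|%N; have n0 : (0 < n)%N by rewrite absz_gt0 denq_eq0.
have t0 : iotaA iota 'X != 0 by apply: (abs_neq0 absC); rewrite abs_theta card_Fq_gt0R.
have [x xn] := Cinf_surjX hC (iotaA iota 'X ^ numq c) n0.
have x0 : x != 0.
  apply: contra_eq_neq xn => ->; rewrite expr0n eqn0Ngt n0/= eq_sym.
  by rewrite expfz_neq0.
have ax := abs_gt0 absC x0.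
have absZ (y : C) (k : int) : abs (y ^ k) = abs y ^ k.
  by case: k => k; rewrite ?NegzE -?exprnP -?exprnN ?(absV absC) (absX absC).
have lnZ (y : R) (k : int) : 0 < y -> ln (y ^ k) = ln y * k%:~R.
  move=> y0; case: k => k; first by rewrite -exprnP lnXn// -pmulrn mulr_natr.
  by rewrite NegzE -exprnN lnV ?posrE ?exprn_gt0// lnXn// mulrNz mulrN -pmulrn mulr_natr.
have lx : ln (abs x) = ratr c * ln q%:R.
  have := congr1 (fun y => ln (abs y)) xn.
  rewrite (absX absC) absZ abs_theta lnXn// lnZ ?card_Fq_gt0R// => h.
  have nR : (n%:R : R) != 0 by rewrite pnatr_eq0 -lt0n.
  apply: (mulIf nR); rewrite mulr_natr h -mulrA [in RHS]mulrC -mulrA; congr (_ * _).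
  rewrite /ratr mulrCA.
  suff -> : (n%:R : R) / (denq c)%:~R = 1 by rewrite mulr1.
  have -> : (denq c)%:~R = n%:R :> R by rewrite -[in LHS](gez0_abs (ltW (denq_gt0 c))) -pmulrn.
  by rewrite divff.
exists x; rewrite -(ltr_ln (x := a)) ?posrE// -[abs x < b]ltr_ln ?posrE//.
by rewrite lx ac cb.
Qed.

(** Factor by factor: every zero z of [Q] satisfies |x| < rho <= |z|, whence |x - z| = |z|. *)
Lemma polefree_abs (Q : {poly C}) (rho : R) :
  (forall x, abs x < rho -> Q.[x] != 0) -> forall x, abs x < rho -> abs Q.[x] = abs Q.[0].
Proof.
move=> Q0 x xr; have nzQ : Q != 0 by apply: contraTneq (Q0 x xr) => ->; rewrite horner0 eqxx.
have [s Qs] := Cinf_split hC nzQ.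
have zr z : z \in s -> rho <= abs z.
  move=> zs; rewrite leNgt; apply/negP => /Q0; rewrite Qs hornerZ horner_prod.
  by rewrite (big_rem z)//= hornerXsubC subrr mul0r mulr0 eqxx.
rewrite Qs !hornerZ !horner_prod !(abs_mul absC) !(abs_prod absC); congr (_ * _).
rewrite big_seq [RHS]big_seq; apply: eq_bigr => z /zr zr'.
rewrite !hornerXsubC sub0r (absN absC) (abs_distC absC) (absB_isosceles absC)//.
exact: lt_le_trans zr'.
Qed.

(** By density of the value group, [x] can be chosen with |x| < rho larger than [a], |x0| and the
    absolute values of all zeros in the disc. Each linear factor is then at least as large at [x] as
    at [x0]. *)
Lemma maximum_principle (p : {poly C}) (x0 : C) (rho a : R) :
  abs x0 < rho -> a < rho -> exists x, [/\ a < abs x, abs x < rho & abs p.[x0] <= abs p.[x]].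
Proof.
move=> x0r ar; have [p0|p0] := eqVneq p 0.
  have [||x /andP[h1 h2]] := @abs_dense (Num.max (abs x0) a) rho.
  - by rewrite le_max (abs_nonneg absC).
  - by rewrite gt_max x0r.
  by exists x; split=> //; [move: h1; rewrite gt_max => /andP[]|rewrite p0 !horner0].
have [s ps] := Cinf_split hC p0.
pose b := \big[Num.max/(Num.max (abs x0) a)]_(z <- s | abs z < rho) abs z.
have b0 : 0 <= b by apply: le_trans (bigmax_ge_id _ _ _ _); rewrite le_max (abs_nonneg absC).
have br : b < rho by apply: bigmax_lt; rewrite ?gt_max ?x0r.
have [x /andP[bx xr]] := abs_dense b0 br; exists x.
have /andP[x0x ax] : (abs x0 < abs x) && (a < abs x).
  by rewrite -gt_max; apply: le_lt_trans bx; exact: bigmax_ge_id.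
split=> //; rewrite ps !hornerZ !horner_prod !(abs_mul absC) !(abs_prod absC).
apply: ler_wpM2l; first exact: (abs_nonneg absC).
rewrite big_seq [X in _ <= X]big_seq; apply: ler_prod => z zs.
rewrite (abs_nonneg absC)/= !hornerXsubC.
have [zr|rz] := ltP (abs z) rho.
  have zx : abs z < abs x by apply: le_lt_trans bx; exact: le_bigmax_seq.
  by rewrite (absB_isosceles absC zx); apply: (absB_le absC); exact: ltW.
rewrite (abs_distC absC) (absB_isosceles absC (lt_le_trans x0r rz)).
by rewrite (abs_distC absC) (absB_isosceles absC (lt_le_trans xr rz)).
Qed.

(** The maximum principle moves the point so close to the boundary of the disc that dividing by it
    costs no more than the factor 1 / rho. *)
Lemma schwarz (P : {poly C}) (rho S : R) :
  0 < rho -> (forall x, abs x < rho -> abs (P.[x] * x) <= S) ->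
  forall x, abs x < rho -> abs P.[x] <= S / rho.
Proof.
move=> rho0 PS x xr; rewrite leNgt; apply/negP => Px.
have S0 : 0 <= S by apply: le_trans (PS 0 _); rewrite ?(abs_nonneg absC) ?(abs0 absC).
have Px0 : 0 < abs P.[x] by apply: le_lt_trans Px; rewrite divr_ge0// ltW.
have [|y [Sy yr Pxy]] := @maximum_principle P x rho (S / abs P.[x]) xr.
  by rewrite ltr_pdivrMr// mulrC -ltr_pdivrMr.
have := PS y yr; rewrite (abs_mul absC) leNgt => /negP; apply.
have y0 : 0 < abs y by apply: le_lt_trans Sy; rewrite divr_ge0// ltW.
apply: (@lt_le_trans _ _ (abs P.[x] * abs y)); last by rewrite ler_pM2r.
by rewrite mulrC -ltr_pdivrMr.
Qed.

(** Cauchy estimates for a fraction without poles in the disc. Taylor polynomial and remainder are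
    produced one coefficient at a time by dividing by X; |Q| is constant on the disc by
    [polefree_abs], so [schwarz] for the numerator bounds each quotient. Everything stays
    polynomial, so no power series are involved. *)
Lemma rat_jet (P Q : {poly C}) (rho S : R) r :
  0 < rho -> (forall x, abs x < rho -> Q.[x] != 0) ->
  (forall x, abs x < rho -> abs (P.[x] / Q.[x]) <= S) ->
  exists p P1 : {poly C}, [/\ (size p <= r)%N, forall j, abs p`_j <= S / rho ^+ j,
    P = p * Q + P1 * 'X^r & forall x, abs x < rho -> abs (P1.[x] / Q.[x]) <= S / rho ^+ r].
Proof.
move=> rho0 Q0 PS; have S0 : 0 <= S.
  by apply: le_trans (PS 0 _); rewrite ?(abs_nonneg absC) ?(abs0 absC).
elim: r => [|r [p [P1 [sp pS PE P1S]]]].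
  exists 0, P; split.
  - by rewrite size_poly0.
  - by move=> j; rewrite coef0 (abs0 absC) divr_ge0// exprn_ge0// ltW.
  - by rewrite mul0r add0r expr0 mulr1.
  - by move=> x xr; rewrite expr0 divr1 PS.
have Q00 : Q.[0] != 0 by apply: Q0; rewrite (abs0 absC).
pose a := P1.[0] / Q.[0].
have aS : abs a <= S / rho ^+ r by apply: P1S; rewrite (abs0 absC).
have /factor_theorem[P2 P2E] : root (P1 - a *: Q) 0.
  by rewrite rootE hornerD hornerN hornerZ divfK// subrr.
rewrite subr0 in P2E.
have P1E : P1 = P2 * 'X + a *: Q by rewrite -P2E subrK.
exists (p + a *: 'X^r), P2; split.
- apply: leq_trans (size_polyD _ _) _; rewrite geq_max (leqW sp).
  by apply: leq_trans (size_scale_leq _ _) _; rewrite size_polyXn.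
- move=> j; rewrite coefD coefZ coefXn; case: eqP => [->|_].
    by rewrite mulr1 nth_default// add0r.
  by rewrite mulr0 addr0.
- by rewrite PE P1E -!mul_polyC exprS; ring.
- move=> x xr; have Qx := Q0 x xr.
  rewrite (abs_mul absC) (absV absC) (polefree_abs Q0 xr).
  rewrite ler_pdivrMr ?(abs_gt0 absC)// exprSr invfM mulrA mulrAC.
  apply: (schwarz rho0) xr => y yr; have Qy := Q0 y yr.
  have -> : P2.[y] * y = P1.[y] - a * Q.[y] by rewrite P1E !hornerE; ring.
  rewrite -(polefree_abs Q0 yr) -ler_pdivrMr ?(abs_gt0 absC)// -(absV absC) -(abs_mul absC).
  by rewrite mulrBl mulfK//; apply: (absB_le absC) => //; exact: P1S.
Qed.

Definition bigO (r : nat) (F : C -> C) := exists2 rho, 0 < rho & exists2 M, 0 < M &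
  forall x, abs x < rho -> abs (F x) <= M * abs x ^+ r.

Lemma eq_bigO r F G : (exists2 rho, 0 < rho & forall x, abs x < rho -> F x = G x) ->
  bigO r F -> bigO r G.
Proof.
move=> [s s0 FG] [rho rho0 [M M0 hM]].
exists (Num.min rho s); first by rewrite lt_min rho0.
by exists M => // x; rewrite lt_min => /andP[xr xs]; rewrite -FG// hM.
Qed.

Lemma bigOD r F G : bigO r F -> bigO r G -> bigO r (fun x => F x + G x).
Proof.
move=> [rho rho0 [M M0 hM]] [s s0 [N N0 hN]].
exists (Num.min rho s); first by rewrite lt_min rho0.
exists (Num.max M N); first by rewrite lt_max M0.
move=> x; rewrite lt_min => /andP[xr xs].
apply: (absD_le absC); [apply: le_trans (hM x xr) _|apply: le_trans (hN x xs) _];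
  by rewrite ler_wpM2r ?exprn_ge0 ?(abs_nonneg absC)// le_max lexx ?orbT.
Qed.

Lemma bigOM r s F G : bigO r F -> bigO s G -> bigO (r + s) (fun x => F x * G x).
Proof.
move=> [rho rho0 [M M0 hM]] [t t0 [N N0 hN]].
exists (Num.min rho t); first by rewrite lt_min rho0.
exists (M * N) => [|x]; first exact: mulr_gt0.
rewrite lt_min => /andP[xr xs]; rewrite (abs_mul absC) exprD mulrACA.
by apply: ler_pM; rewrite ?(abs_nonneg absC) ?hM ?hN.
Qed.

Lemma bigO_le r s F : (s <= r)%N -> bigO r F -> bigO s F.
Proof.
move=> sr [rho rho0 [M M0 hM]]; exists (Num.min rho 1); first by rewrite lt_min rho0/=.
exists M => // x; rewrite lt_min => /andP[xr x1]; apply: le_trans (hM x xr) _.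
by rewrite ler_pM2l// ler_wiXn2l ?(abs_nonneg absC)// ltW.
Qed.

Lemma bigO_poly (p : {poly C}) : bigO 0 (fun x => p.[x]).
Proof.
have [M M0 hM] := poly_lipschitz hC p 1; exists 1 => //.
exists (Num.max M (abs p.[0])) => [|x x1]; first by rewrite lt_max M0.
rewrite expr0 mulr1 -[p.[x]](subrK p.[0]); apply: le_trans (abs_ultra absC _ _) _.
rewrite ge_max !le_max lexx orbT andbT; apply/orP; left.
apply: le_trans (hM x 0 (ltW x1) _) _; first by rewrite (abs0 absC).
by rewrite subr0 ler_piMr// ltW.
Qed.

Lemma bigO_X : bigO 1 id.
Proof. by exists 1 => //; exists 1 => // x _; rewrite mul1r expr1. Qed.

Lemma bigO_Xn r : bigO r (fun x => x ^+ r).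
Proof. by exists 1 => //; exists 1 => // x _; rewrite mul1r (absX absC). Qed.

Lemma bigO_cst c : bigO 0 (fun=> c).
Proof. by have := bigO_poly c%:P; apply: eq_bigO; exists 1 => // x _; rewrite hornerC. Qed.

Lemma bigOZ r c F : bigO r F -> bigO r (fun x => c * F x).
Proof. by move=> h; have := bigOM (bigO_cst c) h; rewrite add0n. Qed.

Lemma bigOB r F G : bigO r F -> bigO r G -> bigO r (fun x => F x - G x).
Proof.
move=> hF /(bigOZ (-1)) hG; have := bigOD hF hG; apply: eq_bigO.
by exists 1 => // x _; rewrite mulN1r.
Qed.

Lemma bigO_sum r I (s : seq I) (P : pred I) (F : I -> C -> C) :
  (forall i, P i -> bigO r (F i)) -> bigO r (fun x => \sum_(i <- s | P i) F i x).
Proof.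
move=> h; elim: s => [|i s IH].
  exists 1 => //; exists 1 => // x _; rewrite big_nil (abs0 absC).
  by rewrite mul1r exprn_ge0// (abs_nonneg absC).
case: (boolP (P i)) => Pi.
  by apply: eq_bigO (bigOD (h i Pi) IH); exists 1 => // x _; rewrite big_cons Pi.
by apply: eq_bigO IH; exists 1 => // x _; rewrite big_cons (negbTE Pi).
Qed.

Lemma bigO_poly_coef r (p : {poly C}) : bigO r (fun x => p.[x]) ->
  forall j, (j < r)%N -> p`_j = 0.
Proof.
move=> [rho rho0 [M M0 hM]] j; elim/ltn_ind: j => j IH jr.
apply/eqP; apply: contraT => pj.
have [p1 pE] : exists p1, p = p1 * 'X^j.
  exists (drop_poly j p); rewrite -[LHS](poly_take_drop j) (_ : take_poly j p = 0) ?add0r//.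
  apply/polyP => i; rewrite coef_take_poly coef0; case: ltnP => // ij.
  by apply: IH => //; exact: ltn_trans jr.
have c0 : p1.[0] = p`_j by rewrite pE coefMXn ltnn subnn horner_coef0.
have [L L0 hL] := poly_lipschitz hC p1 1.
have aj := abs_gt0 absC pj.
pose b := Num.min (Num.min rho 1) (Num.min (abs p`_j / L) (abs p`_j / M)).
have b0 : 0 < b by rewrite !lt_min rho0 ltr01 !divr_gt0.
have [x /andP[x0 xb]] := abs_dense (lexx 0) b0.
move: xb; rewrite !lt_min => /andP[/andP[xr x1] /andP[xL xM]].
have p1x : abs p1.[x] = abs p`_j.
  rewrite -c0 -[p1.[x]](subrK p1.[0]) addrC (abs_isosceles absC)// c0 -c0.
  apply: le_lt_trans (hL x 0 (ltW x1) _) _; first by rewrite (abs0 absC).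
  by rewrite subr0 mulrC -ltr_pdivlMr// c0.
have := hM x xr; rewrite pE hornerM hornerXn (abs_mul absC) (absX absC) p1x leNgt => /negP hn; exfalso; apply: hn.
rewrite -(subnK (ltnW jr)) exprD mulrA ltr_pM2r ?exprn_gt0//.
rewrite -(prednK (n := (r - j)%N)) ?subn_gt0// exprS mulrA.
apply: (@le_lt_trans _ _ (M * abs x)).
  by rewrite ler_piMr ?mulr_ge0 ?(ltW M0) ?(ltW x0)// exprn_ile1 ?(ltW x0) ?(ltW x1).
by rewrite mulrC -ltr_pdivlMr.
Qed.

Lemma bigO_poly_unique r F (p p' : {poly C}) : bigO r (fun x => F x - p.[x]) ->
  bigO r (fun x => F x - p'.[x]) -> forall j, (j < r)%N -> p`_j = p'`_j.
Proof.
move=> hp hp' j jr; apply/eqP; rewrite -subr_eq0 -coefB; apply/eqP.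
apply: (bigO_poly_coef _ jr); have := bigOB hp' hp; apply: eq_bigO.
by exists 1 => // x _; rewrite hornerD hornerN; ring.
Qed.

Definition disc_analytic (rho : R) (h : C -> C) := forall e, 0 < e -> exists P Q : {poly C},
  forall x, abs x < rho -> Q.[x] != 0 /\ abs (h x - P.[x] / Q.[x]) <= e.

(** Cauchy estimates for a uniform limit of fractions. The difference of two approximants is again a
    fraction without poles, and [rat_jet] for it shows that each Taylor coefficient of the
    approximants is a Cauchy sequence. *)
Lemma jet_bound (h : C -> C) rho S r : 0 < rho -> 0 < S -> disc_analytic rho h ->
  (forall x, abs x < rho -> abs (h x) <= S) ->
  exists p : {poly C}, [/\ (size p <= r)%N, forall j, abs p`_j <= S / rho ^+ j &
    forall x, abs x < rho -> abs (h x - p.[x]) <= S / rho ^+ r * abs x ^+ r].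
Proof.
move=> rho0 S0 han hS.
(* The errors do not exceed [S], so the approximants inherit the bound [S]. *)
pose e i : R := S / i.+1%:R.
have e0 i : 0 < e i by rewrite divr_gt0.
have eS i : e i <= S by rewrite ler_pdivrMr// ler_peMr ?ler1n// ltW.
have emono i j : (i <= j)%N -> e j <= e i.
  by move=> ij; rewrite ler_pM2l// lef_pV2 ?posrE// ler_nat.
have /choice[PQ hPQ] : forall i, exists PQ : {poly C} * {poly C}, forall x, abs x < rho ->
    PQ.2.[x] != 0 /\ abs (h x - PQ.1.[x] / PQ.2.[x]) <= e i.
  by move=> i; have [P [Q hPQ]] := han (e i) (e0 i); exists (P, Q).
pose f i x := (PQ i).1.[x] / (PQ i).2.[x].
have fS i x : abs x < rho -> abs (f i x) <= S.
  move=> xr; have [_ hf] := hPQ i x xr; have -> : f i x = h x - (h x - f i x) by ring.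
  by apply: (absB_le absC); [exact: hS|exact: le_trans (eS i)].
have Q0 i x : abs x < rho -> (PQ i).2.[x] != 0 by move=> /(hPQ i)[].
have /choice[p hp] : forall i, exists p : {poly C}, [/\ (size p <= r)%N,
    forall j, abs p`_j <= S / rho ^+ j &
    forall x, abs x < rho -> abs (f i x - p.[x]) <= S / rho ^+ r * abs x ^+ r].
  move=> i; have [p [P1 [sp pS PE P1S]]] := rat_jet r rho0 (Q0 i) (fS i).
  exists p; split=> // x xr; have Qx := Q0 i x xr.
  rewrite /f PE hornerD !hornerM hornerXn mulrDl mulfK// addrC addKr mulrAC (abs_mul absC) (absX absC).
  by rewrite ler_wpM2r ?exprn_ge0 ?(abs_nonneg absC)// P1S.
have M0 : 0 < S / rho ^+ r by rewrite divr_gt0// exprn_gt0.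
have bigOp i : bigO r (fun x => f i x - (p i).[x]).
  by exists rho => //; exists (S / rho ^+ r) => //; have [_ _] := hp i.
have pc i i' j : (i <= i')%N -> abs ((p i)`_j - (p i')`_j) <= e i / rho ^+ j.
  move=> ii'; have [rj|jr] := leqP r j.
    have [s1 _ _] := hp i; have [s2 _ _] := hp i'.
    by rewrite !nth_default ?(leq_trans _ rj)// subrr (abs0 absC) divr_ge0 ?exprn_ge0// ltW.
  pose P2 := (PQ i).1 * (PQ i').2 - (PQ i').1 * (PQ i).2.
  pose Q2 := (PQ i).2 * (PQ i').2.
  have f2 x : abs x < rho -> P2.[x] / Q2.[x] = f i x - f i' x.
    move=> xr; have h1 := Q0 i x xr; have h2 := Q0 i' x xr.
    by rewrite /f !hornerE; field; rewrite h1 h2.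
  have Q20 x : abs x < rho -> Q2.[x] != 0.
    by move=> xr; rewrite hornerM mulf_neq0// Q0.
  have P2S x : abs x < rho -> abs (P2.[x] / Q2.[x]) <= e i.
    move=> xr; rewrite f2//; have [_ h1] := hPQ i x xr; have [_ h2] := hPQ i' x xr.
    have -> : f i x - f i' x = (h x - f i' x) - (h x - f i x) by ring.
    by apply: (absB_le absC) => //; exact: le_trans h2 (emono _ _ ii').
  have [p2 [P1 [sp pS PE P1S]]] := rat_jet r rho0 Q20 P2S.
  rewrite -coefB (_ : (p i - p i')`_j = p2`_j)//.
  apply: (@bigO_poly_unique r (fun x => f i x - f i' x)) jr.
    apply: eq_bigO (bigOB (bigOp i) (bigOp i')); exists 1 => // x _.
    by rewrite hornerD hornerN; ring.
  apply: (@eq_bigO r (fun x => P1.[x] / Q2.[x] * x ^+ r)).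
    exists rho => // x xr; rewrite -f2// PE hornerD (hornerM p2 Q2 x) (hornerM P1 'X^r x) hornerXn.
    by rewrite mulrDl mulfK ?Q20// [p2.[x] + _]addrC addrK mulrAC.
  exists rho => //; exists (e i / rho ^+ r); first by rewrite divr_gt0// exprn_gt0.
  by move=> x xr; rewrite (abs_mul absC) (absX absC) ler_wpM2r ?exprn_ge0 ?(abs_nonneg absC)// P1S.
have ecvg d : 0 < d -> exists N, forall i, (N <= i)%N -> e i < d.
  move=> d0; have := archi_boundP (ltW (divr_gt0 S0 d0)); set N := Num.bound _ => hN.
  exists N => i Ni; rewrite /e ltr_pdivrMr// mulrC -ltr_pdivrMr//.
  by apply: lt_le_trans hN _; rewrite ler_nat leqW.
have /choice[c hc] : forall j, exists c, cvg_abs abs (fun i => (p i)`_j) c.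
  move=> j; apply: (Cinf_complete hC) => d d0.
  have [N hN] := ecvg (d * rho ^+ j) (mulr_gt0 d0 (exprn_gt0 _ rho0)).
  exists N => i i' Ni Ni'.
  have -> : (p i)`_j - (p i')`_j = ((p N)`_j - (p i')`_j) - ((p N)`_j - (p i)`_j) by ring.
  have small k : (N <= k)%N -> abs ((p N)`_j - (p k)`_j) < d.
    move=> Nk; apply: le_lt_trans (pc _ _ _ Nk) _.
    by rewrite ltr_pdivrMr ?exprn_gt0//; exact: hN.
  by apply: (absB_lt absC); exact: small.
exists (\poly_(j < r) c j); split.
- exact: size_poly.
- move=> j; rewrite coef_poly; case: ifP => _; last by rewrite (abs0 absC) ltW// divr_gt0// exprn_gt0.
  by apply: (cvg_abs_le absC (N := 0)) (hc j) => i _; have [_ ->] := hp i.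
- move=> x xr; apply: (cvg_abs_le absC (x := fun i => f i x - (p i).[x]) (N := 0)).
    by move=> i _; have [_ _ ->] := hp i.
  apply: (cvg_absB absC).
    apply/(cvg_absP absC) => d d0; have [N hN] := ecvg d d0; exists N => i Ni.
    by rewrite (abs_distC absC); have [_ h1] := hPQ i x xr; apply: le_lt_trans h1 (hN i Ni).
  rewrite horner_poly.
  apply: (@eq_cvg_abs _ _ _ absC (fun i => \sum_(j < r) (p i)`_j * x ^+ j)) => [i|].
    by rewrite (@horner_coef_wide _ r)//; have [] := hp i.
  apply: (@cvg_abs_sum _ _ _ absC _ _ xpredT (fun (j : 'I_r) i => (p i)`_j * x ^+ j)
    (fun j => c j * x ^+ j)) => j _.
  by apply: (cvg_absM absC) => //; exact: (cvg_abs_cst absC).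
Qed.

End Jets.

(** * Rigid analytic functions on Omega and their Taylor expansions *)

Section Rigid.
Variables (R : realType) (Fq : finFieldType) (C : fieldType) (abs : C -> R).
Variable (iota : {rmorphism ratfun Fq -> C}).
Hypothesis hC : is_Cinf abs iota.
Let absC := Cinf_abs hC.
Local Notation q := #|Fq|.
Local Notation aff := (Omega_aff abs iota).
Local Notation bigO := (bigO abs).

Lemma qn_gt0 n : 0 < q%:R ^- n :> R.
Proof. by rewrite invr_gt0 exprn_gt0// (card_Fq_gt0R R Fq). Qed.

Lemma Omega_aff_disc n z x : aff n z -> abs x < q%:R ^- n -> aff n (z + x).
Proof.
move=> [zn zK] xn; split.
  apply: (absD_le absC) => //; apply: le_trans (ltW xn) _.
  have q1 := ltW (card_Fq_gt1R R Fq).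
  apply: (@le_trans _ _ 1); last exact: exprn_ege1.
  by rewrite invf_le1 ?exprn_ege1// exprn_gt0// (card_Fq_gt0R R Fq).
move=> y yK; have -> : z + x - y = (z - y) + x by ring.
by rewrite (abs_isosceles absC) ?zK//; apply: lt_le_trans xn _; exact: zK.
Qed.

Lemma Omega_aff_Omega n z : aff n z -> Omega abs iota z.
Proof.
by move=> [_ zK] /zK; rewrite subrr (abs0 absC) leNgt qn_gt0.
Qed.

Lemma expq_unbounded (B : R) : exists n, B < q%:R ^+ n.
Proof.
exists (Num.bound `|B|); apply: le_lt_trans (ler_norm _) _.
apply: lt_le_trans (archi_boundP (normr_ge0 B)) _.
rewrite -natrX ler_nat; apply: ltnW; apply: ltn_expl; exact: finRing_gt1.
Qed.

Lemma Omega_exhausted z : Omega abs iota z -> exists n, aff n z.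
Proof.
move=> zO.
have [d d0 dz] : exists2 d, 0 < d & forall x, Kinf abs iota x -> d <= abs (z - x).
  apply: contrapT => H; apply: zO => e e0; apply: contrapT => H2; apply: H.
  exists e => // x xK; rewrite leNgt; apply/negP => zx.
  have e1 : 0 < Num.min e (e - abs (z - x)) by rewrite lt_min e0 subr_gt0.
  have [y yr xy] := xK _ e0; apply: H2; exists y => //.
  have -> : z - y = (z - x) + (x - y) by ring.
  exact: (absD_lt absC).
have [n1 h1] := expq_unbounded (abs z); have [n2 h2] := expq_unbounded d^-1.
have q1 := ltW (card_Fq_gt1R R Fq).
exists (maxn n1 n2); split.
  by apply: le_trans (ltW h1) _; apply: ler_weXn2l => //; exact: leq_maxl.
move=> x /dz; apply: le_trans; rewrite -[d]invrK lef_pV2 ?posrE ?invr_gt0 ?exprn_gt0 ?(card_Fq_gt0R R Fq)//.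
by apply: le_trans (ltW h2) _; apply: ler_weXn2l => //; exact: leq_maxr.
Qed.

Definition rational_on n (f : C -> C) := exists P Q : {poly C}, forall z, aff n z ->
  Q.[z] != 0 /\ f z = P.[z] / Q.[z].

Lemma eq_rational_on n f g : (forall z, aff n z -> f z = g z) ->
  rational_on n f -> rational_on n g.
Proof. by move=> fg [P [Q h]]; exists P, Q => z zn; have [? e] := h z zn; rewrite -fg. Qed.

Lemma rational_on_poly n (P : {poly C}) : rational_on n (fun z => P.[z]).
Proof. by exists P, 1 => z _; rewrite hornerC divr1 oner_neq0. Qed.

Lemma rational_on_cst n c : rational_on n (fun=> c).
Proof. by apply: eq_rational_on (rational_on_poly n c%:P) => z _; rewrite hornerC. Qed.

Lemma rational_onV n (P : {poly C}) : (forall z, aff n z -> P.[z] != 0) ->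
  rational_on n (fun z => P.[z]^-1).
Proof. by move=> P0; exists 1, P => z /P0 ?; rewrite hornerC div1r. Qed.

Lemma rational_onD n f g : rational_on n f -> rational_on n g ->
  rational_on n (fun z => f z + g z).
Proof.
move=> [P [Q h]] [P' [Q' h']]; exists (P * Q' + P' * Q), (Q * Q') => z zn.
have [Q0 ->] := h z zn; have [Q'0 ->] := h' z zn.
by rewrite !hornerE mulf_neq0//; split=> //; field; rewrite Q0 Q'0.
Qed.

Lemma rational_onM n f g : rational_on n f -> rational_on n g ->
  rational_on n (fun z => f z * g z).
Proof.
move=> [P [Q h]] [P' [Q' h']]; exists (P * P'), (Q * Q') => z zn.
have [Q0 ->] := h z zn; have [Q'0 ->] := h' z zn.
by rewrite !(hornerD, hornerM) mulf_neq0//; split=> //; field; rewrite Q0 Q'0.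
Qed.

Lemma rational_on_sum n I (s : seq I) (P : pred I) f : (forall i, P i -> rational_on n (f i)) ->
  rational_on n (fun z => \sum_(i <- s | P i) f i z).
Proof.
move=> h; elim: s => [|i s IH].
  by apply: eq_rational_on (rational_on_cst n 0) => z _; rewrite big_nil.
case: (boolP (P i)) => Pi.
  by apply: eq_rational_on (rational_onD (h i Pi) IH) => z _; rewrite big_cons Pi.
by apply: eq_rational_on IH => z _; rewrite big_cons (negbTE Pi).
Qed.

(** A zero of the denominator lies outside the affinoid: it has absolute value larger than q^n, or
    it is closer than q^(-n) to a point of F_q((1/theta)). Either way its distance to every point of
    the affinoid is at least q^(-n), which bounds the denominator from below. *)
Lemma rational_bounded n f : rational_on n f -> exists2 M, 0 < M & forall z, aff n z -> abs (f z) <= M.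
Proof.
move=> [P [Q h]]; have [M M0 hM] : exists2 M, 0 < M & forall z, aff n z -> abs P.[z] <= M.
  have [L L0 hL] := poly_lipschitz hC P (q%:R ^+ n).
  have qn0 : 0 < q%:R ^+ n :> R by rewrite exprn_gt0// (card_Fq_gt0R R Fq).
  exists (Num.max (L * q%:R ^+ n) (abs P.[0])) => [|z [zn _]]; first by rewrite lt_max mulr_gt0.
  rewrite -[P.[z]](subrK P.[0]); apply: le_trans (abs_ultra absC _ _) _.
  rewrite ge_max !le_max lexx orbT andbT; apply/orP; left.
  apply: le_trans (hL z 0 zn _) _; first by rewrite (abs0 absC) ltW.
  by rewrite subr0 ler_pM2l.
have [Q0|Q0] := eqVneq Q 0.
  by exists 1 => // z /h[]; rewrite Q0 horner0 eqxx.
have [s Qs] := Cinf_split hC Q0.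
pose m := abs (lead_coef Q) * (q%:R ^- n) ^+ size s.
have m0 : 0 < m by rewrite mulr_gt0 ?exprn_gt0 ?qn_gt0// (abs_gt0 absC)// lead_coef_eq0.
exists (M / m) => [|z zn]; first exact: divr_gt0.
have [Qz ->] := h z zn; rewrite (abs_mul absC) (absV absC).
apply: ler_pM; rewrite ?(abs_nonneg absC) ?invr_ge0 ?(abs_nonneg absC) ?hM//.
rewrite lef_pV2 ?posrE ?(abs_gt0 absC)// Qs hornerZ horner_prod (abs_mul absC) (abs_prod absC).
rewrite /m ler_pM2l ?(abs_gt0 absC) ?lead_coef_eq0//.
have qn := ltW (qn_gt0 n).
have : {in s, forall x, ~ aff n x}.
  move=> x xs xn; have [] := h x xn; rewrite Qs hornerZ horner_prod (big_rem x)//=.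
  by rewrite hornerXsubC subrr mul0r mulr0 eqxx.
elim: (s) => [|x t IH] ht; first by rewrite big_nil.
rewrite big_cons exprS; apply: ler_pM; rewrite ?exprn_ge0//; last first.
  by apply: IH => y yt; apply: ht; rewrite inE yt orbT.
rewrite hornerXsubC; have [zle zK] := zn.
have [xn|xn] := leP (abs x) (q%:R ^+ n); last first.
  rewrite (abs_distC absC) (absB_isosceles absC); last exact: le_lt_trans xn.
  apply: le_trans (ltW xn); apply: (@le_trans _ _ 1).
    by rewrite invf_le1 ?exprn_ege1 ?exprn_gt0 ?(card_Fq_gt0R R Fq)// ltW// (card_Fq_gt1R R Fq).
  by rewrite exprn_ege1// ltW// (card_Fq_gt1R R Fq).
have [y yK xy] : exists2 y, Kinf abs iota y & abs (x - y) < q%:R ^- n.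
  apply: contrapT => H; apply: (ht x (mem_head _ _)); split=> // y yK.
  by rewrite leNgt; apply/negP => xy; apply: H; exists y.
have -> : z - x = (z - y) - (x - y) by ring.
by rewrite (absB_isosceles absC) ?zK//; exact: lt_le_trans (zK y yK).
Qed.

Lemma rigid_bounded n f : rigid_analytic abs iota f ->
  exists2 M, 0 < M & forall z, aff n z -> abs (f z) <= M.
Proof.
move=> fr; have [P [Q h]] := fr n 1 ltr01.
have [|M M0 hM] := @rational_bounded n (fun z => P.[z] / Q.[z]).
  by exists P, Q => z /h[].
exists (Num.max M 1) => [|z zn]; first by rewrite lt_max M0.
rewrite -[f z](subrK (P.[z] / Q.[z])); apply: le_trans (abs_ultra absC _ _) _.
by rewrite ge_max !le_max hM// (h z zn).2 orbT.
Qed.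

Lemma rational_rigid f : (forall n e, 0 < e -> exists2 g, rational_on n g &
  forall z, aff n z -> abs (f z - g z) <= e) -> rigid_analytic abs iota f.
Proof.
move=> h n e e0; have [g [P [Q gPQ]] fg] := h n e e0; exists P, Q => z zn.
by have [Q0 gE] := gPQ z zn; rewrite -gE; split=> //; exact: fg.
Qed.

Lemma rigid_rational f n e : rigid_analytic abs iota f -> 0 < e ->
  exists2 g, rational_on n g & forall z, aff n z -> abs (f z - g z) <= e.
Proof.
move=> fr e0; have [P [Q h]] := fr n e e0; exists (fun z => P.[z] / Q.[z]).
  by exists P, Q => z /h[].
by move=> z /h[].
Qed.

Lemma rigid_cst c : rigid_analytic abs iota (fun=> c).
Proof.
apply: rational_rigid => n e e0; exists (fun=> c); first exact: rational_on_cst.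
by move=> z _; rewrite subrr (abs0 absC) ltW.
Qed.

Lemma rigidM f g : rigid_analytic abs iota f -> rigid_analytic abs iota g ->
  rigid_analytic abs iota (fun z => f z * g z).
Proof.
move=> fr gr; apply: rational_rigid => n e e0.
have [M M0 hM] := rigid_bounded n fr.
have [g' g'r gg'] := rigid_rational n gr (divr_gt0 e0 M0).
have [M' M'0 hM'] := rational_bounded g'r.
have [f' f'r ff'] := rigid_rational n fr (divr_gt0 e0 M'0).
exists (fun z => f' z * g' z); first exact: rational_onM.
move=> z zn; have -> : f z * g z - f' z * g' z = f z * (g z - g' z) + (f z - f' z) * g' z by ring.
apply: (absD_le absC); rewrite (abs_mul absC).
  apply: (@le_trans _ _ (M * (e / M))); last by rewrite mulrCA divff ?gt_eqF// mulr1.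
  by apply: ler_pM; rewrite ?(abs_nonneg absC) ?hM ?gg'.
apply: (@le_trans _ _ (e / M' * M')); last by rewrite divfK// gt_eqF.
by apply: ler_pM; rewrite ?(abs_nonneg absC) ?hM' ?ff'.
Qed.

Lemma rigidZ c f : rigid_analytic abs iota f -> rigid_analytic abs iota (fun z => c * f z).
Proof. by apply: rigidM; exact: rigid_cst. Qed.

Definition shift_poly z (P : {poly C}) : {poly C} := \poly_(i < size P) P^`N(i).[z].

Lemma horner_shift_poly z P x : (shift_poly z P).[x] = P.[z + x].
Proof. by rewrite horner_poly nderiv_taylor//; exact: mulrC. Qed.

Lemma coef_shift_poly z P i : (shift_poly z P)`_i = P^`N(i).[z].
Proof. by rewrite coef_poly; case: ltnP => // /nderivn_poly0 ->; rewrite horner0. Qed.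

Lemma rigid_disc f n z : rigid_analytic abs iota f -> aff n z ->
  disc_analytic abs (q%:R ^- n) (fun x => f (z + x)).
Proof.
move=> fr zn e e0; have [P [Q h]] := fr n e e0.
exists (shift_poly z P), (shift_poly z Q) => x xn; rewrite !horner_shift_poly.
by apply: h; exact: Omega_aff_disc.
Qed.

Lemma rigid_jet f z r : rigid_analytic abs iota f -> Omega abs iota z ->
  exists2 p : {poly C}, (size p <= r)%N & bigO r (fun x => f (z + x) - p.[x]).
Proof.
move=> fr /Omega_exhausted[n zn]; have [M M0 hM] := rigid_bounded n fr.
have [|p [sp pM hp]] := jet_bound hC r (qn_gt0 n) M0 (rigid_disc fr zn).
  by move=> x xn; apply: hM; exact: Omega_aff_disc.
exists p => //; exists (q%:R ^- n); first exact: qn_gt0.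
by exists (M / (q%:R ^- n) ^+ r) => //; rewrite divr_gt0// exprn_gt0// qn_gt0.
Qed.

(** The r-th Taylor coefficient, read off from any polynomial that agrees with f(z + x) up to
    O(x^(r+1)); by [bigO_poly_unique] the choice is immaterial. No division by r!, which may be 0 in
    characteristic p, takes place. *)
Definition hyperderiv (r : nat) (f : C -> C) (z : C) : C :=
  xget 0 [set a | exists2 p : {poly C}, bigO r.+1 (fun x => f (z + x) - p.[x]) & a = p`_r]%classic.

Lemma hyperderivE r f z (p : {poly C}) j : bigO r.+1 (fun x => f (z + x) - p.[x]) ->
  (j <= r)%N -> hyperderiv j f z = p`_j.
Proof.
move=> hp jr; rewrite /hyperderiv; case: xgetP => [a _ [p' hp' ->]|/(_ p`_j)].
  have hp2 := @bigO_le _ _ _ _ _ hC r.+1 j.+1 _ jr hp.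
  exact: (bigO_poly_unique hC hp' hp2).
by case; exists p => //; exact: (bigO_le hC _ hp).
Qed.

(** The Leibniz rule for P = f Q, solved for the r-th hyperderivative of f; the lower ones are
    rational by induction. *)
Lemma rational_hyperderiv n (P Q : {poly C}) : (forall z, aff n z -> Q.[z] != 0) ->
  forall r, rational_on n (hyperderiv r (fun z => P.[z] / Q.[z])).
Proof.
move=> Q0; pose f z := P.[z] / Q.[z].
have jet z r : aff n z -> exists p P1 : {poly C}, shift_poly z P = p * shift_poly z Q + P1 * 'X^(r.+1) /\
    forall j, (j <= r)%N -> hyperderiv j f z = p`_j.
  move=> zn; have [|M M0 hM] := @rational_bounded n f.
    by exists P, Q => y /Q0.
  have [||p [P1 [sp pM PE P1M]]] := @rat_jet _ _ _ _ _ hC (shift_poly z P) (shift_poly z Q) _ M r.+1 (qn_gt0 n).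
  - by move=> x xn; rewrite horner_shift_poly Q0//; exact: Omega_aff_disc.
  - by move=> x xn; rewrite !horner_shift_poly; apply: hM; exact: Omega_aff_disc.
  exists p, P1; split=> // j jr; apply: (hyperderivE (r := r)) => //.
  exists (q%:R ^- n); first exact: qn_gt0.
  exists (M / (q%:R ^- n) ^+ r.+1) => [|x xn]; first by rewrite divr_gt0// exprn_gt0// qn_gt0.
  have Qx : (shift_poly z Q).[x] != 0 by rewrite horner_shift_poly Q0//; exact: Omega_aff_disc.
  rewrite /f -!horner_shift_poly PE hornerD !hornerM hornerXn mulrDl mulfK// addrC addKr.
  by rewrite mulrAC (abs_mul absC) (absX absC) ler_wpM2r ?exprn_ge0 ?(abs_nonneg absC)// P1M.
elim/ltn_ind => r IH.
apply: (@eq_rational_on n (fun z => (P^`N(r).[z] - \sum_(i < r) hyperderiv i f z * Q^`N(r - i).[z]) * Q.[z]^-1)).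
  move=> z zn; have [p [P1 [PE hp]]] := jet z r zn.
  apply: (canLR (mulfK (Q0 z zn))); rewrite hp//.
  have := congr1 (fun s : {poly C} => s`_r) PE.
  rewrite coefD coefMXn ltnSn addr0 coefM coef_shift_poly big_ord_recr/= subnn coef_shift_poly nderivn0 => ->.
  rewrite addrC -addrA; apply/eqP; rewrite eq_sym addrC -subr_eq subrr eq_sym subr_eq0.
  by apply/eqP; apply: eq_bigr => i _; rewrite coef_shift_poly hp// ltnW.
apply: rational_onM; last exact: rational_onV.
apply: rational_onD; first exact: rational_on_poly.
apply: (@eq_rational_on n (fun z => -1 * \sum_(i < r) hyperderiv i f z * Q^`N(r - i).[z])).
  by move=> z _; rewrite mulN1r.
apply: rational_onM; first exact: rational_on_cst.
apply: rational_on_sum => i _; apply: rational_onM; last exact: rational_on_poly.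
exact: IH.
Qed.

(** Discs of radius q^(-n) around points of the n-th affinoid stay inside it, so the Cauchy estimate
    for f - P/Q loses only the factor q^(n r), uniformly in z. *)
Lemma rigid_hyperderiv r f : rigid_analytic abs iota f -> rigid_analytic abs iota (hyperderiv r f).
Proof.
move=> fr; apply: rational_rigid => n e e0.
have qn := qn_gt0 n; pose e' := e * (q%:R ^- n) ^+ r.
have e'0 : 0 < e' by rewrite mulr_gt0// exprn_gt0.
have [P [Q h]] := fr n e' e'0; have Q0 z : aff n z -> Q.[z] != 0 by move=> /h[].
exists (hyperderiv r (fun z => P.[z] / Q.[z])); first exact: rational_hyperderiv.
move=> z zn; have zO := Omega_aff_Omega zn.
have gr : rigid_analytic abs iota f by [].
have [p1 _ hp1] := rigid_jet r.+1 fr zO.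
have han : disc_analytic abs (q%:R ^- n) (fun x => f (z + x) - P.[z + x] / Q.[z + x]).
  move=> d d0; have [P1 [Q1 h1]] := rigid_disc fr zn d0.
  exists (P1 * shift_poly z Q - shift_poly z P * Q1), (Q1 * shift_poly z Q) => x xn.
  have [Q1x fx] := h1 x xn; have Qx := Q0 _ (Omega_aff_disc zn xn).
  rewrite !hornerE !horner_shift_poly mulf_neq0//; split=> //.
  rewrite (_ : _ - _ = f (z + x) - P1.[x] / Q1.[x])//; field.
  by rewrite Q1x Qx.
have [|p2 [_ p2e hp2]] := jet_bound hC r.+1 qn e'0 han.
  by move=> x xn; have [] := h _ (Omega_aff_disc zn xn).
have b2 : bigO r.+1 (fun x => f (z + x) - P.[z + x] / Q.[z + x] - p2.[x]).
  by exists (q%:R ^- n) => //; exists (e' / (q%:R ^- n) ^+ r.+1) => //; rewrite divr_gt0// exprn_gt0.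
have b3 : bigO r.+1 (fun x => P.[z + x] / Q.[z + x] - (p1 - p2).[x]).
  apply: eq_bigO (bigOB hC hp1 b2); exists 1 => // x _.
  by rewrite hornerD hornerN; ring.
rewrite (hyperderivE hp1)// (hyperderivE (f := fun z => P.[z] / Q.[z]) b3)// coefB opprB addrCA subrr addr0.
by apply: le_trans (p2e r) _; rewrite /e' mulfK// gt_eqF// exprn_gt0.
Qed.

End Rigid.

(** * Characteristic p *)

Lemma card_pchar_pow (F : finFieldType) p : p \in [pchar F] -> exists2 n, (0 < n)%N & #|F| = (p ^ n)%N.
Proof.
move=> pF; have pp := pcharf_prime pF.
have := abelian.abelem_pgroup (abelian.fin_ring_pchar_abelem pF).
rewrite /pgroup.pgroup cardsT => /p_natP[n Fn]; exists n => //.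
by case: n Fn (finRing_gt1 F) => // ->.
Qed.

Lemma pchar_ext_field (Fq : finFieldType) (L : fieldType) (iota : {rmorphism ratfun Fq -> L}) p :
  p \in [pchar Fq] -> p \in [pchar L].
Proof.
move=> pF; apply: (rmorph_pchar iota); apply: (rmorph_pchar (@FracField.tofrac {poly Fq})).
by rewrite pchar_poly.
Qed.

Section CharP.
Variables (Fq : finFieldType) (L : comNzRingType) (p : nat).
Hypotheses (pF : p \in [pchar Fq]) (pL : p \in [pchar L]).
Local Notation q := #|Fq|.

Lemma exprpnD (x y : L) n : (x + y) ^+ (p ^ n) = x ^+ (p ^ n) + y ^+ (p ^ n).
Proof.
apply: exprDn_pchar; rewrite (eq_pnat _ (pcharf_eq pL)).
by rewrite pnatX pnat_id ?(pcharf_prime pL).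
Qed.

Lemma exprpnN (x : L) n : (- x) ^+ (p ^ n) = - x ^+ (p ^ n).
Proof.
apply/eqP; rewrite -addr_eq0 -exprpnD addNr expr0n.
by rewrite expn_eq0 (gtn_eqF (prime_gt0 (pcharf_prime pL))).
Qed.

Lemma exprqnD (x y : L) n : (x + y) ^+ (q ^ n) = x ^+ (q ^ n) + y ^+ (q ^ n).
Proof. by have [m _ ->] := card_pchar_pow pF; rewrite -expnM exprpnD. Qed.

Lemma exprqnN (x : L) n : (- x) ^+ (q ^ n) = - x ^+ (q ^ n).
Proof. by have [m _ ->] := card_pchar_pow pF; rewrite -expnM exprpnN. Qed.

Lemma exprqnB (x y : L) n : (x - y) ^+ (q ^ n) = x ^+ (q ^ n) - y ^+ (q ^ n).
Proof. by rewrite exprqnD exprqnN. Qed.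

Lemma exprqn_sum I (s : seq I) (P : pred I) (F : I -> L) n :
  (\sum_(i <- s | P i) F i) ^+ (q ^ n) = \sum_(i <- s | P i) F i ^+ (q ^ n).
Proof.
elim/big_rec2: _ => [|i x y _ <-]; last by rewrite exprqnD.
by rewrite expr0n expn_eq0 -leqn0 leqNgt (ltnW (finRing_gt1 Fq)).
Qed.

Lemma exprqD (x y : L) : (x + y) ^+ q = x ^+ q + y ^+ q.
Proof. by have := exprqnD x y 1; rewrite expn1. Qed.

Lemma exprqB (x y : L) : (x - y) ^+ q = x ^+ q - y ^+ q.
Proof. by have := exprqnB x y 1; rewrite expn1. Qed.

End CharP.

(** * Bol's identity *)

Section Types.
Variables (Fq : finFieldType) (L : fieldType).
Local Notation q := #|Fq|.

Lemma Zmod_valD N (x : L) (a b : Zmod N) : x ^+ N.-1.+1 = 1 ->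
  x ^+ ((a + b : Zmod N)%R : 'I_N.-1.+1) = x ^+ (a : 'I_N.-1.+1) * x ^+ (b : 'I_N.-1.+1).
Proof. by move=> x1; rewrite -exprD -(expr_mod (_ + _) x1). Qed.

Lemma Zmod_val_nat N (x : L) (r : nat) : x ^+ N.-1.+1 = 1 ->
  x ^+ (Zmod_of_int N r : 'I_N.-1.+1) = x ^+ r.
Proof.
move=> x1; rewrite /Zmod_of_int -pmulrn; elim: r => [|r IH]; first by rewrite mulr0n expr0.
by rewrite mulrS Zmod_valD// IH /= expr_mod// -exprD.
Qed.

Lemma card_pred_pred : q.-1.-1.+1 = q.-1.
Proof. by case: #|Fq| (finRing_gt1 Fq) => [|[]]. Qed.

(** Units of A are nonzero constants. This makes the power of the determinant in the automorphy
    factor depend only on the exponent modulo q - 1. *)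
Lemma det_unit_pow (iota : {rmorphism ratfun Fq -> L}) (g : 'M[{poly Fq}]_2) : g \in unitmx ->
  iotaA iota (\det g) != 0 /\ iotaA iota (\det g) ^+ q.-1.-1.+1 = 1.
Proof.
rewrite unitmxE poly_unitE => /andP[/size_poly1P[c c0 ->] _]; rewrite card_pred_pred.
split; first by rewrite fmorph_eq0 tofrac_eq0 polyC_eq0.
rewrite /iotaA -!rmorphXn; suff -> : c ^+ q.-1 = 1 by rewrite !rmorph1.
apply: (mulIf c0); rewrite -exprSr mul1r prednK ?expf_card//.
exact: ltnW (finRing_gt1 Fq).
Qed.

End Types.

Section Bol.
Variables (R : realType) (Fq : finFieldType) (C : fieldType) (abs : C -> R).
Variable (iota : {rmorphism ratfun Fq -> C}).
Hypothesis hC : is_Cinf abs iota.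
Let absC := Cinf_abs hC.
Variable p : nat.
Hypothesis pF : p \in [pchar Fq].
Let pC : p \in [pchar C] := pchar_ext_field iota pF.
Local Notation q := #|Fq|.
Local Notation Om := (Omega abs iota).
Local Notation iA := (iotaA iota).

Lemma iotaA_Kinf a : Kinf abs iota (iA a).
Proof. exact: Kinf_iota. Qed.

Lemma KinfM x y : Kinf abs iota x -> Kinf abs iota y -> Kinf abs iota (x * y).
Proof.
move=> hx hy; rewrite -[y]invrK; apply: (Kinf_div hC) => //; rewrite -div1r.
by apply: (Kinf_div hC) => //; have := Kinf_iota hC 1; rewrite rmorph1.
Qed.

Lemma iotaAD a b : iA (a + b) = iA a + iA b.
Proof. by rewrite /iotaA !rmorphD. Qed.
Lemma iotaAB a b : iA (a - b) = iA a - iA b.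
Proof. by rewrite /iotaA !rmorphB. Qed.
Lemma iotaAM a b : iA (a * b) = iA a * iA b.
Proof. by rewrite /iotaA !rmorphM. Qed.
Lemma iotaAX a n : iA (a ^+ n) = iA a ^+ n.
Proof. by rewrite /iotaA !rmorphXn. Qed.
Lemma iotaA_eq0 a : (iA a == 0) = (a == 0).
Proof. by rewrite fmorph_eq0 tofrac_eq0. Qed.

Lemma det_mx2 (g : 'M[{poly Fq}]_2) : \det g = g 0 0 * g 1 1 - g 0 1 * g 1 0.
Proof.
rewrite (expand_det_row _ 0) big_ord_recl big_ord1 /cofactor !det_mx11 !mxE.
have -> : lift 0 0 = 1 :> 'I_2 by exact: val_inj.
have -> : lift 1 0 = 0 :> 'I_2 by exact: val_inj.
by rewrite expr0 expr1 mul1r mulN1r mulrN.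
Qed.

Lemma moebius_denom_neq0 (g : 'M[{poly Fq}]_2) z : g \in unitmx -> Om z ->
  iA (g 1 0) * z + iA (g 1 1) != 0.
Proof.
move=> gu zO; have [d0 _] := det_unit_pow iota gu; rewrite det_mx2 in d0.
have [c0|c0] := eqVneq (g 1 0) 0.
  move: d0; rewrite c0 mulr0 subr0 iotaAM mulf_eq0 negb_or => /andP[_].
  by rewrite [iA 0](_ : _ = 0) ?mul0r ?add0r//; apply/eqP; rewrite iotaA_eq0.
apply/negP => /eqP h; apply: zO.
have -> : z = (0 - iA (g 1 1)) / iA (g 1 0).
  have := iotaA_eq0 (g 1 0); rewrite (negbTE c0) => /negbT c1.
  by apply: (canRL (mulfK c1)); rewrite sub0r; apply/eqP; rewrite -addr_eq0 mulrC h.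
apply: (Kinf_div hC); last exact: iotaA_Kinf.
apply: (KinfB hC); last exact: iotaA_Kinf.
by have := Kinf_iota hC 0; rewrite rmorph0.
Qed.

Lemma moebius_Omega (g : 'M[{poly Fq}]_2) z : g \in unitmx -> Om z ->
  Om ((iA (g 0 0) * z + iA (g 0 1)) / (iA (g 1 0) * z + iA (g 1 1))).
Proof.
move=> gu zO wK; have [d0 _] := det_unit_pow iota gu; rewrite det_mx2 in d0.
have j0 := moebius_denom_neq0 gu zO; move: wK j0 d0; rewrite iotaAB !iotaAM.
set a := iA (g 0 0); set b := iA (g 0 1); set c := iA (g 1 0); set d := iA (g 1 1).
set w := (_ / _) => wK j0 d0; apply: zO.
have e0 : a - c * w != 0.
  have -> : a - c * w = (a * d - b * c) / (c * z + d) by rewrite /w; field.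
  by rewrite mulf_neq0// invr_eq0.
have -> : z = (d * w - b) / (a - c * w).
  apply: (canRL (mulfK e0)); rewrite /w; field; exact: j0.
apply: (Kinf_div hC); apply: (KinfB hC); try exact: iotaA_Kinf;
  by apply: KinfM => //; exact: iotaA_Kinf.
Qed.

Lemma exprz_near1 t (n : int) : abs t < 1 -> abs ((1 + t) ^ n - 1) <= abs t.
Proof.
move=> t1; have u1 : abs (1 + t) = 1 by rewrite (abs_isosceles absC) (abs1 absC).
have nat_case (m : nat) : abs ((1 + t) ^+ m - 1) <= abs t.
  elim: m => [|m IH]; first by rewrite subrr (abs0 absC) (abs_nonneg absC).
  rewrite exprS (_ : _ - 1 = (1 + t) * ((1 + t) ^+ m - 1) + t); last by ring.
  by apply: (absD_le absC) => //; rewrite (abs_mul absC) u1 mul1r.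
case: n => m; first exact: nat_case.
have u0 : (1 + t) ^+ m.+1 != 0 by rewrite expf_neq0//; apply: (abs_neq0 absC); rewrite u1.
rewrite NegzE -exprnN (_ : _ - 1 = - ((1 + t) ^+ m.+1 - 1) / (1 + t) ^+ m.+1); last by field.
by rewrite (abs_mul absC) (absN absC) (absV absC) (absX absC) u1 expr1n invr1 mulr1.
Qed.

(* Multiplying F(g(z + x)) by u^(r-1), u = 1 + c x / (c z + d), turns the
   coordinate x |-> delta x / u into polynomials of degree less than r, apart
   from the leading term, while u^(K + r - 1) = 1 + O(x^(r+1)). *)
Theorem bol (K : int) (m : Zmod q.-1) (r M : nat) (n' : int) (f : C -> C) :
  (0 < r)%N -> (r < p ^ M)%N -> K + r%:Z - 1 = (p ^ M)%:Z * n' ->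
  rigid_analytic abs iota f -> modular_transform abs iota K m f ->
  modular_transform abs iota (K + (2 * r)%N%:Z) (m + Zmod_of_int q.-1 r) (hyperderiv abs r f).
Proof.
move=> r0 rP Kr fr fm g z gu zO; have [D0 D1] := det_unit_pow iota gu.
have j0 := moebius_denom_neq0 gu zO; have wO := moebius_Omega gu zO.
move: (fm g); rewrite /=.
set a := iA (g 0 0) in j0 wO *; set b := iA (g 0 1) in j0 wO *.
set c := iA (g 1 0) in j0 wO *; set d := iA (g 1 1) in j0 wO *.
set D := iA (\det g) in D0 D1 * => fmg.
have DE : D = a * d - b * c by rewrite /D det_mx2 iotaAB !iotaAM.
set j := c * z + d in j0 wO *; set w := (a * z + b) / j in wO *.
have [pA spA hA] := rigid_jet hC r.+1 fr wO.
have [pB spB hB] := rigid_jet hC r.+1 fr zO.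
rewrite (hyperderivE hC hA)// (hyperderivE hC hB)//.
pose dl := D / j ^+ 2; pose y x := c / j * x; pose u x := 1 + y x.
have dl0 : dl != 0 by rewrite mulf_neq0// invr_eq0 expf_neq0.
pose Phi x := f (w + dl * x / u x) * u x ^+ r.-1.
have [rho rho0 small] : exists2 rho, 0 < rho & forall x, abs x < rho -> abs (y x) < 1.
  have M0 : 0 < abs (c / j) + 1 by rewrite ltr_wpDl// (abs_nonneg absC).
  exists (abs (c / j) + 1)^-1 => [|x xr]; first by rewrite invr_gt0.
  rewrite (abs_mul absC); apply: le_lt_trans (_ : (abs (c / j) + 1) * abs x < 1).
    by rewrite ler_wpM2r ?(abs_nonneg absC)// lerDl.
  by rewrite mulrC -ltr_pdivlMr// div1r.
have u1 x : abs x < rho -> abs (u x) = 1.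
  by move=> /small yx; rewrite /u (abs_isosceles absC) (abs1 absC).
have u0 x : abs x < rho -> u x != 0 by move=> /u1 ux; apply: (abs_neq0 absC); rewrite ux.
have bO_y : bigO abs 1 y by have := bigOZ hC (c / j) (bigO_X abs).
have bO_u k : bigO abs 0 (fun x => u x ^+ k).
  exists rho => //; exists 1 => // x xr.
  by rewrite (absX absC) u1// expr1n expr0 mulr1.
have bO_uV k : bigO abs 0 (fun x => (u x ^+ k)^-1).
  exists rho => //; exists 1 => // x xr.
  by rewrite (absV absC) (absX absC) u1// expr1n expr0 mulr1 invr1.
pose L := \sum_(s < r) ((pA`_s * dl ^+ s) *: 'X^s * (1 + (c / j) *: 'X) ^+ (r.-1 - s)) +
  (pA`_r * dl ^+ r) *: 'X^r.
have PhiL : bigO abs r.+1 (fun x => Phi x - L.[x]).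
  have h1 : bigO abs r.+1 (fun x => Phi x - pA.[dl * x / u x] * u x ^+ r.-1).
    have [s s0 [B B0 hs]] := hA; pose E := abs dl.
    have E0 : 0 < E by exact: (abs_gt0 absC).
    have : bigO abs r.+1 (fun x => f (w + dl * x / u x) - pA.[dl * x / u x]).
      exists (Num.min rho (s / E)); first by rewrite lt_min rho0 divr_gt0.
      exists (B * E ^+ r.+1) => [|x]; first by rewrite mulr_gt0// exprn_gt0.
      rewrite lt_min => /andP[xr xs].
      have ex : abs (dl * x / u x) = E * abs x.
        by rewrite (abs_mul absC) (absV absC) u1// invr1 mulr1 (abs_mul absC).
      apply: le_trans (hs _ _) _; first by rewrite ex mulrC -ltr_pdivlMr.
      by rewrite ex exprMn mulrA.
    move=> /(bigOM hC)/(_ (bO_u r.-1)); rewrite addn0; apply: eq_bigO.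
    by exists 1 => // x _; rewrite /Phi mulrBl.
  apply: eq_bigO (bigOD hC h1 (bigOZ hC (pA`_r * dl ^+ r) (F := fun x => x ^+ r * (- y x / u x)) _)).
    exists rho => // x xr; have ux := u0 x xr.
    suff -> : L.[x] = pA.[dl * x / u x] * u x ^+ r.-1 - pA`_r * dl ^+ r * (x ^+ r * (- y x / u x)).
      by ring.
    rewrite (@horner_coef_wide _ r.+1 pA)// big_ord_recr/= mulrDl /L hornerD hornerZ hornerXn.
    rewrite horner_sum mulr_suml -addrA; congr (_ + _).
      apply: eq_bigr => s _; rewrite hornerM hornerZ hornerXn horner_exp hornerD hornerC hornerZ hornerX.
      rewrite -/(y x) -/(u x) -[in RHS](@subnK s r.-1) ?exprD; last by have := ltn_ord s; lia.
      by rewrite [(dl * x / u x) ^+ s]expr_div_n (exprMn s dl x); field; exact: expf_neq0.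
    have -> : - y x / u x = (u x)^-1 - 1 by rewrite /u; field; exact: ux.
    rewrite [(dl * x / u x) ^+ r]expr_div_n (exprMn r dl x).
    have -> : u x ^+ r = u x * u x ^+ r.-1 by rewrite -exprS prednK.
    by field; rewrite expf_neq0 ?ux.
  rewrite -addn1.
  apply: (bigOM hC (r := r) (s := 1) (F := fun x => x ^+ r) (G := fun x => - y x / u x)).
    exact: (bigO_Xn hC).
  have := bigOM hC (bigOZ hC (-1) bO_y) (bO_uV 1%N); rewrite addn0; apply: eq_bigO.
  by exists 1 => // x _; rewrite expr1 mulN1r.
pose kap := D ^- (m : 'I_q.-1.-1.+1) * j ^ K.
have PhiR : bigO abs r.+1 (fun x => Phi x - (kap *: pB).[x]).
  have h1 : bigO abs r.+1 (fun x => u x ^ (K + r%:Z - 1) - 1).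
    rewrite Kr; apply: (bigO_le hC rP).
    have := bigO_Xn hC (p ^ M); move=> /(bigOZ hC ((c / j) ^+ (p ^ M))) [s s0 [B B0 hs]].
    exists (Num.min rho s); first by rewrite lt_min rho0.
    exists B => // x; rewrite lt_min => /andP[xr xs].
    rewrite -exprz_exp -exprnP /u exprpnD// expr1n.
    apply: le_trans (exprz_near1 _ _) _.
      by rewrite (absX absC) exprn_ilt1 ?(abs_nonneg absC) ?small// expn_eq0 (gtn_eqF (prime_gt0 (pcharf_prime pC))).
    by apply: le_trans (hs x xs); rewrite /y exprMn.
  have h2 : bigO abs 0 (fun x => f (z + x)).
    have := bigOD hC (bigO_le hC (leq0n _) hB) (bigO_poly hC pB); apply: eq_bigO.
    by exists 1 => // x _; rewrite subrK.
  have h12 := bigOM hC h1 h2; rewrite addn0 in h12.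
  apply: eq_bigO (bigOZ hC kap (bigOD hC h12 hB)).
  have [n zn] := Omega_exhausted hC zO.
  exists (Num.min rho (q%:R ^- n)); first by rewrite lt_min rho0 qn_gt0.
  move=> x; rewrite lt_min => /andP[xr xn]; have ux := u0 x xr.
  have zxO := Omega_aff_Omega hC (Omega_aff_disc hC zn xn).
  have jx : c * (z + x) + d = j * u x by rewrite /u /y /j; field; exact: j0.
  have gE : w + dl * x / u x = (a * (z + x) + b) / (c * (z + x) + d).
    rewrite jx /w /dl DE /j; have := j0; rewrite /j => jj.
    have uE : u x = (c * z + d + c * x) / (c * z + d) by rewrite /u /y /j; field.
    have : c * z + d + c * x != 0.
      by move: (u0 x xr); rewrite uE mulf_eq0 negb_or => /andP[].
    by rewrite uE => h; field; rewrite h jj.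
  rewrite /Phi gE (fmg _ gu zxO) jx hornerZ exprzMl ?unitfE// /kap.
  rewrite addrAC -addrA expfzDr// expfzDr//.
  have -> : u x ^+ r.-1 = u x ^ r%:Z * u x ^ (-1).
    by rewrite -expfzDr// exprnP; congr (_ ^ _); lia.
  ring.
(* In degree r the summands of [L] with s < r drop out, as their degree is at most r - 1. What
   remains is a relation between the r-th Taylor coefficients of f at [w] and at [z]. *)
have := bigO_poly_unique hC PhiL PhiR (ltnSn r).
rewrite coefD !coefZ coefXn eqxx mulr1 coef_sum big1 ?add0r => [h|s _]; last first.
  rewrite -scalerAl coefZ coefXnM ltnNge (ltnW (ltn_ord s))/= [X in _ * X]nth_default ?mulr0//.
  apply: leq_trans (size_poly_exp_leq _ _) _.
  have : (size (1 + (c / j) *: 'X)%R <= 2)%N.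
    apply: leq_trans (size_polyD _ _) _; rewrite geq_max size_poly1.
    by apply: leq_trans (size_scale_leq _ _) _; rewrite size_polyX.
  case: (size _) => [|[|[|]]]//= _; have := ltn_ord s; lia.
have -> : pA`_r = kap * pB`_r / dl ^+ r by rewrite -h mulfK// expf_neq0.
rewrite Zmod_valD// Zmod_val_nat// /kap /dl expfzDr// -exprnP exprM [(D / _) ^+ r]expr_div_n [in RHS]invfM.
by field; rewrite !expf_neq0.
Qed.
End Bol.

(** * The Carlitz exponential and its lattice *)

Section Boxes.
Variable Fq : finFieldType.
Local Notation q := #|Fq|.

Definition box (D : nat) : seq {poly Fq} := [seq rVpoly v | v <- enum 'rV[Fq]_D].

Lemma mem_box D b : (b \in box D) = (size b <= D)%N.
Proof.
apply/mapP/idP => [[v _ ->]|bD]; first exact: size_poly.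
by exists (poly_rV b); rewrite ?mem_enum// poly_rV_K.
Qed.

Lemma box_uniq D : uniq (box D).
Proof. by rewrite map_inj_uniq ?enum_uniq//; exact: can_inj rVpolyK. Qed.

Lemma size_box D : size (box D) = (q ^ D)%N.
Proof. by rewrite size_map -cardE card_mx mul1n. Qed.

Lemma box_mono D D' : (D <= D')%N -> {subset box D <= box D'}.
Proof. by move=> DD b; rewrite !mem_box => /leq_trans; apply. Qed.

Lemma box_shift D (c : {poly Fq}) : c \in box D -> perm_eq (box D) [seq b - c | b <- box D].
Proof.
rewrite mem_box => cD; apply: uniq_perm; first exact: box_uniq.
  by rewrite map_inj_uniq ?box_uniq//; exact: addIr.
move=> b; apply/idP/mapP => [|[b']]; rewrite !mem_box.
  move=> bD; exists (b + c); rewrite ?addrK// mem_box.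
  by apply: leq_trans (size_polyD _ _) _; rewrite geq_max bD.
move=> bD ->; apply: leq_trans (size_polyD _ _) _.
by rewrite geq_max bD size_polyN.
Qed.

Lemma boxS D : perm_eq (box D.+1) [seq b + c *: 'X^D | c <- enum Fq, b <- box D].
Proof.
apply: uniq_perm; first exact: box_uniq.
  apply: allpairs_uniq; rewrite ?enum_uniq ?box_uniq// => -[c b] [c' b'].
  move=> /allpairsP[[? ?] /= [_ bD [-> ->]]] /allpairsP[[? ?] /= [_ bD' [-> ->]]] /= h.
  rewrite !mem_box in bD bD'.
  have := congr1 (fun s : {poly Fq} => s`_D) h; rewrite /= !coefD !coefZ coefXn eqxx !mulr1.
  rewrite !(nth_default 0 bD) !(nth_default 0 bD') !add0r => cc.
  by move: h; rewrite cc => /addIr ->.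
move=> b; rewrite mem_box; apply/idP/allpairsP => [bD|[[c b'] /= [_ bD ->]]]; last first.
  rewrite mem_box in bD; apply: leq_trans (size_polyD _ _) _; rewrite geq_max (leqW bD).
  by apply: leq_trans (size_scale_leq _ _) _; rewrite size_polyXn.
exists (b`_D, b - b`_D *: 'X^D); rewrite mem_enum subrK; split=> //.
rewrite mem_box; apply/leq_sizeP => j jD; rewrite coefB coefZ coefXn.
case: eqP => [->|/eqP jD']; first by rewrite mulr1 subrr.
rewrite mulr0 subr0 nth_default//; apply: leq_trans bD _.
by rewrite ltn_neqAle eq_sym jD'.
Qed.

End Boxes.

Section Carlitz.
Variables (R : realType) (Fq : finFieldType) (C : fieldType) (abs : C -> R).
Variable (iota : {rmorphism ratfun Fq -> C}).
Hypothesis hC : is_Cinf abs iota.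
Let absC := Cinf_abs hC.
Variable p : nat.
Hypothesis pF : p \in [pchar Fq].
Let pC : p \in [pchar C] := pchar_ext_field iota pF.
Local Notation q := #|Fq|.
Local Notation iA := (iotaA iota).
Local Notation th := (iA 'X).
Local Notation br i := (iA (bracket Fq i)).
Local Notation Dn i := (iA (carlitz_D Fq i)).
Local Notation qD := (exprqD pF pC).
Local Notation qB := (exprqB pF pC).

Lemma q_gt0 : (0 < q)%N. Proof. exact: ltnW (finRing_gt1 Fq). Qed.

Lemma qn_gt0N n : (0 < q ^ n)%N. Proof. by rewrite expn_gt0 q_gt0. Qed.

Lemma expr_q_pred (x : C) : x ^+ q.-1 * x = x ^+ q.
Proof. by rewrite -exprSr prednK// q_gt0. Qed.

Lemma iotaA_const_q (c : Fq) : iA c%:P ^+ q = iA c%:P.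
Proof. by rewrite -iotaAX -rmorphXn expf_card. Qed.

Lemma brE i : br i = th ^+ (q ^ i) - th.
Proof. by rewrite /bracket iotaAB iotaAX. Qed.

Lemma brS i : br i.+1 = br i ^+ q + br 1.
Proof. by rewrite !brE qB -exprM -expnSr expn1; ring. Qed.

Lemma br0 : br 0 = 0.
Proof. by rewrite brE expn0 expr1 subrr. Qed.

Lemma abs_br i : abs (br i.+1) = q%:R ^+ (q ^ i.+1).
Proof.
have t := abs_theta hC; have q1 := card_Fq_gt1R R Fq.
rewrite brE (absB_isosceles absC) (absX absC) t// -{1}[q%:R]expr1 ltr_eXn2l//.
by rewrite -{1}(expn0 q) ltn_exp2l// finRing_gt1.
Qed.

Lemma br_neq0 i : br i.+1 != 0.
Proof. by apply: (abs_neq0 absC); rewrite abs_br exprn_gt0// (card_Fq_gt0R R Fq). Qed.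

Lemma Dn0 : Dn 0 = 1. Proof. by rewrite /iotaA !rmorph1. Qed.

Lemma DnS i : Dn i.+1 = br i.+1 * Dn i ^+ q.
Proof. by rewrite /= iotaAM iotaAX. Qed.

Lemma Dn_neq0 i : Dn i != 0.
Proof.
by elim: i => [|i IH]; rewrite ?Dn0 ?oner_neq0// DnS mulf_neq0 ?br_neq0 ?expf_neq0.
Qed.

Lemma abs_Dn i : abs (Dn i) = q%:R ^+ (i * q ^ i).
Proof.
elim: i => [|i IH]; first by rewrite Dn0 (abs1 absC).
rewrite DnS (abs_mul absC) (absX absC) IH abs_br -exprM -exprD; congr (_ ^+ _).
by rewrite -mulnA -expnSr mulSn.
Qed.

(** The Carlitz polynomial e_D, which is the product of x - a over the polynomials a of degree less
    than D ([ed_prod]). The recursion is taken as the definition because it makes additivity and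
    F_q-linearity immediate. *)
Fixpoint ed (D : nat) (x : C) : C :=
  if D is D'.+1 then ed D' x ^+ q - Dn D' ^+ q.-1 * ed D' x else x.

Fixpoint ec (D i : nat) : C :=
  if D is D'.+1 then (if i is i'.+1 then ec D' i' ^+ q else 0) - Dn D' ^+ q.-1 * ec D' i
  else (i == 0%N)%:R.

Lemma ec_gt D i : (D < i)%N -> ec D i = 0.
Proof.
elim: D i => [|D IH] [|i]//= Di.
by rewrite !IH ?mulr0 ?expr0n ?(gtn_eqF q_gt0) ?subrr//; lia.
Qed.

Lemma ec_diag D : ec D D = 1.
Proof. by elim: D => //= D ->; rewrite ec_gt// mulr0 subr0 expr1n. Qed.

Lemma edE D x : ed D x = \sum_(i < D.+1) ec D i * x ^+ (q ^ i).
Proof.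
elim: D => [|D IH]; first by rewrite big_ord1 mul1r expn0 expr1.
rewrite /= IH -[q]expn1 (exprqn_sum pF pC) expn1.
under [RHS]eq_bigr do rewrite mulrBl.
rewrite sumrB; congr (_ - _).
  rewrite [RHS]big_ord_recl mul0r add0r; apply: eq_bigr => i _.
  by rewrite exprMn -exprM -expnSr.
rewrite mulr_sumr [RHS]big_ord_recr/= ec_gt// mulr0 mul0r addr0.
by apply: eq_bigr => i _; rewrite mulrA.
Qed.

Lemma edD D x y : ed D (x + y) = ed D x + ed D y.
Proof. by elim: D => //= D ->; rewrite qD; ring. Qed.

Lemma edN D x : ed D (- x) = - ed D x.
Proof. by apply/eqP; rewrite -addr_eq0 -edD addNr; elim: D => //= D /eqP ->; rewrite mulr0 expr0n (gtn_eqF q_gt0) subrr. Qed.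

Lemma edB D x y : ed D (x - y) = ed D x - ed D y.
Proof. by rewrite edD edN. Qed.

Lemma ed_const D c x : ed D (iA c%:P * x) = iA c%:P * ed D x.
Proof. by elim: D => //= D ->; rewrite exprMn iotaA_const_q; ring. Qed.

Lemma kappaS D : Dn D.+1 ^+ q.-1 * br D.+1 = br D.+1 ^+ q * (Dn D ^+ q.-1) ^+ q.
Proof. by rewrite DnS exprMn -(expr_q_pred (br _)) -!exprM [(q * _)%N]mulnC; ring. Qed.

(** Counterpart for e_D of the functional equation of e_C. It gives e_D(theta^D) = D_D, and the
    recursion then makes e_(D+1) vanish at theta^D, so the zeros of e_D are found without the
    product formula. *)
Lemma ed_theta D x : ed D.+1 (th * x) = th * ed D.+1 x + br D.+1 * ed D x ^+ q.
Proof.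
elim: D => [|D IH]; first by rewrite /= Dn0 expr1n exprMn brE expn1; ring.
set E := ed D.+1 x in IH *; set e := ed D x in IH *.
have EE : E = e ^+ q - Dn D ^+ q.-1 * e by [].
have Eq : E ^+ q = (e ^+ q) ^+ q - (Dn D ^+ q.-1) ^+ q * e ^+ q by rewrite EE qB exprMn.
rewrite [LHS]/= -/(ed D.+1 (th * x)) IH [ed D.+2 x]/= -/E -EE.
rewrite qD !exprMn (brS D.+1) (brE 1) expn1.
have := kappaS D; set k' := Dn D.+1 ^+ q.-1; set k := Dn D ^+ q.-1; set B := br D.+1 => h.
rewrite mulrDr [k' * (B * _)]mulrA h.
move: Eq; rewrite -/k; set Eq := E ^+ q; set e2 := (e ^+ q) ^+ q => ->.
by ring.
Qed.

Lemma ed_thetaX D : ed D (th ^+ D) = Dn D.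
Proof.
elim: D => [|D IH]; first by rewrite expr0 Dn0.
by rewrite exprS ed_theta IH DnS [ed D.+1 _]/= IH expr_q_pred subrr mulr0 add0r.
Qed.

Lemma ed_thetaX_lt D i : (i < D)%N -> ed D (th ^+ i) = 0.
Proof.
elim: D => // D IH; rewrite ltnS leq_eqVlt => /orP[/eqP ->|/IH /= ->].
  by rewrite /= ed_thetaX expr_q_pred subrr.
by rewrite mulr0 expr0n (gtn_eqF q_gt0) subrr.
Qed.

Lemma ed_box D b : b \in box Fq D -> ed D (iA b) = 0.
Proof.
rewrite mem_box => bD.
have -> : iA b = \sum_(i < D) iA (b`_i)%:P * th ^+ i.
  rewrite -[b in LHS]coefK poly_def (big_ord_widen D (fun i => b`_i *: 'X^i))//.
  rewrite big_mkcond/= /iotaA !rmorph_sum; apply: eq_bigr => i _.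
  case: ltnP => [_|bi]; first by rewrite -mul_polyC !rmorphM !rmorphXn.
  by rewrite nth_default// !rmorph0 mul0r.
elim/big_ind: _ => [|x y hx hy|i _]; last by rewrite ed_const ed_thetaX_lt ?mulr0.
  by have := edB D 0 0; rewrite !subrr.
by rewrite edD hx hy addr0.
Qed.

Lemma ec_succ D i : ec D.+1 i.+1 = ec D i ^+ q - Dn D ^+ q.-1 * ec D i.+1.
Proof. by []. Qed.

Lemma ec_zero D : ec D.+1 0 = - (Dn D ^+ q.-1 * ec D 0).
Proof. by rewrite /= sub0r. Qed.

Lemma ec_zero_q D : ec D.+1 0 ^+ q = - ((Dn D ^+ q.-1) ^+ q * ec D 0 ^+ q).
Proof. by rewrite -exprMn -sub0r /= qB expr0n (gtn_eqF q_gt0). Qed.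

Lemma ecS D i : ec D.+1 i.+1 * br i.+1 = br D.+1 * ec D i ^+ q.
Proof.
elim: D i => [|D IH] i.
  case: i => [|i]; first by rewrite /= mulr0 subr0 expr1n mulr1 mul1r.
  by rewrite /= mulr0 subr0 expr0n (gtn_eqF q_gt0) mul0r mulr0.
rewrite [ec D.+2 _]ec_succ mulrBl -mulrA IH mulrA kappaS [br D.+2]brS.
case: i => [|i]; first by rewrite ec_zero_q; ring.
rewrite [br i.+2]brS mulrDr -exprMn IH exprMn.
have -> : ec D.+1 i.+1 ^+ q = (ec D i ^+ q) ^+ q - (Dn D ^+ q.-1) ^+ q * ec D i.+1 ^+ q.
  by rewrite ec_succ qB exprMn.
by ring.
Qed.

Lemma ec0_neq0 D : ec D 0 != 0.
Proof.
elim: D => [|D IH]; first by rewrite /= oner_neq0.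
by rewrite /= sub0r oppr_eq0 mulf_neq0// expf_neq0// Dn_neq0.
Qed.

(** Coefficient of x^(q^i) in e_D divided by its linear coefficient, that is, in the product of x
    with all 1 - x/b for b nonzero of degree less than D. *)
Definition al (D i : nat) := ec D i / ec D 0.
(** The factor in the recursion [alS]. Its limit for growing D is the (q-1)-st power of the Carlitz
    period, see [carlitz_period]. *)
Definition cc (D : nat) := br D.+1 * ec D 0 ^+ q / ec D.+1 0.

Lemma al0 D : al D 0 = 1. Proof. by rewrite /al divff// ec0_neq0. Qed.

Lemma alS D i : al D.+1 i.+1 = cc D * al D i ^+ q / br i.+1.
Proof.
have h0 := ec0_neq0 D; have h1 := ec0_neq0 D.+1; have h2 := br_neq0 i.
apply: (canRL (mulfK h2)); rewrite /al /cc mulrAC ecS expr_div_n.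
by field; rewrite h1 expf_neq0.
Qed.

Lemma ccS D : cc D.+1 * br D.+1 ^+ q = cc D * br D.+2.
Proof.
have h0 := ec0_neq0 D; have h1 := ec0_neq0 D.+1; have h2 := br_neq0 D.
have hD := Dn_neq0 D; have hD' := Dn_neq0 D.+1.
rewrite /cc [ec D.+2 0]ec_zero ec_zero_q.
have := kappaS D; set k' := Dn D.+1 ^+ q.-1; set k := (Dn D ^+ q.-1) ^+ q => h.
have k'0 : k' != 0 by rewrite expf_neq0.
have -> : k = k' * br D.+1 / br D.+1 ^+ q by rewrite h mulrAC mulfV ?mul1r// expf_neq0.
by field; rewrite h1 oppr_eq0 mulf_neq0 ?expf_neq0.
Qed.

Lemma abs_cc D : abs (cc D) = q%:R ^+ q.
Proof.
elim: D => [|D IH].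
  rewrite /cc /= Dn0 !expr1n mulr1 sub0r mulr1 (abs_mul absC) (absV absC) (absN absC) (abs1 absC).
  by rewrite invr1 mulr1 abs_br expn1.
have := congr1 abs (ccS D).
rewrite (abs_mul absC (cc D)) (abs_mul absC (cc D.+1)) (absX absC (br _)) !abs_br -exprM -expnSr IH.
by apply: mulIf; rewrite expf_neq0// gt_eqF// (card_Fq_gt0R R Fq).
Qed.

Lemma expr_ltn_small (e : R) : 0 < e -> exists N, forall n, (N <= n)%N -> q%:R ^- n < e.
Proof.
move=> e0; have [N hN] := expq_unbounded Fq e^-1; exists N => n Nn.
have q1 := card_Fq_gt1R R Fq.
rewrite -[e]invrK ltf_pV2 ?posrE ?invr_gt0 ?exprn_gt0 ?(card_Fq_gt0R R Fq)//.
by apply: lt_le_trans hN _; apply: ler_weXn2l => //; exact: ltW.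
Qed.

(** Since [D+2] = [D+1]^q + [1], consecutive terms differ by cc_D [1] / [D+1]^q, which tends to 0
    because all cc_D have absolute value q^q. *)
Lemma cc_cvg : exists2 c, cvg_abs abs cc c & abs c = q%:R ^+ q.
Proof.
have dE D : cc D.+1 - cc D = cc D * br 1 / br D.+1 ^+ q.
  have h := expf_neq0 q (br_neq0 D); apply: (canRL (mulfK h)).
  by rewrite mulrBl ccS brS; ring.
have dv : vanish abs (fun D => cc D.+1 - cc D).
  move=> e e0; have [N hN] := expr_ltn_small (divr_gt0 e0 (exprn_gt0 (q + q) (card_Fq_gt0R R Fq))).
  exists N => n Nn; rewrite dE (abs_mul absC (cc n * _)) (abs_mul absC (cc n)) (absV absC) (absX absC) abs_cc !abs_br expn1 -exprD -exprM -expnSr.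
  rewrite mulrC -ltr_pdivlMr ?exprn_gt0 ?(card_Fq_gt0R R Fq)//; apply: hN.
  apply: leq_trans Nn _; apply: ltnW; apply: (@leq_trans n.+2) => //.
  by apply: ltnW; apply: ltn_expl; exact: finRing_gt1.
have [s hs] := vanish_csum absC (Cinf_complete hC) dv.
have cl : cvg_abs abs cc (cc 0 + s).
  apply: (eq_cvg_abs absC _ (cvg_absD absC (cvg_abs_cst absC (cc 0)) hs)) => n.
  rewrite -(big_mkord xpredT (fun D => cc D.+1 - cc D)) telescope_sumr//.
  by rewrite addrC subrK.
exists (cc 0 + s) => //; apply: le_anti.
rewrite (cvg_abs_le absC (N := 0) _ cl) => [|n _]; last by rewrite abs_cc.
by rewrite (cvg_abs_ge absC (N := 0) _ cl) => [|n _]; last by rewrite abs_cc.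
Qed.

Lemma carlitz_term_vanish (y : C) : vanish abs (fun i => iota (carlitz_D_inv Fq i) * y ^+ (q ^ i)).
Proof.
move=> e e0.
have [n hn] := expq_unbounded Fq (abs y); have [N hN] := expr_ltn_small e0.
have qge1 : 1 <= q%:R :> R by apply: ltW; exact: card_Fq_gt1R.
exists (n + N)%N => i nNi.
rewrite /carlitz_D_inv fmorphV (abs_mul absC) (absV absC) -[iota _]/(Dn i) abs_Dn (absX absC).
apply: le_lt_trans (hN (i - n)%N _); last by lia.
apply: (@le_trans _ _ (q%:R ^- (i * q ^ i) * q%:R ^+ (n * q ^ i))).
  rewrite ler_wpM2l ?invr_ge0 ?exprn_ge0 ?(ltW (card_Fq_gt0R R Fq))//.
  by rewrite exprM lerXn2r ?nnegrE ?(abs_nonneg absC) ?exprn_ge0 ?ltW// (card_Fq_gt0R R Fq).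
rewrite -(@subnK (n * q ^ i) (i * q ^ i)); last by rewrite leq_mul2r; apply/orP; right; lia.
rewrite exprD invfM -mulrA mulVf ?mulr1; last by rewrite expf_neq0// gt_eqF// (card_Fq_gt0R R Fq).
rewrite lef_pV2 ?posrE ?exprn_gt0 ?(card_Fq_gt0R R Fq)// -mulnBl.
by apply: ler_weXn2l => //; rewrite leq_pmulr// qn_gt0N.
Qed.

Lemma carlitz_exp_csum (y : C) :
  csum abs (fun i => iota (carlitz_D_inv Fq i) * y ^+ (q ^ i)) (carlitz_exp abs iota y).
Proof.
have [s hs] := vanish_csum absC (Cinf_complete hC) (carlitz_term_vanish y).
by rewrite /carlitz_exp (lim_absE absC hs).
Qed.

Lemma carlitz_expD x y : carlitz_exp abs iota (x + y) = carlitz_exp abs iota x + carlitz_exp abs iota y.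
Proof.
apply: (csum_unique absC (carlitz_exp_csum (x + y))).
apply: (eq_csum absC _ (csumD absC (carlitz_exp_csum x) (carlitz_exp_csum y))) => i.
by rewrite (exprqnD pF pC) mulrDr.
Qed.

Lemma carlitz_exp_const c x : carlitz_exp abs iota (iA c%:P * x) = iA c%:P * carlitz_exp abs iota x.
Proof.
apply: (csum_unique absC (carlitz_exp_csum _)).
apply: (eq_csum absC _ (csumZ absC (iA c%:P) (carlitz_exp_csum x))) => i.
have cq : iA c%:P ^+ (q ^ i) = iA c%:P.
  by elim: i => [|i IH]; rewrite ?expn0 ?expr1// expnS exprM iotaA_const_q.
by rewrite exprMn cq; ring.
Qed.

Lemma carlitz_expN x : carlitz_exp abs iota (- x) = - carlitz_exp abs iota x.
Proof.
have := carlitz_exp_const (-1) x.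
by rewrite !rmorphN1 /iotaA !rmorphN1 !mulN1r.
Qed.

Lemma carlitz_expB x y : carlitz_exp abs iota (x - y) = carlitz_exp abs iota x - carlitz_exp abs iota y.
Proof. by rewrite carlitz_expD carlitz_expN. Qed.

Lemma carlitz_exp_theta x :
  carlitz_exp abs iota (th * x) = th * carlitz_exp abs iota x + carlitz_exp abs iota x ^+ q.
Proof.
have h := carlitz_exp_csum x.
have hq : csum abs (fun i => (iota (carlitz_D_inv Fq i) * x ^+ (q ^ i)) ^+ q) (carlitz_exp abs iota x ^+ q).
  apply: (eq_cvg_abs absC _ (cvg_absX absC q h)) => n.
  by have := exprqn_sum pF pC (index_enum 'I_n) xpredT (fun i => iota (carlitz_D_inv Fq i) * x ^+ (q ^ i)) 1; rewrite expn1.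
apply: (csum_unique absC (carlitz_exp_csum _)).
apply: (eq_csum absC _ (csumD absC (csumZ absC th h) (csum_shift absC 1 hq))) => i.
have DV k : iota (carlitz_D_inv Fq k) = (Dn k)^-1 by rewrite /carlitz_D_inv fmorphV.
case: i => [|i] /=; first by rewrite expn0 !expr1 addr0 DV Dn0; ring.
rewrite subn1 /= !DV !exprMn -exprM -expnSr exprVn DnS.
have h1 := br_neq0 i; have h2 := Dn_neq0 i.
have -> : th ^+ (q ^ i.+1) = br i.+1 + th by rewrite brE subrK.
by field; rewrite h1 expf_neq0.
Qed.

Lemma cvg_dominated (t : nat -> nat -> C) (s : nat -> R) l S :
  (forall e, 0 < e -> exists N, forall i, (N <= i)%N -> s i < e) ->
  (forall D i, abs (t D i) <= s i) -> (forall i, cvg_abs abs (t^~ i) (l i)) ->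
  csum abs l S -> cvg_abs abs (fun D => \sum_(i < D.+1) t D i) S.
Proof.
move=> sv ts tl lS; apply/(cvg_absP absC) => e e0; have [N hN] := sv e e0.
have lN : cvg_abs abs (fun D => \sum_(i < N) t D i) (\sum_(i < N) l i).
  by apply: (@cvg_abs_sum _ _ _ absC _ _ xpredT (fun (i : 'I_N) D => t D i) (fun i => l i)) => i _.
have lv := csum_vanish absC lS; have [N1 hN1] := lv e e0.
have /(cvg_absP absC)/(_ e e0)[N2 hN2] := lN.
have SN : abs (S - \sum_(i < N) l i) < e.
  have [N3 hN3] := (cvg_absP absC _ _).1 lS e e0.
  have := hN3 (maxn N3 N) (leq_maxl _ _).
  have -> : S - \sum_(i < N) l i = (\sum_(i < maxn N3 N) l i - \sum_(i < N) l i) - (\sum_(i < maxn N3 N) l i - S) by ring.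
  move=> h; apply: (absB_lt absC) => //; rewrite sum_ord_sub ?leq_maxr//.
  rewrite big_nat_cond.
  have sl i : (N <= i)%N -> abs (l i) < e.
    move=> Ni; apply: le_lt_trans (hN i Ni).
    by apply: (cvg_abs_le absC (N := 0) _ (tl i)) => D _.
  elim/big_ind: _ => [|a b ha hb|i /andP[/andP[/sl]]]//; first by rewrite (abs0 absC).
  exact: (absD_lt absC).
exists (maxn N N2) => D; rewrite geq_max => /andP[ND N2D].
have -> : \sum_(i < D.+1) t D i - S = (\sum_(i < D.+1) t D i - \sum_(i < N) t D i)
  + (\sum_(i < N) t D i - \sum_(i < N) l i) - (S - \sum_(i < N) l i) by ring.
apply: (absB_lt absC) => //; apply: (absD_lt absC); last exact: hN2.
rewrite sum_ord_sub ?(leqW ND)// big_nat_cond.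
elim/big_ind: _ => [|a b ha hb|i /andP[/andP[/hN + _] _]]//; first by rewrite (abs0 absC).
  exact: (absD_lt absC).
exact: le_lt_trans.
Qed.

Section Period.
Variables (pi c : C).
Hypotheses (ccc : cvg_abs abs cc c) (pic : pi ^+ q.-1 = c) (absc : abs c = q%:R ^+ q).

Lemma pi_neq0 : pi != 0.
Proof.
have q1 : (0 < q.-1)%N by case: #|Fq| (finRing_gt1 Fq) => [|[]].
apply: contra_eq_neq absc => pi0; rewrite -pic pi0 expr0n (gtn_eqF q1) (abs0 absC).
by rewrite lt_eqF// exprn_gt0// (card_Fq_gt0R R Fq).
Qed.

Lemma pi_powS i : pi ^+ (q ^ i.+1).-1 = c * (pi ^+ (q ^ i).-1) ^+ q.
Proof.
rewrite -pic -exprM -exprD; congr (_ ^+ _).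
by rewrite expnSr; case: (q ^ i)%N (qn_gt0N i) => // a _; case: #|Fq| q_gt0 => // b _; rewrite mulSn addSn.
Qed.

Definition al_lim i := pi ^+ (q ^ i).-1 / Dn i.

Lemma al_limS i : al_lim i.+1 = c * al_lim i ^+ q / br i.+1.
Proof.
have h1 := br_neq0 i; have h2 := Dn_neq0 i.
by rewrite /al_lim pi_powS DnS expr_div_n; field; rewrite h1 expf_neq0.
Qed.

Lemma al_lim0 : al_lim 0 = 1.
Proof. by rewrite /al_lim expn0 expr0 Dn0 divr1. Qed.

Lemma al_cvg i : cvg_abs abs (al^~ i) (al_lim i).
Proof.
elim: i => [|i IH].
  by rewrite al_lim0; apply: (eq_cvg_abs absC _ (cvg_abs_cst absC 1)) => D; rewrite al0.
have h : cvg_abs abs (fun D => al D.+1 i.+1) (al_lim i.+1).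
  rewrite al_limS; apply: (eq_cvg_abs absC (x := fun D => cc D * al D i ^+ q * (br i.+1)^-1)).
    by move=> D; rewrite alS.
  apply: (cvg_absM absC); last exact: (cvg_abs_cst absC).
  by apply: (cvg_absM absC) => //; exact: (cvg_absX absC).
move/(cvg_absP absC): h => h; apply/(cvg_absP absC) => e e0; have [N hN] := h e e0.
by exists N.+1 => -[//|D] ND; exact: hN.
Qed.

Lemma abs_al_le D i : abs (al D i) <= abs (al_lim i).
Proof.
elim: i D => [|i IH] D; first by rewrite al0 al_lim0.
case: D => [|D]; first by rewrite /al ec_gt// mul0r (abs0 absC) (abs_nonneg absC).
rewrite alS al_limS (abs_mul absC (cc D * _)) (abs_mul absC (cc D)) (abs_mul absC (c * _)) (abs_mul absC c) (absX absC (al D i)) (absX absC (al_lim i)) abs_cc absc ler_wpM2r ?(abs_nonneg absC)//.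
rewrite ler_wpM2l ?exprn_ge0 ?(ltW (card_Fq_gt0R R Fq))//.
by rewrite lerXn2r ?nnegrE ?(abs_nonneg absC).
Qed.

Lemma al_lim_term i x : al_lim i * x ^+ (q ^ i) = pi^-1 * (iota (carlitz_D_inv Fq i) * (pi * x) ^+ (q ^ i)).
Proof.
rewrite /al_lim /carlitz_D_inv fmorphV -[iota _]/(Dn i) exprMn.
have -> : pi ^+ (q ^ i) = pi * pi ^+ (q ^ i).-1 by rewrite -exprS prednK ?qn_gt0N.
by field; rewrite pi_neq0 Dn_neq0.
Qed.

(** The product expansion of e_C. The coefficients converge by [al_cvg], and those of e_D are
    dominated by their limits: both obey the same recursion, with factors [cc D] and [c] of equal
    absolute value. *)
Lemma ed_cvg x : cvg_abs abs (fun D => ed D x / ec D 0) (pi^-1 * carlitz_exp abs iota (pi * x)).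
Proof.
apply: (eq_cvg_abs absC (x := fun D => \sum_(i < D.+1) al D i * x ^+ (q ^ i))).
  by move=> D; rewrite edE mulr_suml; apply: eq_bigr => i _; rewrite /al mulrAC.
have S := csumZ absC pi^-1 (carlitz_exp_csum (pi * x)).
apply: (@cvg_dominated (fun D i => al D i * x ^+ (q ^ i)) (fun i => abs (al_lim i * x ^+ (q ^ i))) (fun i => al_lim i * x ^+ (q ^ i))).
- move=> e e0; have [N hN] := csum_vanish absC S e0; exists N => i Ni.
  by rewrite al_lim_term hN.
- move=> D i; rewrite (abs_mul absC (al D i)) (abs_mul absC (al_lim i)) ler_wpM2r ?(abs_nonneg absC)//; exact: abs_al_le.
- by move=> i; apply: (cvg_absM absC); [exact: al_cvg|exact: (cvg_abs_cst absC)].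
- by apply: (eq_csum absC _ S) => i; rewrite al_lim_term.
Qed.

End Period.
End Carlitz.

Lemma sum_ord_shift (V : zmodType) (F : nat -> V) i k : (i <= k)%N ->
  \sum_(j < k - i) F (j + i)%N = \sum_(n < k | (i <= n)%N) F n.
Proof.
move=> ik; rewrite -(big_mkord (fun n => (i <= n)%N) F).
rewrite [RHS](@big_cat_nat _ _ _ i)//= [X in _ = X + _]big_nat_cond [X in _ = X + _]big1; last first.
  by move=> n /andP[/andP[_ ni]]; rewrite leqNgt ni.
rewrite add0r; transitivity (\sum_(0 + i <= n < k | (i <= n)%N) F n); last by rewrite add0n.
rewrite big_addn big_mkord.
by apply: eq_bigl => n; rewrite leq_addl.
Qed.

Lemma horner_deriv_prod_XsubC (L : fieldType) (s : seq L) (x : L) : x \notin s ->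
  (\prod_(z <- s) ('X - z%:P))^`().[x] = (\prod_(z <- s) (x - z)) * \sum_(z <- s) (x - z)^-1.
Proof.
elim: s => [|z s IH]; first by rewrite !big_nil derivC horner0 mulr0.
rewrite inE negb_or => /andP[xz xs]; rewrite !big_cons derivM derivXsubC mul1r hornerD hornerM.
rewrite IH// hornerXsubC horner_prod; under eq_bigr do rewrite hornerXsubC.
by field; rewrite subr_eq0.
Qed.

(** * Sums over the rows of the period lattice *)

Section Rows.
Variables (R : realType) (Fq : finFieldType) (C : fieldType) (abs : C -> R).
Variable (iota : {rmorphism ratfun Fq -> C}).
Hypothesis hC : is_Cinf abs iota.
Let absC := Cinf_abs hC.
Variable p : nat.
Hypothesis pF : p \in [pchar Fq].
Let pC : p \in [pchar C] := pchar_ext_field iota pF.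
Local Notation q := #|Fq|.
Local Notation iA := (iotaA iota).
Local Notation th := (iA 'X).
Local Notation br i := (iA (bracket Fq i)).
Local Notation Dn i := (iA (carlitz_D Fq i)).
Local Notation ed := (ed iota).
Local Notation ec := (ec iota).
Local Notation al := (al iota).
Local Notation box := (box Fq).
Local Notation expC := (carlitz_exp abs iota).

Lemma iotaA_inj : injective (iA).
Proof. by move=> a b ab; apply/eqP; rewrite -subr_eq0 -(iotaA_eq0 iota) iotaAB ab subrr. Qed.

Lemma qR0 n : ((q ^ n.+1)%:R : C) = 0.
Proof.
have [m m0 ->] := card_pchar_pow pF; apply/eqP; rewrite -(dvdn_pcharf pC).
by rewrite -expnM; apply: dvdn_exp => //; rewrite muln_gt0 m0.
Qed.

Definition edp D : {poly C} := \sum_(i < D.+1) ec D i *: 'X^(q ^ i).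

Lemma horner_edp D x : (edp D).[x] = ed D x.
Proof. by rewrite (edE iota pF) horner_sum; apply: eq_bigr => i _; rewrite hornerZ hornerXn. Qed.

(** Both sides are monic of degree q^D, and the q^D elements of the box are zeros of [edp D]. *)
Lemma edp_prod D : edp D = \prod_(b <- box D) ('X - (iA b)%:P).
Proof.
have lt_q i : (i < D)%N -> (q ^ i < q ^ D)%N by rewrite ltn_exp2l ?finRing_gt1.
have [s1 l1] : size (edp D) = (q ^ D).+1 /\ lead_coef (edp D) = 1.
  rewrite /edp big_ord_recr/= (ec_diag iota pF) scale1r addrC.
  have h : (size (\sum_(i < D) ec D i *: 'X^(q ^ i) : {poly C})%R < size ('X^(q ^ D) : {poly C})%R)%N.
    rewrite size_polyXn ltnS; apply: leq_trans (size_sum _ _ _) _; apply/bigmax_leqP => i _.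
    by apply: leq_trans (size_scale_leq _ _) _; rewrite size_polyXn lt_q.
  by rewrite size_polyDl// lead_coefDl// lead_coefXn size_polyXn.
have su : uniq (map iA (box D)) by rewrite map_inj_uniq ?box_uniq//; exact: iotaA_inj.
rewrite -[RHS](big_map iA xpredT (fun z => 'X - z%:P)).
have := @all_roots_prod_XsubC _ (edp D) (map iA (box D)).
rewrite l1 scale1r; apply; rewrite ?uniq_rootsE//.
  by rewrite s1 size_map size_box.
by apply/allP => _ /mapP[b bD ->]; rewrite rootE horner_edp (ed_box iota pF).
Qed.

Lemma ed_prod D x : ed D x = \prod_(b <- box D) (x - iA b).
Proof.
rewrite -horner_edp edp_prod horner_prod.
by apply: eq_bigr => b _; rewrite hornerXsubC.
Qed.

Lemma deriv_edp D : (edp D)^`() = (ec D 0)%:P.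
Proof.
rewrite /edp raddf_sum big_ord_recl/= derivZ expn0 derivXn expr0 alg_polyC.
rewrite big1 ?addr0// => i _; rewrite derivZ derivXn -mulr_natr.
by rewrite -polyC_natr qR0 mulr0 scaler0.
Qed.

Definition rs D n (x : C) := \sum_(b <- box D) ((x - iA b) ^+ n)^-1.

Lemma rs1E D x : (forall a, x != iA a) -> rs D 1 x = ec D 0 / ed D x.
Proof.
move=> xA; have xs : x \notin map iA (box D) by apply/mapP => -[b _ xb]; have := xA b; rewrite xb eqxx.
have := horner_deriv_prod_XsubC xs.
rewrite !(big_map (iotaA iota)) -edp_prod deriv_edp hornerC -ed_prod => ->.
have e0 : ed D x != 0.
  by rewrite ed_prod prodf_seq_neq0; apply/allP => b _ /=; rewrite subr_eq0.
by rewrite mulrAC mulfV// mul1r /rs; apply: eq_bigr => b _; rewrite expr1.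
Qed.

Lemma sum_scale_const D x m n : (forall y, \sum_(b <- box D) (y - iA b) ^+ m = x) ->
  (\sum_(b <- box D.+1) (n - iA b) ^+ m) = 0.
Proof.
move=> h; rewrite (perm_big _ (boxS Fq D)) big_allpairs_dep/=.
transitivity (\sum_(c <- enum Fq) x).
  apply: eq_bigr => c _; rewrite -(h (n - iA (c *: 'X^D))).
  by apply: eq_bigr => b _; rewrite iotaAD opprD addrA addrAC.
by rewrite big_const_seq count_predT -cardE iter_addr_0 -mulr_natr -[q in q%:R](expn1 q) qR0 mulr0.
Qed.

(* As a polynomial in x, the sum over the smaller box has more periods than its degree,
   hence is constant; summing q copies of it gives 0. *)
Lemma power_sum D m x : (m < q ^ D)%N -> \sum_(b <- box D.+1) (x - iA b) ^+ m = 0.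
Proof.
move=> mD; pose P : {poly C} := \sum_(b <- box D) ('X - (iA b)%:P) ^+ m.
have PE y : P.[y] = \sum_(b <- box D) (y - iA b) ^+ m.
  by rewrite horner_sum; apply: eq_bigr => b _; rewrite horner_exp hornerXsubC.
apply: (@sum_scale_const D P.[0]) => y; rewrite -PE.
have Pper c z : c \in box D -> P.[z + iA c] = P.[z].
  move=> cD; rewrite !PE [RHS](perm_big _ (box_shift cD)) [RHS](big_map (fun b => b - c)).
  by apply: eq_bigr => b _; rewrite iotaAB opprB addrA.
have : P - (P.[0])%:P = 0.
  apply: (@roots_geq_poly_eq0 _ _ (map iA (box D))).
  - apply/allP => _ /mapP[b bD ->]; rewrite rootE hornerD hornerN hornerC.
    by have := Pper b 0 bD; rewrite add0r => ->; rewrite subrr.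
  - by rewrite map_inj_uniq ?box_uniq//; exact: iotaA_inj.
  rewrite size_map size_box; apply: leq_trans mD; apply: leq_trans (size_polyD _ _) _.
  rewrite geq_max; apply/andP; split.
    apply: leq_trans (size_sum _ _ _) _; apply/bigmax_leqP_seq => b _ _.
    apply: leq_trans (size_poly_exp_leq _ _) _; rewrite size_XsubC /=; lia.
  by rewrite size_polyN; apply: leq_trans (size_polyC_leq1 _) _.
by move/(congr1 (fun s : {poly C} => s.[y])); rewrite hornerD hornerN hornerC horner0 => /eqP; rewrite subr_eq0 => /eqP.
Qed.

(** The case y = 0 is included, with 0 as the inverse of 0; it occurs for the term b = 0 of the row
    through the origin. *)
Lemma frac_pow_lt (y : C) i k : (i < k)%N ->
  y ^+ (q ^ i) * (y ^+ (q ^ k))^-1 = ((y ^+ (q ^ (k - i)).-1)^-1) ^+ (q ^ i).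
Proof.
move=> ik; have qn := qn_gt0N Fq.
have kE : (q ^ k = q ^ i + (q ^ (k - i)).-1 * q ^ i)%N.
  have := qn (k - i)%N; case E : (q ^ (k - i))%N => [//|a] _ /=.
  by rewrite -mulSn -E -expnD subnK// ltnW.
have [->|y0] := eqVneq y 0.
  have k1 : (0 < (q ^ (k - i)).-1)%N.
    rewrite -(@ltn_add2r 1) add0n addn1 prednK// -{1}(expn0 q) ltn_exp2l ?finRing_gt1// subn_gt0//.
  by rewrite !expr0n (gtn_eqF (qn k)) (gtn_eqF k1) invr0 mulr0 expr0n (gtn_eqF (qn i)).
rewrite kE exprD exprM exprVn; set a := y ^+ (q ^ i); set b := (y ^+ _) ^+ _.
by field; rewrite /a /b !expf_neq0.
Qed.

Lemma frac_pow_gt (y : C) i k : (k < i)%N ->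
  y ^+ (q ^ i) * (y ^+ (q ^ k))^-1 = (y ^+ (q ^ (i - k)).-1) ^+ (q ^ k).
Proof.
by move=> ki; have /(congr1 GRing.inv) := frac_pow_lt y ki; rewrite invfM invrK exprVn invrK mulrC.
Qed.

Lemma power_sum_pred D n x : (n < D)%N -> \sum_(b <- box D) (x - iA b) ^+ (q ^ n).-1 = 0.
Proof.
case: D => // D; rewrite ltnS => nD; apply: power_sum.
by rewrite prednK ?qn_gt0N// leq_exp2l// finRing_gt1.
Qed.

(** Divide e_D(x - b) = e_D(x) by (x - b)^(q^k) and sum over b. The monomials of e_D with i >= k
    give power sums with exponents q^n - 1, n < D, which vanish; those with i < k give q^i-th powers
    of sums of (x - b)^(-(q^(k-i) - 1)). *)
Lemma row_identity D k x : (forall a, x != iA a) -> (0 < k)%N ->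
  \sum_(i < k) ec D i * rs D (q ^ (k - i)).-1 x ^+ (q ^ i) = ed D x * rs D 1 x ^+ (q ^ k).
Proof.
move=> xA k0.
have y0 b : x - iA b != 0 by rewrite subr_eq0.
transitivity (\sum_(b <- box D) ed D (x - iA b) * ((x - iA b) ^+ (q ^ k))^-1); last first.
  rewrite (exprqn_sum pF pC) mulr_sumr big_seq [RHS]big_seq; apply: eq_bigr => b bD.
  by rewrite (edB iota pF) (ed_box iota pF)// subr0 expr1 exprVn.
transitivity (\sum_(i < D.+1) ec D i * \sum_(b <- box D) (x - iA b) ^+ (q ^ i) * ((x - iA b) ^+ (q ^ k))^-1); last first.
  under [RHS]eq_bigr do rewrite (edE iota pF) mulr_suml.
  rewrite exchange_big; apply: eq_bigr => i _; rewrite mulr_sumr.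
  by apply: eq_bigr => b _; rewrite mulrA.
pose T i := ec D i * \sum_(b <- box D) (x - iA b) ^+ (q ^ i) * ((x - iA b) ^+ (q ^ k))^-1.
have Tlt i : (i < k)%N -> ec D i * rs D (q ^ (k - i)).-1 x ^+ (q ^ i) = T i.
  move=> ik; rewrite /T /rs (exprqn_sum pF pC); congr (_ * _).
  by apply: eq_bigr => b _; rewrite frac_pow_lt.
have Tge i : (k <= i)%N -> T i = 0.
  rewrite leq_eqVlt => /orP[/eqP <-|ki]; rewrite /T.
    have [Dk|kD] := ltnP D k; first by rewrite (ec_gt iota pF) ?mul0r.
    rewrite (eq_bigr (fun b => (x - iA b) ^+ (q ^ 0).-1)) => [|b _]; last by rewrite divff ?expf_neq0.
    by rewrite power_sum_pred ?mulr0//; apply: leq_trans kD.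
  have [Di|iD] := ltnP D i; first by rewrite (ec_gt iota pF) ?mul0r.
  rewrite (eq_bigr (fun b => ((x - iA b) ^+ (q ^ (i - k)).-1) ^+ (q ^ k))) => [|b _]; last exact: frac_pow_gt.
  rewrite -(exprqn_sum pF pC) power_sum_pred ?expr0n ?(gtn_eqF (qn_gt0N _ _)) ?mulr0//; lia.
rewrite (eq_bigr (fun i : 'I_k => T i)) => [|i _]; last exact: Tlt.
rewrite -!(big_mkord xpredT T); have [kD|Dk] := leqP k D.+1.
  rewrite [RHS](@big_cat_nat _ _ _ k)//= [X in _ = _ + X]big_nat_cond [X in _ = _ + X]big1 ?addr0//.
  by move=> i /andP[/andP[/Tge]].
rewrite (@big_cat_nat _ _ _ D.+1)//= ?(ltnW Dk)// [X in _ + X]big_nat_cond [X in _ + X]big1 ?addr0//.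
by move=> i /andP[/andP[Di _] _]; rewrite /T (ec_gt iota pF) ?mul0r.
Qed.

(** The same division at x = 0, where e_D(-b) = 0 makes the total vanish. The term b = 0 is absent,
    so the monomial i = k meets a sum of q^D - 1 ones, which is -1 and puts the coefficient of e_D
    on the right. *)
Lemma row_identity0 D k : (0 < D)%N -> (0 < k)%N ->
  \sum_(i < k) ec D i * rs D (q ^ (k - i)).-1 0 ^+ (q ^ i) = ec D k.
Proof.
move=> D0 k0.
pose T i := ec D i * \sum_(b <- box D) (0 - iA b) ^+ (q ^ i) * ((0 - iA b) ^+ (q ^ k))^-1.
have T0 : \sum_(i < D.+1) T i = 0.
  rewrite /T; under eq_bigr do rewrite mulr_sumr.
  rewrite exchange_big big_seq big1// => b bD.
  under eq_bigr do rewrite mulrA.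
  rewrite -mulr_suml -(edE iota pF) (edB iota pF) (ed_box iota pF)// subr0.
  by have := edB iota pF D 0 0; rewrite !subrr => ->; rewrite mul0r.
have Tlt i : (i < k)%N -> ec D i * rs D (q ^ (k - i)).-1 0 ^+ (q ^ i) = T i.
  move=> ik; rewrite /T /rs (exprqn_sum pF pC); congr (_ * _).
  by apply: eq_bigr => b _; rewrite frac_pow_lt.
have Tk : T k = - ec D k.
  rewrite /T -mulrN1; congr (_ * _).
  rewrite (bigD1_seq 0) ?box_uniq ?mem_box ?size_poly0//= /iotaA !rmorph0 subrr.
  rewrite expr0n (gtn_eqF (qn_gt0N _ _)) mul0r add0r.
  rewrite (eq_bigr (fun=> 1)) => [|b b0]; last first.
    by rewrite divff// expf_neq0// sub0r oppr_eq0 iotaA_eq0.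
  rewrite big_const_seq iter_addr_0.
  have : count (fun b => b != 0) (box D) = (q ^ D).-1.
    have := count_predC (pred1 (0 : {poly Fq})) (box D); rewrite size_box.
    by rewrite count_uniq_mem ?box_uniq// mem_box size_poly0 /= => <-.
  move=> ->; apply/eqP; rewrite -addr_eq0 -mulrSr prednK ?qn_gt0N//.
  by rewrite -(prednK D0) qR0.
have Tgt i : (k < i)%N -> T i = 0.
  move=> ki; rewrite /T; have [Di|iD] := ltnP D i; first by rewrite (ec_gt iota pF) ?mul0r.
  rewrite (eq_bigr (fun b => ((0 - iA b) ^+ (q ^ (i - k)).-1) ^+ (q ^ k))) => [|b _]; last exact: frac_pow_gt.
  rewrite -(exprqn_sum pF pC) power_sum_pred ?expr0n ?(gtn_eqF (qn_gt0N _ _)) ?mulr0//; lia.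
rewrite (eq_bigr (fun i : 'I_k => T i)) => [|i _]; last exact: Tlt.
have : \sum_(i < k.+1) T i = \sum_(i < D.+1) T i.
  rewrite -!(big_mkord xpredT T); have [kD|Dk] := leqP k D.
    rewrite [RHS](@big_cat_nat _ _ _ k.+1)//= [X in _ = _ + X]big_nat_cond [X in _ = _ + X]big1 ?addr0//.
    by move=> i /andP[/andP[/Tgt]].
  rewrite (@big_cat_nat _ _ _ D.+1)//= 1?ltnW// [X in _ + X]big_nat_cond [X in _ + X]big1 ?addr0//.
  by move=> i /andP[/andP[Di _] _]; rewrite /T (ec_gt iota pF) ?mul0r.
by rewrite T0 big_ord_recr/= Tk => /eqP; rewrite subr_eq0 => /eqP.
Qed.

Fixpoint carlitz_log (i : nat) : ratfun Fq :=
  if i is j.+1 then - carlitz_log j / FracField.tofrac (bracket Fq i) else 1.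
Local Notation ll i := (iota (carlitz_log i)).

Lemma logS i : ll i.+1 * br i.+1 = - ll i.
Proof.
by rewrite /= fmorph_div rmorphN -[iota (FracField.tofrac _)]/(br i.+1) divfK// (br_neq0 hC).
Qed.

(** Let c_m be the coefficient of x^(q^m) in e_C(log_C(x)). Splitting [m+1] as [m+1-i]^(q^i) + [i]
    gives [m+1] c_(m+1) = c_m^q - c_m; as c_0 = 1, all later coefficients vanish. *)
Lemma exp_log n : (0 < n)%N -> \sum_(i < n.+1) (Dn i)^-1 * ll (n - i) ^+ (q ^ i) = 0.
Proof.
pose c m := \sum_(i < m.+1) (Dn i)^-1 * ll (m - i) ^+ (q ^ i).
have c0 : c 0%N = 1 by rewrite /c big_ord1 subn0 Dn0 invr1 mul1r !rmorph1 expr1n.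
have h m : br m.+1 * c m.+1 = c m ^+ q - c m.
  have e1 (i : 'I_m.+2) : br m.+1 * ((Dn i)^-1 * ll (m.+1 - i) ^+ (q ^ i)) =
    (Dn i)^-1 * (br (m.+1 - i) * ll (m.+1 - i)) ^+ (q ^ i) + br i * (Dn i)^-1 * ll (m.+1 - i) ^+ (q ^ i).
    have im : (i <= m.+1)%N by rewrite -ltnS.
    have -> : br m.+1 = br (m.+1 - i) ^+ (q ^ i) + br i.
      by rewrite !brE (exprqnB pF pC) -exprM -expnD subnK//; ring.
    by rewrite exprMn; ring.
  rewrite /c mulr_sumr; under eq_bigr do rewrite e1.
  rewrite big_split/= addrC; congr (_ + _).
    rewrite big_ord_recl br0 !mul0r add0r -[q]expn1 (exprqn_sum pF pC) expn1.
    apply: eq_bigr => i _; rewrite lift0 subSS DnS invfM mulrA divff ?(br_neq0 hC)// mul1r.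
    by rewrite exprMn exprVn -exprM -expnSr.
  rewrite big_ord_recr/= subnn br0 mul0r expr0n (gtn_eqF (qn_gt0N _ _)) mulr0 addr0.
  rewrite -sumrN; apply: eq_bigr => i _.
  have im : (i <= m)%N by rewrite -ltnS.
  by rewrite subSn// [br _ * ll _]mulrC logS (exprqnN pF pC) mulrN.
move=> n0; rewrite -/(c n); case: n n0 => // n _; elim: n => [|n IH].
  apply: (mulfI (br_neq0 hC 0)); rewrite h c0 expr1n subrr mulr0//.
by apply: (mulfI (br_neq0 hC n.+1)); rewrite h IH expr0n (gtn_eqF (q_gt0 _)) subr0 mulr0.
Qed.

(** Closed form of the Goss polynomial of index q^k - 1 of e_C. *)
Definition eis_goss k (u : C) := \sum_(i < k) ll i * u ^+ (q ^ k - q ^ i).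

(** After exchanging the sums, u^(q^k - q^n) is multiplied by the n-th coefficient of e_C(log_C(x)),
    which is 0 unless n = 0. This is the limit form of [row_identity]. *)
Lemma eis_goss_rec k u : (0 < k)%N ->
  \sum_(i < k) (Dn i)^-1 * eis_goss (k - i) u ^+ (q ^ i) = u ^+ (q ^ k).-1.
Proof.
move=> k0.
transitivity (\sum_(i < k) \sum_(n < k | (i <= n)%N) (Dn i)^-1 * ll (n - i) ^+ (q ^ i) * u ^+ (q ^ k - q ^ n)).
  apply: eq_bigr => i _; rewrite /eis_goss (exprqn_sum pF pC) mulr_sumr.
  rewrite -(@sum_ord_shift _ (fun n => (Dn i)^-1 * ll (n - i) ^+ (q ^ i) * u ^+ (q ^ k - q ^ n))) ?(ltnW (ltn_ord i))//.
  apply: eq_bigr => j _; rewrite addnK exprMn mulrA -exprM mulnBl -!expnD subnK//.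
  exact: ltnW.
rewrite (exchange_big_dep xpredT)//=.
transitivity (\sum_(n < k) (n == 0 :> nat)%:R * u ^+ (q ^ k - q ^ n)).
  apply: eq_bigr => n _; rewrite -mulr_suml; congr (_ * _).
  have nk := ltn_ord n.
  transitivity (\sum_(i < n.+1) (Dn i)^-1 * ll (n - i) ^+ (q ^ i)).
    by rewrite [RHS](big_ord_widen k (fun i => (Dn i)^-1 * ll (n - i) ^+ (q ^ i))).
  case: (posnP n) => [->|n0]; last exact: exp_log.
  by rewrite big_ord1 subn0 Dn0 invr1 mul1r !rmorph1 expr1n.
case: k k0 => // k _; rewrite big_ord_recl big1 ?addr0/= ?mul1r ?expn0 ?subn1// => i _.
by rewrite mul0r.
Qed.

Section Limits.
Variables (pi c : C).
Hypotheses (ccc : cvg_abs abs (cc iota) c) (pic : pi ^+ q.-1 = c) (absc : abs c = q%:R ^+ q).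

(** A triangular system: as [al D 0] is 1, the term i = 0 expresses [X k D] by sums of smaller
    index, and the other coefficients tend to pi^(q^i - 1) / D_i. By induction on k the limits solve
    the limit system, up to the homogeneity factor pi^(q^k - 1). *)
Lemma recursive_limit (X Y : nat -> nat -> C) (gam eta : nat -> C) :
  (forall k D, (0 < k)%N -> (0 < D)%N -> \sum_(i < k) al D i * X (k - i)%N D ^+ (q ^ i) = Y k D) ->
  (forall k, (0 < k)%N -> cvg_abs abs (Y k) (pi ^+ (q ^ k).-1 * eta k)) ->
  (forall k, (0 < k)%N -> \sum_(i < k) (Dn i)^-1 * gam (k - i)%N ^+ (q ^ i) = eta k) ->
  forall k, (0 < k)%N -> cvg_abs abs (X k) (pi ^+ (q ^ k).-1 * gam k).
Proof.
move=> hX hY hg k; elim/ltn_ind: k => -[//|k] IH _.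
apply: (@cvg_abs_near _ _ _ absC (fun D => Y k.+1 D - \sum_(i < k) al D i.+1 * X (k - i)%N D ^+ (q ^ i.+1)) _ _ 1%N).
  move=> D D0; rewrite -hX// big_ord_recl (al0 hC) expn0 expr1 mul1r subn0.
  by rewrite [X in _ + X - _](eq_bigr (fun i : 'I_k => al D i.+1 * X (k - i)%N D ^+ (q ^ i.+1))) ?addrK.
have -> : pi ^+ (q ^ k.+1).-1 * gam k.+1 = pi ^+ (q ^ k.+1).-1 * eta k.+1 -
    \sum_(i < k) al_lim iota pi i.+1 * (pi ^+ (q ^ (k - i)).-1 * gam (k - i)%N) ^+ (q ^ i.+1).
  rewrite -hg// big_ord_recl Dn0 invr1 mul1r expn0 expr1 subn0 mulrDr -addrA.
  rewrite -[LHS]addr0; congr (_ + _); apply/esym/eqP; rewrite mulr_sumr -sumrB big1// => i _.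
  rewrite lift0 subSS /al_lim exprMn -exprM.
  have -> : (q ^ k.+1).-1 = ((q ^ i.+1).-1 + (q ^ (k - i)).-1 * q ^ i.+1)%N.
    have -> : (q ^ k.+1 = q ^ (k - i) * q ^ i.+1)%N by rewrite -expnD addnS subnK// ltnW.
    have := qn_gt0N Fq (k - i); have := qn_gt0N Fq i.+1.
    by case: (q ^ (k - i))%N => [|a]; case: (q ^ i.+1)%N => [|b]// _ _; rewrite mulSn addSn.
  by rewrite exprD; ring.
apply: (cvg_absB absC); first exact: hY.
apply: (@cvg_abs_sum _ _ _ absC _ _ xpredT (fun (i : 'I_k) D => al D i.+1 * X (k - i)%N D ^+ (q ^ i.+1))
  (fun i : 'I_k => al_lim iota pi i.+1 * (pi ^+ (q ^ (k - i)).-1 * gam (k - i)%N) ^+ (q ^ i.+1))) => i _.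
apply: (cvg_absM absC); first exact: (al_cvg hC pF ccc pic).
by apply: (cvg_absX absC); apply: IH; have := ltn_ord i; lia.
Qed.

Lemma row0_cvg k : (0 < k)%N -> cvg_abs abs (fun D => rs D (q ^ k).-1 0) (pi ^+ (q ^ k).-1 * - ll k).
Proof.
move=> k0; apply: (@recursive_limit (fun k D => rs D (q ^ k).-1 0) (fun k D => al D k)
   (fun k => - ll k) (fun k => (Dn k)^-1)) => // {k k0} k.
- move=> D k0 D0; rewrite /al -(row_identity0 D0 k0) mulr_suml.
  by apply: eq_bigr => i _; rewrite mulrAC.
- move=> k0; exact: (al_cvg hC pF ccc pic).
- move=> k0; have := exp_log k0; rewrite big_ord_recr/= subnn rmorph1 expr1n mulr1.
  move=> /eqP; rewrite addrC addr_eq0 => /eqP ->; rewrite -sumrN.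
  by apply: eq_bigr => i _; rewrite (exprqnN pF pC) mulrN.
Qed.

Lemma row1_cvg x : (forall a, x != iA a) -> expC (pi * x) != 0 ->
  cvg_abs abs (fun D => rs D 1 x) (pi * (expC (pi * x))^-1).
Proof.
move=> xA e0; have pi0 := pi_neq0 hC pic absc.
have := cvg_absV absC _ (ed_cvg hC pF ccc pic absc x).
rewrite mulf_neq0 ?invr_eq0// invfM invrK => /(_ isT).
by apply: eq_cvg_abs => // D; rewrite rs1E// invfM invrK mulrC.
Qed.

(** The first-order sum is the logarithmic derivative of e_D, so e_D(x) times it is the linear
    coefficient of e_D. Dividing [row_identity] by that coefficient leaves the (q^k - 1)-st power of
    the first-order sum, whose limit is known, and [eis_goss] solves the limit system. *)
Lemma row_cvg k x : (forall a, x != iA a) -> expC (pi * x) != 0 -> (0 < k)%N ->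
  cvg_abs abs (fun D => rs D (q ^ k).-1 x) (pi ^+ (q ^ k).-1 * eis_goss k (expC (pi * x))^-1).
Proof.
move=> xA e0 k0; pose u := (expC (pi * x))^-1.
apply: (@recursive_limit (fun k D => rs D (q ^ k).-1 x) (fun k D => rs D 1 x ^+ (q ^ k).-1)
   (fun k => eis_goss k u) (fun k => u ^+ (q ^ k).-1)) => // {k k0} k.
- move=> D k0 D0.
  have ed0 : ed D x != 0.
    by rewrite ed_prod prodf_seq_neq0; apply/allP => b _ /=; rewrite subr_eq0.
  have ec0 := ec0_neq0 hC D.
  have -> : rs D 1 x ^+ (q ^ k).-1 = (ec D 0)^-1 * (ed D x * rs D 1 x ^+ (q ^ k)).
    rewrite -{2}(prednK (qn_gt0N Fq k)) exprS {2}rs1E//.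
    by field; rewrite ec0 ed0.
  rewrite -row_identity// mulr_sumr; apply: eq_bigr => i _; rewrite /al; ring.
- by move=> k0; rewrite -exprMn; apply: (cvg_absX absC); exact: row1_cvg.
- exact: eis_goss_rec.
Qed.

Lemma abs_ed_ec D x : abs (ed D x / ec D 0) =
  \prod_(b <- box D) (if b == 0 then abs x else abs (x - iA b) / abs (iA b)).
Proof.
have ecE : ec D 0 = \prod_(b <- box D | b != 0) (- iA b).
  have b0 : 0 \in box D by rewrite mem_box size_poly0.
  have EX : edp D = (\prod_(b <- box D | b != 0) ('X - (iA b)%:P)) * 'X.
    by rewrite edp_prod (bigD1_seq 0) ?box_uniq//= /iotaA !rmorph0 subr0 mulrC.
  have := congr1 (fun s : {poly C} => s`_1) EX; rewrite coefMX/= -horner_coef0 horner_prod.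
  under [X in _ = X -> _]eq_bigr do rewrite hornerXsubC sub0r.
  move=> <-; have := congr1 (fun s : {poly C} => s`_0) (deriv_edp D).
  by rewrite coef_deriv coefC eqxx mulr1n => ->.
have b0 : 0 \in box D by rewrite mem_box size_poly0.
rewrite ecE ed_prod (abs_mul absC) (absV absC) !(abs_prod absC).
rewrite (bigD1_seq 0) ?box_uniq//= [in RHS](bigD1_seq 0) ?box_uniq//= eqxx.
rewrite /iotaA !rmorph0 subr0 -mulrA; congr (_ * _); rewrite -prodf_div.
by apply: eq_bigr => b /negbTE ->; rewrite (absN absC).
Qed.

Lemma abs_iotaA (a : {poly Fq}) : a != 0 -> abs (iA a) = q%:R ^+ (size a).-1.
Proof. exact: (Cinf_norm hC). Qed.

(** When |x| is minimal on x + A, every factor |x - b| / |b| of the product expansion is at least 1.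
    This makes u(z) small far away from F_q((1/theta)). *)
Lemma expC_ge x : (forall b, abs x <= abs (x - iA b)) -> abs x <= abs (pi^-1 * expC (pi * x)).
Proof.
move=> xmin; apply: (cvg_abs_ge absC (N := 0) _ (ed_cvg hC pF ccc pic absc x)) => D _.
have b0 : 0 \in box D by rewrite mem_box size_poly0.
rewrite abs_ed_ec (bigD1_seq 0) ?box_uniq//= eqxx ler_peMr ?(abs_nonneg absC)//.
elim/big_rec: _ => // b y b0' y1; rewrite (negbTE b0').
have ab : 0 < abs (iA b) by rewrite (abs_gt0 absC) // iotaA_eq0.
rewrite -[1]mulr1; apply: ler_pM => //; rewrite ler_pdivlMr// mul1r.
have [xb|bx] := ltP (abs x) (abs (iA b)).
  by rewrite (abs_distC absC) (absB_isosceles absC).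
exact: le_trans (xmin b).
Qed.

Lemma expC_lattice a : expC (pi * iA a) = 0.
Proof.
have pi0 := pi_neq0 hC pic absc.
have h := ed_cvg hC pF ccc pic absc (iA a).
have /(cvg_abs_unique absC h)/eqP : cvg_abs abs (fun D => ed D (iA a) / ec D 0) 0.
  apply: (@cvg_abs_near _ _ _ absC (fun=> 0) _ _ (size a)); last exact: (cvg_abs_cst absC).
  by move=> D aD; rewrite (ed_box iota pF) ?mul0r// mem_box.
by rewrite mulf_eq0 invr_eq0 (negbTE pi0) => /eqP.
Qed.

(** Factors with |b| > |x| have absolute value 1, so the partial products stay bounded away from
    0. *)
Lemma expC_neq0 x : (forall a, x != iA a) -> expC (pi * x) != 0.
Proof.
move=> xA; have [N hN] := expq_unbounded Fq (abs x).
pose F b := if b == 0 then abs x else abs (x - iA b) / abs (iA b).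
have F0 b : 0 < F b.
  rewrite /F; case: ifPn => b0.
    by apply: (abs_gt0 absC); have := xA 0; rewrite /iotaA !rmorph0.
  by rewrite divr_gt0// (abs_gt0 absC) ?subr_eq0 ?iotaA_eq0.
have F1 b : b \notin box N.+1 -> F b = 1.
  rewrite mem_box -ltnNge => Nb; have b0 : b != 0 by rewrite -size_poly_gt0; apply: leq_trans Nb.
  have xb : abs x < abs (iA b).
    rewrite abs_iotaA//; apply: lt_le_trans hN _; apply: ler_weXn2l.
      by apply: ltW; exact: card_Fq_gt1R.
    by rewrite -ltnS prednK ?size_poly_gt0// ltnW.
  by rewrite /F (negbTE b0) (abs_distC absC) (absB_isosceles absC)// divff// gt_eqF// (abs_gt0 absC)// iotaA_eq0.
have h := ed_cvg hC pF ccc pic absc x.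
suff : 0 < abs (pi^-1 * expC (pi * x)).
  by move=> /(abs_neq0 absC); rewrite mulf_eq0 negb_or => /andP[].
apply: (@lt_le_trans _ _ (\prod_(b <- box N.+1) F b)).
  by apply: prodr_gt0 => b _; exact: F0.
apply: (cvg_abs_ge absC (N := N.+1) _ h) => D ND.
have -> : abs (ed D x / ec D 0) = \prod_(b <- box D) F b by exact: abs_ed_ec.
rewrite [X in _ <= X](bigID (fun b => b \in box N.+1))/= [X in _ <= _ * X]big1 ?mulr1 => [|b /F1//].
rewrite -[X in _ <= X]big_filter (perm_big [seq b <- box D | b \in box N.+1])//.
apply: uniq_perm; rewrite ?filter_uniq ?box_uniq// => b; rewrite mem_filter.
by apply/idP/andP => [bN|[]//]; split=> //; exact: box_mono bN.
Qed.

End Limits.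

(** A (q-1)-st root [pi] of the limit of [cc] also generates the kernel of e_C. Two generators
    differ by a unit of A, a nonzero constant, whose (q-1)-st power is 1. *)
Lemma carlitz_period (pt : C) : is_carlitz_period abs iota pt -> exists c,
  [/\ cvg_abs abs (cc iota) c, pt ^+ q.-1 = c & abs c = q%:R ^+ q].
Proof.
move=> hpt; have [c ccc absc] := cc_cvg hC pF; exists c; split=> //.
have q1 : (0 < q.-1)%N by case: #|Fq| (finRing_gt1 Fq) => [|[]].
have [pi pic] := Cinf_surjX hC c q1.
have pi0 := pi_neq0 hC pic absc.
have /hpt[a pia] : expC pi = 0.
  by have := expC_lattice ccc pic absc 1; rewrite /iotaA !rmorph1 mulr1.
have pt0 : pt != 0 by apply: contraNneq pi0 => pt0; rewrite pia pt0 mulr0.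
have ept : expC pt = 0 by apply/hpt; exists 1; rewrite /iotaA !rmorph1 mul1r.
have [b ptb] : exists b, pt / pi = iA b.
  apply: contrapT => H; have := expC_neq0 ccc pic absc (x := pt / pi).
  rewrite mulrCA divff// mulr1 ept eqxx => H2.
  by have : false by apply: H2 => b; apply/eqP => h; apply: H; exists b.
have ab1 : a * b = 1.
  by apply: iotaA_inj; rewrite iotaAM -ptb mulrA -pia divff// /iotaA !rmorph1.
have bu : b \is a GRing.unit by apply/unitrP; exists a; split=> //; rewrite mulrC.
move: bu; rewrite poly_unitE => /andP[/size_poly1P[z z0 bz] _].
have -> : pt = iA b * pi by rewrite -ptb divfK.
rewrite exprMn pic bz -iotaAX -rmorphXn.
suff -> : z ^+ q.-1 = 1 by rewrite /iotaA !rmorph1 mul1r.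
by apply: (mulIf z0); rewrite -exprSr mul1r prednK ?expf_card// q_gt0.
Qed.

End Rows.

(** * The expansion of [u (a z)] in powers of [u z] *)

Section FpsPoly.
Variable S : comNzRingType.

Lemma fps_mul_poly (f g : nat -> S) (P Q : {poly S}) n :
  (forall i, (i <= n)%N -> f i = P`_i) -> (forall i, (i <= n)%N -> g i = Q`_i) ->
  fps_mul f g n = (P * Q)`_n.
Proof.
move=> fP gQ; rewrite coefM; apply: eq_bigr => i _.
by rewrite fP ?gQ ?leq_subr// -ltnS.
Qed.

Lemma fps_exp_poly (f : nat -> S) (P : {poly S}) m n :
  (forall i, (i <= n)%N -> f i = P`_i) -> forall i, (i <= n)%N -> fps_exp f m i = (P ^+ m)`_i.
Proof.
move=> fP; elim: m => [|m IH] i ni; first by rewrite expr0 coef1.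
rewrite exprSr /=; apply: fps_mul_poly => j ji; [apply: IH|apply: fP]; exact: leq_trans ni.
Qed.

Lemma coef_trunc (f : nat -> S) n i : (i <= n)%N -> f i = (\poly_(j < n.+1) f j)`_i.
Proof. by rewrite coef_poly ltnS => ->. Qed.

(** The n-th coefficient depends only on the truncation of [f] at n, and by Frobenius the p^e-th
    power of a polynomial involves only exponents divisible by p^e. *)
Lemma fps_exp_pow (f : nat -> S) p e m n : p \in [pchar S] ->
  ~~ (p ^ e %| n)%N -> fps_exp f (m * p ^ e) n = 0.
Proof.
move=> pS pn; rewrite (fps_exp_poly _ (@coef_trunc f n) (leqnn n)) exprM.
set P := (\poly_(j < n.+1) f j) ^+ m.
have -> : P ^+ (p ^ e) = \sum_(i < size P) (P`_i ^+ (p ^ e)) *: 'X^(i * p ^ e).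
  have p0 := prime_gt0 (pcharf_prime pS).
  have pP : p \in [pchar {poly S}] by rewrite pchar_poly.
  rewrite -{1}[P]coefK poly_def.
  elim/big_rec2: _ => [|i x y _ <-].
    by rewrite expr0n expn_eq0 (gtn_eqF p0).
  by rewrite exprpnD// exprZn -exprM.
rewrite coef_sum big1// => i _; rewrite coefZ coefXn.
by case: eqP => [nE|_]; rewrite ?mulr0//; move: pn; rewrite nE dvdn_mull.
Qed.

Lemma fps_exp_order (f : nat -> S) d m n :
  (forall i, (i < d)%N -> f i = 0) -> (n < d * m)%N -> fps_exp f m n = 0.
Proof.
move=> fd; elim: m n => [|m IH] n nm; first by rewrite muln0 in nm.
rewrite /= /fps_mul big1// => i _; have [im|mi] := ltnP i (d * m).
  by rewrite IH ?mul0r.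
rewrite fd ?mulr0//; rewrite mulnS in nm; have := ltn_ord i; lia.
Qed.

End FpsPoly.

Section DegreeBound.
Variable Fq : finFieldType.
Local Notation A := {poly Fq}.

(** The coefficient of u^n has degree at most n in theta. The condition is stable under products and
    geometric series, and it gives convergence at every u with q |u| < 1. *)
Definition deg_le_index (f : nat -> A) := forall n, (size (f n) <= n.+1)%N.

Lemma deg_fps_mul f g : deg_le_index f -> deg_le_index g -> deg_le_index (fps_mul f g).
Proof.
move=> hf hg n; apply: leq_trans (size_sum _ _ _) _; apply/bigmax_leqP => i _.
apply: leq_trans (size_polyMleq _ _) _.
have := hf i; have := hg (n - i)%N; have := ltn_ord i; lia.
Qed.

Lemma deg_fps_exp f m : deg_le_index f -> deg_le_index (fps_exp f m).
Proof.
move=> hf; elim: m => [|m IH]; last exact: deg_fps_mul.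
by move=> n; rewrite /=; case: (n == 0%N); rewrite ?size_poly1 ?size_poly0.
Qed.

Lemma deg_fps_geom f : deg_le_index f -> deg_le_index (fps_geom f).
Proof.
move=> hf n; apply: leq_trans (size_sum _ _ _) _; apply/bigmax_leqP => i _.
exact: deg_fps_exp.
Qed.

Lemma deg_polyM (P Q : {poly A}) : deg_le_index (nth 0 P) -> deg_le_index (nth 0 Q) ->
  deg_le_index (nth 0 (P * Q)).
Proof.
move=> hP hQ n; rewrite -(@fps_mul_poly _ (nth 0 P) (nth 0 Q) P Q)//.
exact: deg_fps_mul.
Qed.

Lemma deg_polyX (P : {poly A}) m : deg_le_index (nth 0 P) -> deg_le_index (nth 0 (P ^+ m)).
Proof.
move=> hP n; rewrite -(@fps_exp_poly _ (nth 0 P) P m n (fun _ _ => erefl) n)//.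
exact: deg_fps_exp.
Qed.

Lemma deg_polyD (P Q : {poly A}) : deg_le_index (nth 0 P) -> deg_le_index (nth 0 Q) ->
  deg_le_index (nth 0 (P + Q)).
Proof.
move=> hP hQ n; rewrite coefD; apply: leq_trans (size_polyD _ _) _.
by rewrite geq_max hP hQ.
Qed.

Lemma deg_polyZXn (a : A) m : (size a <= m.+1)%N -> deg_le_index (nth 0 (a *: 'X^m : {poly A})).
Proof.
move=> am n; rewrite coefZ coefXn; case: eqP => [->|_]; first by rewrite mulr1.
by rewrite mulr0 size_poly0.
Qed.

End DegreeBound.

Section UExpansion.
Variables (R : realType) (Fq : finFieldType) (C : fieldType) (abs : C -> R).
Variable (iota : {rmorphism ratfun Fq -> C}).
Hypothesis hC : is_Cinf abs iota.
Let absC := Cinf_abs hC.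
Variable p : nat.
Hypothesis pF : p \in [pchar Fq].
Let pC : p \in [pchar C] := pchar_ext_field iota pF.
Local Notation q := #|Fq|.
Local Notation A := {poly Fq}.
Local Notation iA := (iotaA iota).
Local Notation th := (iA 'X).
Local Notation expC := (carlitz_exp abs iota).

Definition iAm : {rmorphism A -> C} := iota \o @FracField.tofrac A.

Lemma iAmE a : iAm a = iA a. Proof. by []. Qed.

(* The reversed polynomial of the i-th iterate of X |-> theta X + X^q. *)
Fixpoint carlitz_rev (i : nat) : {poly A} :=
  if i is j.+1 then ('X : A) *: 'X^(q ^ i - q ^ j) * carlitz_rev j + carlitz_rev j ^+ q else 1.

(** The polynomial C_a of the Carlitz module, reversed: X^(q^deg a) C_a(1/X). Its constant term is
    the leading coefficient of [a]. *)
Definition carlitz_rev_at (a : A) : {poly A} :=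
  \sum_(i < size a) (a`_i)%:P *: 'X^(q ^ (size a).-1 - q ^ i) * carlitz_rev i.

Lemma qpow_ltS i j : (i < j)%N -> (q ^ i < q ^ j)%N.
Proof. by move=> ij; rewrite ltn_exp2l// finRing_gt1. Qed.

Lemma qpow_le i j : (i <= j)%N -> (q ^ i <= q ^ j)%N.
Proof. by move=> ij; rewrite leq_exp2l// finRing_gt1. Qed.

Lemma carlitz_rev_deg i : deg_le_index (nth 0 (carlitz_rev i)).
Proof.
elim: i => [|i IH].
  by move=> n; rewrite coef1; case: (n == 0%N); rewrite ?size_poly1 ?size_poly0.
apply: deg_polyD; last exact: deg_polyX.
apply: deg_polyM => //; apply: deg_polyZXn; rewrite size_polyX.
by have := qpow_ltS (ltnSn i); lia.
Qed.

Lemma carlitz_rev0 i : (carlitz_rev i)`_0 = 1.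
Proof.
elim: i => [|i IH]; first by rewrite coef1.
rewrite /= coefD -scalerAl coefZ coefXnM.
have -> : (0 < q ^ i.+1 - q ^ i)%N by have := qpow_ltS (ltnSn i); lia.
by rewrite mulr0 add0r -horner_coef0 horner_exp horner_coef0 IH expr1n.
Qed.

Lemma carlitz_rev_at_deg a : deg_le_index (nth 0 (carlitz_rev_at a)).
Proof.
rewrite /carlitz_rev_at; elim/big_ind: _ => [n|P Q hP hQ|i _].
- by rewrite coef0 size_poly0.
- exact: deg_polyD.
apply: deg_polyM; last exact: carlitz_rev_deg.
by apply: deg_polyZXn; apply: leq_trans (size_polyC_leq1 _) _.
Qed.

Lemma carlitz_rev_at0 a : a != 0 -> (carlitz_rev_at a)`_0 = (lead_coef a)%:P.
Proof.
move=> a0; rewrite /carlitz_rev_at coef_sum.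
rewrite -(prednK (n := size a)) ?size_poly_gt0// big_ord_recr/= big1 ?add0r => [|i _].
  by rewrite subnn expr0 -scalerAl mul1r coefZ carlitz_rev0 mulr1.
rewrite -scalerAl coefZ coefXnM/=.
have -> : (0 < q ^ (size a).-1 - q ^ i)%N by rewrite subn_gt0; exact: qpow_ltS (ltn_ord i).
by rewrite mulr0.
Qed.

(* The expansion of u(a z) in powers of u(z). *)
Definition u_at (a : A) (n : nat) : A :=
  let c := (lead_coef a)^-1%:P in
  if (q ^ (size a).-1 <= n)%N then
    c * fps_geom (fun j => (j == 0%N)%:R - c * (carlitz_rev_at a)`_j) (n - q ^ (size a).-1)
  else 0.

Lemma u_at_order (a : A) n : (n < q ^ (size a).-1)%N -> u_at a n = 0.
Proof. by rewrite /u_at; case: leqP. Qed.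

Lemma u_at_deg a : deg_le_index (u_at a).
Proof.
move=> n; rewrite /u_at; case: ifP => _; last by rewrite size_poly0.
rewrite mul_polyC; apply: leq_trans (size_scale_leq _ _) _.
apply: leq_trans (_ : (n - q ^ (size a).-1).+1 <= _)%N; last by rewrite ltnS leq_subr.
apply: deg_fps_geom => j; apply: leq_trans (size_polyD _ _) _; rewrite geq_max size_polyN.
apply/andP; split; first by case: (j == 0%N); rewrite ?size_poly1 ?size_poly0.
by rewrite mul_polyC; apply: leq_trans (size_scale_leq _ _) _; exact: carlitz_rev_at_deg.
Qed.

Lemma abs_iA_size (a : A) n : (size a <= n.+1)%N -> abs (iA a) <= q%:R ^+ n.
Proof.
move=> an; have [->|a0] := eqVneq a 0.
  by rewrite /iotaA !rmorph0 (abs0 absC) exprn_ge0// ltW// (card_Fq_gt0R R Fq).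
rewrite (Cinf_norm hC)//; apply: ler_weXn2l; first by apply: ltW; exact: card_Fq_gt1R.
by rewrite -ltnS prednK ?size_poly_gt0.
Qed.

Section AtU.
Variable u : C.
Hypothesis u_small : q%:R * abs u < 1.
Let s := q%:R * abs u.

Lemma s_ge0 : 0 <= s.
Proof. by rewrite mulr_ge0 ?(abs_nonneg absC)// ltW// (card_Fq_gt0R R Fq). Qed.

Lemma abs_term_le f n : deg_le_index f -> abs (iA (f n) * u ^+ n) <= s ^+ n.
Proof.
move=> hf; rewrite (abs_mul absC) (absX absC) exprMn ler_wpM2r ?exprn_ge0 ?(abs_nonneg absC)//.
exact: abs_iA_size.
Qed.

Lemma geometric_small (e : R) : 0 < e -> exists N, forall n, (N <= n)%N -> s ^+ n < e.
Proof.
move=> e0; have /cvgrPdist_lt/(_ e e0)[N _ hN] : ((fun m => s ^+ m) @ \oo --> (0 : R))%classic.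
  by apply: cvg_expr; rewrite ger0_norm ?s_ge0.
by exists N => m Nm; have := hN m Nm; rewrite sub0r normrN ger0_norm ?exprn_ge0 ?s_ge0.
Qed.

Lemma deg_vanish f : deg_le_index f -> vanish abs (fun n => iA (f n) * u ^+ n).
Proof.
move=> hf e e0; have [N hN] := geometric_small e0; exists N => n Nn.
by apply: le_lt_trans (abs_term_le n hf) _; exact: hN.
Qed.

Definition fps_at (f : nat -> A) (x : C) := csum abs (fun n => iA (f n) * u ^+ n) x.

Lemma fps_at_ex f : deg_le_index f -> exists x, fps_at f x.
Proof. by move=> /deg_vanish/(vanish_csum absC (Cinf_complete hC)). Qed.

Lemma fps_at_mul f g x y : fps_at f x -> fps_at g y -> fps_at (fps_mul f g) (x * y).
Proof.
move=> hf hg; apply: (eq_csum absC _ (csumM absC hf hg)) => n.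
rewrite /fps_mul -!iAmE rmorph_sum mulr_suml; apply: eq_bigr => i _.
have -> : u ^+ n = u ^+ i * u ^+ (n - i) by rewrite -exprD subnKC// -ltnS.
by rewrite rmorphM !iAmE; ring.
Qed.

Lemma fps_at_one : fps_at (fun n => (n == 0%N)%:R) 1.
Proof.
have := @csum_fin _ _ _ absC (fun n => iA (n == 0%N)%:R * u ^+ n) 1.
rewrite big_ord1 eqxx expr0 mulr1 /iotaA !rmorph1; apply=> -[]// n _.
by rewrite /= !rmorph0 mul0r.
Qed.

Lemma fps_at_exp f x m : fps_at f x -> fps_at (fps_exp f m) (x ^+ m).
Proof.
move=> hf; elim: m => [|m IH]; first exact: fps_at_one.
by rewrite exprSr; exact: fps_at_mul.
Qed.

Lemma fps_at_poly (P : {poly A}) : fps_at (nth 0 P) (map_poly iAm P).[u].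
Proof.
rewrite (@horner_coef_wide _ (size P)); last exact: size_poly.
rewrite (eq_bigr (fun i : 'I_(size P) => iA P`_i * u ^+ i)) => [|i _]; last by rewrite coef_map.
apply: (csum_fin absC (t := fun n => iA P`_n * u ^+ n)) => n Pn.
by rewrite nth_default// /iotaA !rmorph0 mul0r.
Qed.

Lemma fps_at_geom f x : deg_le_index f -> f 0%N = 0 -> fps_at f x ->
  1 - x != 0 /\ fps_at (fps_geom f) (1 - x)^-1.
Proof.
move=> hf f0 fx; have [y hy] := fps_at_ex (deg_fps_geom hf).
have h1 : fps_at (fun n => (n == 0%N)%:R - f n) (1 - x).
  rewrite -mulN1r.
  apply: (eq_csum absC _ (csumD absC fps_at_one (csumZ absC (-1) fx))) => n.
  by rewrite iotaAB; ring.
have h2 := fps_at_mul hy h1.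
have h3 : fps_at (fun n => (n == 0%N)%:R) (y * (1 - x)).
  by apply: (eq_csum absC _ h2) => n; rewrite fps_geomP.
have yx : y * (1 - x) = 1 by exact: (csum_unique absC h3 fps_at_one).
have x0 : 1 - x != 0 by apply: contra_eq_neq yx => ->; rewrite mulr0 eq_sym oner_neq0.
by split=> //; have -> : (1 - x)^-1 = y by apply: (mulIf x0); rewrite yx mulVf.
Qed.

Variable z : C.
Hypotheses (u0 : u != 0).
Variable pt : C.
Hypothesis uz : u = u_param abs iota pt z.

Lemma expC_u : expC (pt * z) = u^-1.
Proof. by rewrite uz /u_param invrK. Qed.

Lemma expC_thetaX i : expC (th ^+ i * (pt * z)) = (map_poly iAm (carlitz_rev i)).[u] / u ^+ (q ^ i).
Proof.
elim: i => [|i IH].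
  by rewrite expr0 mul1r expC_u rmorph1 hornerC expn0 expr1 mul1r.
rewrite exprS -mulrA (carlitz_exp_theta hC pF) IH.
set V := (map_poly iAm (carlitz_rev i)).[u].
have -> : (map_poly iAm (carlitz_rev i.+1)).[u] = th * u ^+ (q ^ i.+1 - q ^ i) * V + V ^+ q.
  rewrite [carlitz_rev i.+1]/= rmorphD rmorphM rmorphXn /= map_polyZ map_polyXn.
  by rewrite hornerD hornerM hornerZ hornerXn horner_exp.
rewrite expr_div_n -exprM -expnSr mulrDl; congr (_ + _).
have h : u ^+ (q ^ i) != 0 by rewrite expf_neq0.
have -> : u ^+ (q ^ i.+1) = u ^+ (q ^ i.+1 - q ^ i) * u ^+ (q ^ i).
  by rewrite -exprD subnK// qpow_le.
by field; rewrite h expf_neq0.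
Qed.

Lemma expC_at a : a != 0 ->
  expC (pt * (iA a * z)) = (map_poly iAm (carlitz_rev_at a)).[u] / u ^+ (q ^ (size a).-1).
Proof.
move=> a0.
have aE : iA a = \sum_(i < size a) iA (a`_i)%:P * th ^+ i.
  rewrite -[a in LHS]coefK poly_def -iAmE rmorph_sum; apply: eq_bigr => i _.
  by rewrite -mul_polyC rmorphM rmorphXn.
have -> : pt * (iA a * z) = \sum_(i < size a) iA (a`_i)%:P * (th ^+ i * (pt * z)).
  by rewrite aE mulr_suml mulr_sumr; apply: eq_bigr => i _; ring.
have -> : expC (\sum_(i < size a) iA (a`_i)%:P * (th ^+ i * (pt * z))) =
    \sum_(i < size a) iA (a`_i)%:P * expC (th ^+ i * (pt * z)).
  elim/big_rec2: _ => [|i x y _ <-]; last by rewrite (carlitz_expD hC pF) (carlitz_exp_const hC pF).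
  by have := carlitz_expB hC pF 0 0; rewrite !subrr.
rewrite /carlitz_rev_at rmorph_sum horner_sum mulr_suml; apply: eq_bigr => i _.
rewrite expC_thetaX rmorphM /= map_polyZ map_polyXn hornerM hornerZ hornerXn.
set V := (map_poly iAm (carlitz_rev i)).[u].
have -> : u ^+ (q ^ (size a).-1) = u ^+ (q ^ (size a).-1 - q ^ i) * u ^+ (q ^ i).
  by rewrite -exprD subnK// qpow_le//; have := ltn_ord i; lia.
by rewrite !iAmE; field; rewrite !expf_neq0.
Qed.

(** By [expC_at], u(a z) is u^(q^deg a) divided by the reversed polynomial at u. The factor [c]
    normalises the constant term of that polynomial to 1, so that it can be inverted by a geometric
    series. *)
Lemma u_at_csum a : a != 0 -> fps_at (u_at a) (u_param abs iota pt (iA a * z)).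
Proof.
move=> a0; set c := (lead_coef a)^-1%:P.
pose f j : A := (j == 0%N)%:R - c * (carlitz_rev_at a)`_j.
have la0 : lead_coef a != 0 by rewrite lead_coef_eq0.
have f0 : f 0%N = 0 by rewrite /f eqxx carlitz_rev_at0// -polyCM mulVf// subrr.
have fdeg : deg_le_index f.
  move=> j; apply: leq_trans (size_polyD _ _) _; rewrite geq_max size_polyN.
  apply/andP; split; first by case: (j == 0%N); rewrite ?size_poly1 ?size_poly0.
  by rewrite mul_polyC; apply: leq_trans (size_scale_leq _ _) _; exact: carlitz_rev_at_deg.
have fx : fps_at f (1 - iA c * (map_poly iAm (carlitz_rev_at a)).[u]).
  rewrite -mulNr.
  apply: (eq_csum absC _ (csumD absC fps_at_one (csumZ absC (- iA c) (fps_at_poly (carlitz_rev_at a))))) => n.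
  by rewrite /f iotaAB iotaAM; ring.
have [] := fps_at_geom fdeg f0 fx; rewrite opprB addrCA subrr addr0 => h0 hg.
have := csum_shift absC (q ^ (size a).-1) (csumZ absC (iA c * u ^+ (q ^ (size a).-1)) hg).
have -> : iA c * u ^+ (q ^ (size a).-1) * (iA c * (map_poly iAm (carlitz_rev_at a)).[u])^-1 =
    u_param abs iota pt (iA a * z).
  rewrite /u_param expC_at//; move: h0; rewrite mulf_eq0 negb_or => /andP[c0 v0].
  move: c0 v0 (expf_neq0 (q ^ (size a).-1) u0).
  move: (iA c) ((map_poly iAm (carlitz_rev_at a)).[u]) (u ^+ _) => x y w x0 y0 w0.
  by field; rewrite x0 y0 w0.
apply: (eq_csum absC) => n; rewrite /u_at -/c -/f; case: leqP => [h|_]; last by rewrite /iotaA !rmorph0 mul0r.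
have -> : u ^+ n = u ^+ (n - q ^ (size a).-1) * u ^+ (q ^ (size a).-1) by rewrite -exprD subnK.
by rewrite iotaAM; ring.
Qed.

End AtU.
End UExpansion.

(** * Eisenstein series *)

Section Eisenstein.
Variables (R : realType) (Fq : finFieldType) (C : fieldType) (abs : C -> R).
Variable (iota : {rmorphism ratfun Fq -> C}).
Hypothesis hC : is_Cinf abs iota.
Let absC := Cinf_abs hC.
Variable p : nat.
Hypothesis pF : p \in [pchar Fq].
Let pC : p \in [pchar C] := pchar_ext_field iota pF.
Local Notation q := #|Fq|.
Local Notation A := {poly Fq}.
Local Notation iA := (iotaA iota).
Local Notation expC := (carlitz_exp abs iota).
Local Notation aff := (Omega_aff abs iota).
Local Notation Om := (Omega abs iota).
Local Notation ll i := (iota (carlitz_log Fq i)).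

Lemma iotaA0 : iA 0 = 0. Proof. by rewrite /iotaA !rmorph0. Qed.
Lemma iotaA1 : iA 1 = 1. Proof. by rewrite /iotaA !rmorph1. Qed.

Definition box2 D : seq (A * A) := [seq (a, b) | a <- box Fq D, b <- box Fq D].

Lemma mem_box2 D a b : ((a, b) \in box2 D) = (a \in box Fq D) && (b \in box Fq D).
Proof.
apply/allpairsP/andP => [[[a' b'] /= [? ? [-> ->]]]//|[aD bD]].
by exists (a, b).
Qed.

Lemma box2_uniq D : uniq (box2 D).
Proof. by apply: allpairs_uniq; rewrite ?box_uniq// => -[a b] [a' b'] _ _ [-> ->]. Qed.

Lemma box2_mono D D' : (D <= D')%N -> {subset box2 D <= box2 D'}.
Proof.
move=> DD [a b]; rewrite !mem_box2 => /andP[aD bD].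
by rewrite (box_mono DD aD) (box_mono DD bD).
Qed.

Lemma abs_iotaA_ge D (a : A) : a \notin box Fq D -> q%:R ^+ D <= abs (iA a).
Proof.
rewrite mem_box -ltnNge => Da; have a0 : a != 0 by rewrite -size_poly_gt0; apply: leq_trans Da.
rewrite (Cinf_norm hC)//; apply: ler_weXn2l; first by apply: ltW; exact: card_Fq_gt1R.
by rewrite -ltnS prednK ?size_poly_gt0.
Qed.

(** On the affinoid |a| <= |a z - b| q^n. If |b| <= |a z|, then |b| <= |a| q^n, at the cost of
    another q^n; if |b| > |a z|, then |a z - b| = |b|. The loss is uniform in z. *)
Lemma lattice_lower_bound n z D (a b : A) : aff n z -> (a, b) \notin box2 D ->
  q%:R ^+ D <= abs (iA a * z - iA b) * q%:R ^+ (n + n).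
Proof.
move=> [zn zK]; rewrite mem_box2 negb_and => abD.
have q1 := ltW (card_Fq_gt1R R Fq); have q0 := card_Fq_gt0R R Fq.
have qn1 k : 1 <= q%:R ^+ k :> R by exact: exprn_ege1.
have qn0 k : 0 < q%:R ^+ k :> R by exact: exprn_gt0.
have [a0|a0] := eqVneq a 0.
  move: abD; rewrite a0 mem_box size_poly0 /= => /abs_iotaA_ge bD.
  rewrite iotaA0 mul0r sub0r (absN absC); apply: le_trans bD _.
  by rewrite ler_peMr ?(abs_nonneg absC).
have ia0 : iA a != 0 by rewrite iotaA_eq0.
have low : abs (iA a) <= abs (iA a * z - iA b) * q%:R ^+ n.
  have -> : iA a * z - iA b = iA a * (z - iA b / iA a) by field.
  rewrite (abs_mul absC) -mulrA ler_peMr ?(abs_nonneg absC)//.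
  have := zK (iA b / iA a) (Kinf_div hC (Kinf_iota hC _) (Kinf_iota hC _)).
  by rewrite -[q%:R ^- n]mul1r ler_pdivrMr.
case/orP: abD => [/abs_iotaA_ge aD|/abs_iotaA_ge bD].
  apply: le_trans (le_trans aD low) _; rewrite ler_wpM2l ?(abs_nonneg absC)//.
  by apply: ler_weXn2l => //; exact: leq_addr.
have [ba|ab] := leP (abs (iA b)) (abs (iA a * z)).
  apply: le_trans bD _; apply: le_trans ba _; rewrite (abs_mul absC) exprD mulrA.
  by apply: ler_pM; rewrite ?(abs_nonneg absC).
rewrite (abs_distC absC) (absB_isosceles absC)//; apply: le_trans bD _.
by rewrite ler_peMr ?(abs_nonneg absC).
Qed.

(** For w > 0 the pair (0, 0) contributes 0, as the inverse of 0 is 0, so the sums may run over all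
    of A x A. *)
Definition eis_term w z (ab : A * A) : C := ((iA ab.1 * z - iA ab.2) ^+ w)^-1.

Lemma eis_term_small n w (e : R) : (0 < w)%N -> 0 < e ->
  exists D, forall z ab, aff n z -> ab \notin box2 D -> abs (eis_term w z ab) <= e.
Proof.
move=> w0 e0; have q0 := card_Fq_gt0R R Fq.
pose d := Num.min e 1; have d0 : 0 < d by rewrite lt_min e0 ltr01.
have [D hD] := expq_unbounded Fq (q%:R ^+ (n + n) / d); exists D => z [a b] zn abD.
have h := lattice_lower_bound zn abD.
set y := iA a * z - iA b in h *.
have qn0 : 0 < q%:R ^+ (n + n) :> R by rewrite exprn_gt0.
have y0 : d^-1 <= abs y.
  rewrite -(ler_pM2r qn0); apply: le_trans _ h; rewrite mulrC; exact: ltW.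
have dd : 0 < d^-1 by rewrite invr_gt0.
have yd : (abs y)^-1 <= d by rewrite -[d]invrK lef_pV2// posrE// (lt_le_trans dd).
rewrite /eis_term (absV absC) (absX absC) -/y -exprVn.
have iy0 : 0 <= (abs y)^-1 by rewrite invr_ge0 (abs_nonneg absC).
apply: (@le_trans _ _ (abs y)^-1); last by apply: le_trans yd _; rewrite ge_min lexx.
rewrite -(prednK w0) exprS ler_piMr// exprn_ile1//.
by apply: le_trans yd _; rewrite ge_min lexx orbT.
Qed.

Definition eisenstein w z : C := xget 0 [set s | usum abs (eis_term w z) s]%classic.

Lemma eisensteinE w z : (0 < w)%N -> Om z -> usum abs (eis_term w z) (eisenstein w z).
Proof.
move=> w0 /(Omega_exhausted hC)[n zn].
have [|s hs] := box_usum absC (Cinf_complete hC) (t := eis_term w z) box2_uniq box2_mono.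
  by move=> e e0; have [D hD] := eis_term_small n w0 e0; exists D => ab; exact: hD.
rewrite /eisenstein; case: xgetP => [x _ //|/(_ s)]; by [].
Qed.

Lemma lattice_neq0 z (a b : A) : Om z -> (a != 0) || (b != 0) -> iA a * z - iA b != 0.
Proof.
move=> zO; have [->|a0 _] := eqVneq a 0.
  by rewrite /= iotaA0 mul0r sub0r oppr_eq0 iotaA_eq0.
rewrite subr_eq0; apply/eqP => h; apply: zO.
have ia0 : iA a != 0 by rewrite iotaA_eq0.
have -> : z = iA b / iA a by apply: (canRL (mulfK ia0)); rewrite mulrC.
by apply: (Kinf_div hC); exact: Kinf_iota.
Qed.

Lemma eisenstein_rigid w : (0 < w)%N -> rigid_analytic abs iota (eisenstein w).
Proof.
move=> w0; apply: rational_rigid => n e e0; have [D hD] := eis_term_small n w0 e0.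
exists (fun z => \sum_(ab <- box2 D) eis_term w z ab).
  apply: rational_on_sum => -[a b] _.
  have [/andP[/eqP a0 /eqP b0]|ab0] := boolP ((a == 0) && (b == 0)).
    apply: eq_rational_on (rational_on_cst abs iota n 0) => z _.
    by rewrite /eis_term a0 b0 /= iotaA0 mul0r subrr expr0n (gtn_eqF w0) invr0.
  apply: (@eq_rational_on _ _ _ _ _ _ (fun z => ((iA a *: 'X - (iA b)%:P) ^+ w).[z]^-1)).
    by move=> z _; rewrite horner_exp hornerD hornerN hornerZ hornerX hornerC.
  apply: rational_onV => z zn; rewrite horner_exp hornerD hornerN hornerZ hornerX hornerC.
  rewrite expf_neq0//; apply: lattice_neq0; first exact: (Omega_aff_Omega hC zn).
  by rewrite -negb_and.
move=> z zn; rewrite (abs_distC absC).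
apply: (usum_approx absC e0 (eisensteinE w0 (Omega_aff_Omega hC zn)) (box2_uniq D)).
by move=> ab; exact: hD.
Qed.

(** The matrix g permutes the pairs (a, b), with inverse [h'] because its determinant is a unit, and
    an unconditional sum may be reindexed along this bijection. Only the factor (c z + d)^w remains,
    so the type is 0. *)
Lemma eisenstein_transform w : (0 < w)%N ->
  modular_transform abs iota w%:Z (0 : Zmod q.-1) (eisenstein w).
Proof.
move=> w0 g z gu zO.
have j0 := moebius_denom_neq0 hC gu zO; have wO := moebius_Omega hC gu zO.
rewrite /= expr0 invr1 mul1r -exprnP.
set al := iA (g 0 0) in wO *; set be := iA (g 0 1) in wO *.
set ga := iA (g 1 0) in j0 wO *; set de := iA (g 1 1) in j0 wO *.
pose D := \det g; have DE : D = g 0 0 * g 1 1 - g 0 1 * g 1 0 by exact: det_mx2.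
have Du : D * D^-1 = 1 by rewrite mulrV//; move: gu; rewrite unitmxE.
pose h (ab : A * A) := (ab.1 * g 0 0 - ab.2 * g 1 0, ab.2 * g 1 1 - ab.1 * g 0 1).
pose h' (xy : A * A) := ((xy.1 * g 1 1 + xy.2 * g 1 0) * D^-1, (xy.1 * g 0 1 + xy.2 * g 0 0) * D^-1).
have hK : cancel h h'.
  move=> [a b]; rewrite /h /h' /=.
  have -> : (a * g 0 0 - b * g 1 0) * g 1 1 + (b * g 1 1 - a * g 0 1) * g 1 0 = a * D.
    by rewrite DE; ring.
  have -> : (a * g 0 0 - b * g 1 0) * g 0 1 + (b * g 1 1 - a * g 0 1) * g 0 0 = b * D.
    by rewrite DE; ring.
  by rewrite -!mulrA Du !mulr1.
have h'K : cancel h' h.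
  move=> [x y]; rewrite /h /h' /=; set d := D^-1 in Du *.
  have -> : (x * g 1 1 + y * g 1 0) * d * g 0 0 - (x * g 0 1 + y * g 0 0) * d * g 1 0 = x * (D * d).
    by rewrite DE; ring.
  have -> : (x * g 0 1 + y * g 0 0) * d * g 1 1 - (x * g 1 1 + y * g 1 0) * d * g 0 1 = y * (D * d).
    by rewrite DE; ring.
  by rewrite Du !mulr1.
have := usumZ absC ((ga * z + de) ^+ w) (usum_reindex hK h'K (eisensteinE w0 zO)).
apply: (usum_unique absC); apply: eq_usum (eisensteinE w0 wO) => -[a b].
rewrite /eis_term /h /= !iotaAB !iotaAM -/al -/be -/ga -/de.
have -> : iA a * ((al * z + be) / (ga * z + de)) - iA b =
    ((iA a * al - iA b * ga) * z - (iA b * de - iA a * be)) / (ga * z + de) by field.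
by rewrite expr_div_n invfM invrK mulrC.
Qed.

Variable pt : C.
Hypothesis hpt : is_carlitz_period abs iota pt.

Lemma period_neq0 : pt != 0.
Proof. by have [c [ccc ptc absc]] := carlitz_period hC pF hpt; exact: (pi_neq0 hC ptc absc). Qed.

Lemma expC_lattice_neq0 z a : Om z -> a != 0 -> expC (pt * (iA a * z)) != 0.
Proof.
move=> zO a0; apply/eqP => /hpt[b hb].
have := @lattice_neq0 z a b zO; rewrite a0 => /(_ isT); rewrite subr_eq0 => /eqP; apply.
by apply: (mulfI period_neq0); rewrite hb mulrC.
Qed.

(** Value of the sum over b for fixed [a]. The row a = 0 does not involve z and supplies the
    constant term used for normalisation. *)
Definition eis_row k z a : C :=
  pt ^+ (q ^ k).-1 * (if a == 0 then - ll k else eis_goss iota k (u_param abs iota pt (iA a * z))).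

Lemma eis_row_usum k z a : (0 < k)%N -> Om z ->
  usum abs (fun b => eis_term (q ^ k).-1 z (a, b)) (eis_row k z a).
Proof.
move=> k0 zO; have [c [ccc ptc absc]] := carlitz_period hC pF hpt.
have [n zn] := Omega_exhausted hC zO.
have w0 : (0 < (q ^ k).-1)%N.
  by have := @ltn_exp2l q 0 k (card_Fq_gt1 Fq); rewrite k0 expn0; case: (q ^ k)%N => [|[|]].
apply: (cvg_usum absC (box := box Fq)).
- exact: box_uniq.
- exact: box_mono.
- move=> e e0; have [D hD] := eis_term_small n w0 e0; exists D => b bD.
  by apply: hD => //; rewrite mem_box2 negb_and bD orbT.
rewrite /eis_row; case: eqP => [->|/eqP a0].
  apply: (eq_cvg_abs absC _ (row0_cvg hC pF ccc ptc k0)) => D.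
  by apply: eq_bigr => b _; rewrite /eis_term /= iotaA0 mul0r.
have xA b : iA a * z != iA b.
  by rewrite -subr_eq0; apply: lattice_neq0 => //; rewrite a0.
exact: (row_cvg hC pF ccc ptc absc xA (expC_lattice_neq0 zO a0) k0).
Qed.

(** Translating z by the nearest element of A leaves e_C(pt z) unchanged and makes [expC_ge]
    applicable, whence |e_C(pt z)| >= |pt| B > q for the chosen [B]. *)
Lemma u_param_small : exists2 B, 0 < B & forall z, (forall x, Kinf abs iota x -> B <= abs (z - x)) ->
  [/\ Om z, q%:R * abs (u_param abs iota pt z) < 1 & u_param abs iota pt z != 0].
Proof.
have [c [ccc ptc absc]] := carlitz_period hC pF hpt.
have ap := abs_gt0 absC period_neq0.
have q0 := card_Fq_gt0R R Fq.
pose B := q%:R / abs pt + 1; have B0 : 0 < B by rewrite ltr_wpDl// divr_ge0// ltW.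
exists B => // z zB.
have zO : Om z by move=> /zB; rewrite subrr (abs0 absC) leNgt B0.
have e0 : expC (pt * z) != 0.
  by have := expC_lattice_neq0 zO (oner_neq0 _); rewrite iotaA1 mul1r.
split=> //; last by rewrite /u_param invr_eq0.
(* A nearest element exists because those outside a large box are farther from z than 0 is. *)
have [b0 hb0] : exists b0, forall b, abs (z - iA b0) <= abs (z - iA b).
  have [N hN] := expq_unbounded Fq (abs z).
  have [b0 _ hmin] : exists2 b0, b0 \in box Fq N.+1 & {in box Fq N.+1, forall b, abs (z - iA b0) <= abs (z - iA b)}.
    have : box Fq N.+1 != [::] by rewrite -size_eq0 size_box -lt0n qn_gt0N.
    elim: (box Fq N.+1) => // b s IH _; have [->|s0] := eqVneq s [::].
      by exists b; rewrite ?mem_head// => b'; rewrite inE => /eqP ->.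
    have [b1 b1s h1] := IH s0; have [bb|bb] := leP (abs (z - iA b)) (abs (z - iA b1)).
      exists b; rewrite ?mem_head// => b'; rewrite inE => /orP[/eqP -> //|/h1].
      exact: le_trans.
    exists b1; first by rewrite inE b1s orbT.
    by move=> b'; rewrite inE => /orP[/eqP ->|/h1//]; exact: ltW.
  exists b0 => b; have [bN|bN] := boolP (b \in box Fq N.+1); first exact: hmin.
  apply: (@le_trans _ _ (abs (z - iA 0))); first by apply: hmin; rewrite mem_box size_poly0.
  rewrite iotaA0 subr0 (abs_distC absC) (absB_isosceles absC).
    apply: ltW; apply: lt_le_trans hN _; apply: le_trans (abs_iotaA_ge bN).
    by apply: ler_weXn2l; rewrite ?leqnSn// ltW// (card_Fq_gt1R R Fq).
  apply: lt_le_trans hN _; apply: le_trans (abs_iotaA_ge bN).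
  by apply: ler_weXn2l; rewrite ?leqnSn// ltW// (card_Fq_gt1R R Fq).
have := @expC_ge _ _ _ _ _ hC _ pF pt c ccc ptc absc (z - iA b0).
have -> : expC (pt * (z - iA b0)) = expC (pt * z).
  by rewrite mulrBr (carlitz_expB hC pF) (expC_lattice hC pF ccc ptc absc) subr0.
move=> /(_ _) h.
have {}h : B <= abs (pt^-1 * expC (pt * z)).
  apply: le_trans (h _); first by apply: zB; exact: Kinf_iota.
  by move=> b; rewrite -addrA -opprD -iotaAD.
rewrite /u_param (absV absC) ltr_pdivrMr ?(abs_gt0 absC)// mul1r.
move: h; rewrite (abs_mul absC) (absV absC) mulrC ler_pdivlMr// => h.
by apply: lt_le_trans h; rewrite /B mulrDl divfK ?gt_eqF// mul1r ltrDl.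
Qed.

(* The quotient of the i-th and k-th coefficients of the Carlitz logarithm, which lies in A. *)
Definition log_quot i k : A := \prod_(i <= j < k) (- bracket Fq j.+1).

Lemma log_quotE i k : (i <= k)%N -> ll i = iA (log_quot i k) * ll k.
Proof.
move=> /subnKC <-; elim: (k - i)%N => [|j IH].
  by rewrite addn0 /log_quot big_geq// iotaA1 mul1r.
rewrite IH addnS /log_quot big_nat_recr ?leq_addr//= iotaAM -mulrA; congr (_ * _).
have -> x : iA (- x) = - iA x by rewrite -[- x]sub0r iotaAB iotaA0 sub0r.
by rewrite -[LHS]opprK -(logS hC) mulNr mulrC.
Qed.

Lemma log_neq0 k : ll k != 0.
Proof.
elim: k => [|k IH]; first by rewrite rmorph1 oner_neq0.
have := logS hC k => /eqP; apply: contraTneq => ->.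
by rewrite mul0r eq_sym oppr_eq0.
Qed.

(** Summing over a finite box loses nothing: the expansion of u(a z) starts at u^(q^deg a), so
    polynomials [a] outside the box do not reach u^n. *)
Definition eis_part k i n : A := \sum_(a <- box Fq n | a != 0) fps_exp (u_at a) (q ^ k - q ^ i) n.

Definition eis_coef k n : A := (n == 0%N)%:R - \sum_(i < k) log_quot i k * eis_part k i n.

Definition eis_summand k (a : A) n : A := \sum_(i < k) log_quot i k * fps_exp (u_at a) (q ^ k - q ^ i) n.

Lemma eis_summand_order k (a : A) n : a != 0 -> (n < size a)%N -> eis_summand k a n = 0.
Proof.
move=> a0 na; rewrite /eis_summand big1// => i _.
rewrite (@fps_exp_order _ _ (q ^ (size a).-1)) ?mulr0//.
  exact: u_at_order.
apply: leq_trans na _; rewrite -(prednK (n := size a)) ?size_poly_gt0//.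
have h1 : ((size a).-1 < q ^ (size a).-1)%N by apply: ltn_expl; exact: finRing_gt1.
apply: leq_trans h1 _; apply: leq_pmulr; rewrite subn_gt0; exact: qpow_ltS.
Qed.

Lemma eis_coefE k n D : (n <= D)%N ->
  eis_coef k n = (n == 0%N)%:R - \sum_(a <- box Fq D | a != 0) eis_summand k a n.
Proof.
move=> nD; rewrite /eis_coef; congr (_ - _).
transitivity (\sum_(a <- box Fq n | a != 0) eis_summand k a n).
  by rewrite exchange_big/=; apply: eq_bigr => i _; rewrite mulr_sumr.
rewrite [RHS](bigID (fun a => a \in box Fq n))/= [X in _ = _ + X]big1 ?addr0; last first.
  by move=> a /andP[a0]; rewrite mem_box -ltnNge; exact: eis_summand_order.
rewrite -big_filter -[RHS]big_filter; apply: perm_big.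
apply: uniq_perm; rewrite ?filter_uniq ?box_uniq// => a; rewrite !mem_filter.
apply/idP/idP => [/andP[-> an]|/andP[/andP[-> ->]]//].
by rewrite an (box_mono nD an).
Qed.

Definition eis_form k z : C := (pt ^+ (q ^ k).-1 * - ll k)^-1 * eisenstein (q ^ k).-1 z.

Lemma eis_const_neq0 k : pt ^+ (q ^ k).-1 * - ll k != 0.
Proof. by rewrite mulf_neq0 ?expf_neq0 ?period_neq0// oppr_eq0 log_neq0. Qed.

Lemma eis_form_usum k z : (0 < k)%N -> Om z ->
  usum abs (fun a => if a == 0 then 1 else - (eis_goss iota k (u_param abs iota pt (iA a * z)) / ll k))
    (eis_form k z).
Proof.
move=> k0 zO; have c0 := eis_const_neq0 k.
have w0 : (0 < (q ^ k).-1)%N.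
  by have := @ltn_exp2l q 0 k (card_Fq_gt1 Fq); rewrite k0 expn0; case: (q ^ k)%N => [|[|]].
have h := usum_rows absC (eisensteinE w0 zO) (fun a => eis_row_usum a k0 zO).
apply: eq_usum (usumZ absC (pt ^+ (q ^ k).-1 * - ll k)^-1 h) => a.
rewrite /eis_row; case: eqP => [_|_]; first by rewrite mulVf.
have l0 := log_neq0 k; have p0 : pt ^+ (q ^ k).-1 != 0 by rewrite expf_neq0 ?period_neq0.
by field; rewrite oppr_eq0 l0 p0.
Qed.

Lemma eis_goss_csum k z a : Om z -> q%:R * abs (u_param abs iota pt z) < 1 ->
  u_param abs iota pt z != 0 -> a != 0 ->
  fps_at abs iota (u_param abs iota pt z) (eis_summand k a)
    (eis_goss iota k (u_param abs iota pt (iA a * z)) / ll k).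
Proof.
move=> zO us u0 a0; have ua := u_at_csum hC pF us u0 erefl a0.
rewrite /eis_goss mulr_suml.
pose t (i : 'I_k) n := iA (log_quot i k) *
  (iA (fps_exp (u_at a) (q ^ k - q ^ i) n) * u_param abs iota pt z ^+ n).
have H : csum abs (fun n => \sum_(i < k) t i n)
    (\sum_(i < k) ll i * u_param abs iota pt (iA a * z) ^+ (q ^ k - q ^ i) / ll k).
  apply: (@csum_bigsum _ _ _ absC _ _ xpredT t) => i _.
  have := csumZ absC (iA (log_quot i k)) (fps_at_exp hC (q ^ k - q ^ i) ua).
  rewrite (log_quotE (ltnW (ltn_ord i))).
  by rewrite [_ * ll k * _]mulrAC mulfK// log_neq0.
apply: (eq_csum absC _ H) => n.
rewrite /eis_summand -iAmE rmorph_sum mulr_suml; apply: eq_bigr => i _.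
by rewrite /t rmorphM !iAmE mulrA.
Qed.

(** The terms of the double series over [a] and n are bounded by L (q |u|)^n independently of [a].
    Truncation in n is thus uniform in [a], which permits exchanging the two summations. *)
Lemma eis_form_expansion k : (0 < k)%N ->
  has_u_expansion abs iota pt (eis_form k) (iota \o (@FracField.tofrac A \o eis_coef k)).
Proof.
move=> k0; have [B B0 hB] := u_param_small; exists B => // z /hB[zO us u0].
set u := u_param abs iota pt z in us u0 *.
pose W a := eis_goss iota k (u_param abs iota pt (iA a * z)) / ll k.
have Wcsum a : a != 0 -> csum abs (fun n => iA (eis_summand k a n) * u ^+ n) (W a).
  exact: eis_goss_csum.
pose L := \big[Num.max/1]_(i < k) abs (iA (log_quot i k)).
have L1 : 1 <= L by exact: bigmax_ge_id.
have L0 : 0 < L by exact: lt_le_trans L1.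
have small a n : abs (iA (eis_summand k a n) * u ^+ n) <= L * (q%:R * abs u) ^+ n.
  rewrite /eis_summand -iAmE rmorph_sum mulr_suml; apply: (abs_sum_le absC).
    by rewrite mulr_ge0 ?exprn_ge0 ?mulr_ge0 ?(abs_nonneg absC)// ltW// (card_Fq_gt0R R Fq).
  move=> i _; rewrite rmorphM !iAmE -mulrA (abs_mul absC); apply: ler_pM; rewrite ?(abs_nonneg absC)//.
    exact: (le_bigmax 1 (fun i : 'I_k => abs (iA (log_quot i k)))).
  by apply: (abs_term_le hC); apply: deg_fps_exp; exact: (u_at_deg iota pF).
apply/(cvg_absP absC) => e e0; have e20 : 0 < e / 2 by exact: divr_gt0.
have [N hN] := geometric_small hC us (divr_gt0 e20 L0).
exists N.+1 => n Nn.
have [S0 hS0] := eis_form_usum k0 zO e20.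
have [D0 hD0] : exists D0, {subset S0 <= box Fq D0}.
  elim: S0 {hS0} => [|a s [D1 hD1]]; first by exists 0%N.
  exists (maxn D1 (size a)) => b; rewrite inE => /orP[/eqP ->|/hD1].
    by rewrite mem_box leq_maxr.
  by rewrite !mem_box => /leq_trans; apply; exact: leq_maxl.
(* [D0] makes the sum over [a] accurate, and D >= n makes the box contain every [a] that contributes
   to a coefficient below n. *)
pose D := maxn n D0.
have {hS0} := hS0 (box Fq D) (box_uniq Fq D) (fun a aS => box_mono (leq_maxr n D0) (hD0 a aS)).
rewrite (bigD1_seq 0) ?box_uniq ?mem_box ?size_poly0//= eqxx.
rewrite [X in 1 + X](eq_bigr (fun a => - W a)); last by move=> a /negbTE ->.
rewrite sumrN => hD.
have -> : \sum_(i < n) (iota \o (@FracField.tofrac A \o eis_coef k)) i * u ^+ i =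
    1 - \sum_(a <- box Fq D | a != 0) \sum_(j < n) iA (eis_summand k a j) * u ^+ j.
  rewrite [X in _ = _ - X]exchange_big/=.
  have -> : 1 = \sum_(i < n) iA (i == 0 :> nat)%:R * u ^+ i.
    case: n Nn {D hD} => // n _; rewrite big_ord_recl big1 ?addr0/= ?iotaA1 ?mul1r// => i _.
    by rewrite iotaA0 mul0r.
  rewrite -sumrB; apply: eq_bigr => i _ /=.
  rewrite -[iota _]/(iA (eis_coef k i)) (@eis_coefE k i D); last first.
    by apply: leq_trans (ltnW (ltn_ord i)) _; exact: leq_maxl.
  rewrite iotaAB mulrBl; congr (_ - _).
  by rewrite -iAmE rmorph_sum mulr_suml.
apply: (@le_lt_trans _ _ (e / 2)); last by rewrite ltr_pdivrMr// mulr_natr mulr2n ltrDl.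
set X := \sum_(a <- box Fq D | a != 0) \sum_(j < n) _.
have -> : 1 - X - eis_form k z = (1 - \sum_(a <- box Fq D | a != 0) W a - eis_form k z) +
    \sum_(a <- box Fq D | a != 0) (W a - \sum_(j < n) iA (eis_summand k a j) * u ^+ j).
  by rewrite sumrB -/X; ring.
apply: (absD_le absC) => //; apply: (abs_sum_le absC) => [|a a0]; first exact: ltW.
apply: (csum_tail absC (ltW e20) (Wcsum a a0)) => j nj.
apply: le_trans (small a j) _; rewrite mulrC -ler_pdivlMr//; apply/ltW/hN.
by apply: leq_trans nj; exact: ltnW.
Qed.

Theorem eisenstein_modular k : (0 < k)%N ->
  modular_form_K abs iota pt ((q ^ k).-1)%:Z (0 : Zmod q.-1) (@FracField.tofrac A \o eis_coef k).
Proof.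
move=> k0.
have w0 : (0 < (q ^ k).-1)%N.
  by have := @ltn_exp2l q 0 k (card_Fq_gt1 Fq); rewrite k0 expn0; case: (q ^ k)%N => [|[|]].
exists (eis_form k); last exact: eis_form_expansion.
split; first by apply: (rigidZ hC); exact: eisenstein_rigid.
  move=> g z gu zO; rewrite /= /eis_form (eisenstein_transform w0 gu zO) /=; ring.
by eexists; exact: eis_form_expansion.
Qed.

(** The exponent q^k - q^i is a multiple of q^i, so u(a z) enters through a q^i-th power. *)
Lemma eis_part_pow k i n : (i < k)%N -> ~~ (q ^ i %| n)%N -> eis_part k i n = 0.
Proof.
move=> ik qn; rewrite /eis_part big1// => a _.
have -> : (q ^ k - q ^ i = (q ^ (k - i)).-1 * q ^ i)%N.
  by rewrite -subn1 mulnBl mul1n -expnD subnK// ltnW.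
have [m _ qE] := card_pchar_pow pF.
have qiE : (q ^ i = p ^ (m * i))%N by rewrite expnM -qE.
rewrite qiE in qn *; apply: (@fps_exp_pow _ _ p) => //.
by rewrite pchar_poly.
Qed.

End Eisenstein.

(** * Operations on modular forms *)

Section Operations.
Variables (R : realType) (Fq : finFieldType) (C : fieldType) (abs : C -> R).
Variable (iota : {rmorphism ratfun Fq -> C}).
Hypothesis hC : is_Cinf abs iota.
Let absC := Cinf_abs hC.
Variable p : nat.
Hypothesis pF : p \in [pchar Fq].
Let pC : p \in [pchar C] := pchar_ext_field iota pF.
Local Notation q := #|Fq|.
Local Notation A := {poly Fq}.
Local Notation K := (ratfun Fq).
Local Notation iA := (iotaA iota).
Local Notation expC := (carlitz_exp abs iota).
Local Notation Om := (Omega abs iota).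
Variable pt : C.
Hypothesis hpt : is_carlitz_period abs iota pt.
Local Notation modK := (modular_form_K abs iota pt).

Lemma goss_coefE r j : (j <= r)%N -> goss_coef Fq r j = fps_exp (carlitz_exp_fps Fq) j r.
Proof.
move=> jr.
have expE n k : fps_exp (fun i => 'X * (carlitz_exp_fps Fq i)%:P) n k =
    (fps_exp (carlitz_exp_fps Fq) n k) *: 'X^n :> {poly K}.
  elim: n k => [|n IH] k /=; first by case: (k == 0%N); rewrite ?scale0r ?scale1r.
  rewrite /fps_mul scaler_suml; apply: eq_bigr => i _.
  by rewrite IH -scalerAl mulrA -exprSr mulrC mul_polyC scalerA.
rewrite /goss_coef gossS /fps_geom mulrC coefMX /= coef_sum.
rewrite (bigD1 (Ordinal (n := r.+1) (m := j) jr))//= expE coefZ coefXn eqxx mulr1.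
rewrite big1 ?addr0// => i ij; rewrite expE coefZ coefXn eq_sym.
by rewrite (_ : (i == j :> nat) = false) ?mulr0//; exact: negbTE ij.
Qed.

Lemma carlitz_exp_fps_sign n : (-1) ^+ n * carlitz_exp_fps Fq n = - carlitz_exp_fps Fq n.
Proof.
rewrite /carlitz_exp_fps mulr_sumr -sumrN; apply: eq_bigr => i /eqP iE.
have pK : p \in [pchar K] by exact: (pchar_ext_field idfun pF).
have -> : (-1) ^+ n = -1 :> K by rewrite -iE (exprqnN pF pK) expr1n.
by rewrite mulN1r.
Qed.

(** The exponential e_C is odd, as (-1)^(q^i) = -1 in every characteristic, 2 included. This trades
    the sign (-1)^j of the binomial series for the sign in (-pt)^r. *)
Lemma goss_coef_sign r j : (j <= r)%N -> (-1) ^+ j * goss_coef Fq r j = (-1) ^+ r * goss_coef Fq r j.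
Proof.
move=> jr; rewrite !goss_coefE// {jr}.
elim: j r => [|j IH] r.
  by case: r => [|r]; rewrite //= !mulr0.
rewrite /= /fps_mul !mulr_sumr; apply: eq_bigr => i _.
have -> : (-1) ^+ r = (-1) ^+ i * (-1) ^+ (r - i) :> K.
  by rewrite -exprD subnKC// -ltnS.
rewrite mulrACA -IH carlitz_exp_fps_sign exprS; ring.
Qed.

Lemma fps_exp_scale (c : nat -> K) (x : C) j n :
  fps_exp (fun i => iota (c i) * x ^+ i) j n = iota (fps_exp c j n) * x ^+ n.
Proof.
elim: j n => [|j IH] n /=.
  by case: n => [|n]; rewrite ?rmorph1 ?rmorph0 ?mul0r ?mulr1.
rewrite /fps_mul rmorph_sum mulr_suml; apply: eq_bigr => i _.
have -> : x ^+ n = x ^+ i * x ^+ (n - i) by rewrite -exprD subnKC// -ltnS.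
by rewrite IH rmorphM; ring.
Qed.

Definition exp_jet r : {poly C} :=
  \sum_(i < r.+1) (iota (carlitz_D_inv Fq i) * pt ^+ (q ^ i)) *: 'X^(q ^ i).

Lemma exp_jet_coef r n : (n <= r)%N -> (exp_jet r)`_n = iota (carlitz_exp_fps Fq n) * pt ^+ n.
Proof.
move=> nr; rewrite /exp_jet coef_sum /carlitz_exp_fps rmorph_sum mulr_suml.
rewrite (big_ord_widen_cond r.+1 (fun i => (q ^ i)%N == n) (fun i => iota (carlitz_D_inv Fq i) * pt ^+ n))//.
rewrite [RHS]big_mkcond/=; apply: eq_bigr => i _; rewrite coefZ coefXn eq_sym.
case: eqP => [iE|_] /=; last by rewrite mulr0.
have -> : (i < n.+1)%N.
  by rewrite -iE; apply: leqW; apply: ltn_expl; exact: finRing_gt1.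
by rewrite mulr1 iE.
Qed.

Lemma exp_jetP r : bigO abs r.+1 (fun x => expC (pt * x) - (exp_jet r).[x]).
Proof.
have [M M0 hM] := vanish_bounded absC (carlitz_term_vanish hC pF pt).
exists 1 => //; exists M => // x x1.
have h := carlitz_exp_csum hC pF (pt * x).
have -> : (exp_jet r).[x] = \sum_(i < r.+1) iota (carlitz_D_inv Fq i) * (pt * x) ^+ (q ^ i).
  by rewrite horner_sum; apply: eq_bigr => i _; rewrite hornerZ hornerXn exprMn mulrA.
apply: (csum_tail absC _ h) => [|i ri]; first by rewrite mulr_ge0 ?exprn_ge0 ?(abs_nonneg absC)// ltW.
rewrite exprMn mulrA (abs_mul absC) (absX absC); apply: ler_pM; rewrite ?(abs_nonneg absC) ?exprn_ge0 ?(abs_nonneg absC)//.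
apply: ler_wiXn2l; rewrite ?(abs_nonneg absC) ?(ltW x1)//.
by apply: leq_trans ri _; apply: ltnW; apply: ltn_expl; exact: finRing_gt1.
Qed.

Lemma bigO_expC : bigO abs 1 (fun x => expC (pt * x)).
Proof.
have h := exp_jetP 0.
have h2 : bigO abs 1 (fun x => (exp_jet 0).[x]).
  have := bigOZ hC (iota (carlitz_D_inv Fq 0) * pt) (bigO_X abs); apply: eq_bigO; exists 1 => // x _.
  by rewrite /exp_jet big_ord1 hornerZ hornerXn expn0 !expr1.
by apply: eq_bigO (bigOD hC h h2); exists 1 => // x _; rewrite subrK.
Qed.

Lemma exp_jetX r j : bigO abs r.+1 (fun x => expC (pt * x) ^+ j - (exp_jet r ^+ j).[x]).
Proof.
have hb := bigO_le hC (leq0n 1) bigO_expC.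
have hbj k : bigO abs 0 (fun x => expC (pt * x) ^+ k).
  elim: k => [|k IH]; first exact: (bigO_cst hC 1).
  by apply: eq_bigO (bigOM hC hb IH); exists 1 => // x _; rewrite exprS.
elim: j => [|j IH].
  by apply: eq_bigO (bigOZ hC 0 (exp_jetP r)); exists 1 => // x _; rewrite !expr0 hornerC subrr mul0r.
have h1 := bigOM hC (exp_jetP r) (hbj j); rewrite addn0 in h1.
have h2 := bigOM hC (bigO_poly hC (exp_jet r)) IH; rewrite add0n in h2.
by apply: eq_bigO (bigOD hC h1 h2); exists 1 => // x _; rewrite !exprS hornerM; ring.
Qed.

(** The binomial series with negative exponent. By Pascal's rule, multiplication by 1 + t carries
    the truncated series for n + 1 to that for n, up to one term in t^(r+1). *)
Lemma inv_pow_expansion n r (t : C) : abs t < 1 ->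
  abs (((1 + t) ^+ n)^-1 - \sum_(j < r.+1) (-1) ^+ j * 'C(n + j - 1, j)%:R * t ^+ j) <= abs t ^+ r.+1.
Proof.
move=> t1; have u1 : abs (1 + t) = 1 by rewrite (abs_isosceles absC) (abs1 absC).
have u0 : 1 + t != 0 by apply: (abs_neq0 absC); rewrite u1.
pose S n := \sum_(j < r.+1) (-1) ^+ j * 'C(n + j - 1, j)%:R * t ^+ j.
rewrite -/(S n); elim: n => [|n IH].
  rewrite /S big_ord_recl big1 ?addr0 => [|i _].
    by rewrite bin0 !mulr1 expr0 invr1 subrr (abs0 absC) exprn_ge0// (abs_nonneg absC).
  by rewrite lift0 add0n subSS subn0 bin_small// mulr0 mul0r.
have hS : (1 + t) * S n.+1 = S n + (-1) ^+ r * 'C(n + r, r)%:R * t ^+ r.+1.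
  pose b m j : C := (-1) ^+ j * 'C(m + j - 1, j)%:R * t ^+ j.
  have pascal j : b n.+1 j.+1 + t * b n.+1 j = b n j.+1.
    have e1 : (n.+1 + j.+1 - 1 = (n + j).+1)%N by lia.
    have e2 : (n.+1 + j - 1 = n + j)%N by lia.
    have e3 : (n + j.+1 - 1 = n + j)%N by lia.
    by rewrite /b e1 e2 e3 binS natrD !exprS; ring.
  rewrite mulrDl mul1r -[S n.+1]/(\sum_(j < r.+1) b n.+1 j) -[S n]/(\sum_(j < r.+1) b n j).
  rewrite mulr_sumr {1}big_ord_recl [X in _ + X]big_ord_recr/= [in RHS]big_ord_recl.
  have b0 m : b m 0%N = 1 by rewrite /b bin0 !mulr1.
  rewrite !b0.
  have <- : \sum_(i < r) b n.+1 (lift ord0 i) + \sum_(i < r) t * b n.+1 i = \sum_(i < r) b n (lift ord0 i).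
    by rewrite -big_split/=; apply: eq_bigr => i _; exact: pascal.
  have -> : t * b n.+1 r = (-1) ^+ r * 'C(n + r, r)%:R * t ^+ r.+1.
    by rewrite /b addSn subSS subn0 exprS; ring.
  by ring.
set kap := (-1) ^+ r * 'C(n + r, r)%:R * t ^+ r.+1 in hS.
have -> : ((1 + t) ^+ n.+1)^-1 - S n.+1 = (((1 + t) ^+ n)^-1 - S n - kap) / (1 + t).
  have -> : S n.+1 = (S n + kap) / (1 + t) by rewrite -hS mulrC mulKf.
  by rewrite exprS; field; rewrite u0 expf_neq0.
rewrite (abs_mul absC) (absV absC) u1 invr1 mulr1; apply: (absB_le absC) => //.
rewrite /kap -mulrA (abs_sign absC) (abs_mul absC) (absX absC).
by rewrite ler_piMl ?exprn_ge0 ?(abs_nonneg absC)// (abs_nat_le1 absC).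
Qed.

(** Additivity of e_C gives u(z + x) = u / (1 + u X) with X = e_C(pt x). Expanding (1 + u X)^(-n),
    the power X^j is multiplied by the inner series of Theta^r up to sign, and the coefficient of
    x^r in X^j is pt^r times the Goss coefficient. *)
Lemma hyperderiv_expansion r f c : has_u_expansion abs iota pt f c ->
  has_u_expansion abs iota pt (hyperderiv abs r f) (fun l => (- pt) ^+ r * Theta iota r c l).
Proof.
move=> [B B0 hf]; have [B' B'0 hB'] := u_param_small hC pF hpt.
exists (Num.max B B') => [|z zB]; first by rewrite lt_max B0.
have zB1 x : Kinf abs iota x -> B <= abs (z - x).
  by move=> /zB; apply: le_trans; rewrite le_max lexx.
have [|zO us u0] := hB' z.
  by move=> x /zB; apply: le_trans; rewrite le_max lexx orbT.
set u := u_param abs iota pt z in us u0.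
have hz : csum abs (fun n => c n * u ^+ n) (f z) by exact: hf.
have cv := csum_vanish absC hz; have [M M0 hM] := vanish_bounded absC cv.
pose w j n := c n * 'C(n + j - 1, j)%:R * u ^+ (n + j).
have /choice[W hW] : forall j, exists s, csum abs (w j) s.
  move=> j; apply: (vanish_csum absC (Cinf_complete hC)) => e e0.
  have e1 : 0 < e / (abs u ^+ j + 1).
    by rewrite divr_gt0// ltr_wpDl// exprn_ge0// (abs_nonneg absC).
  have [N hN] := cv _ e1; exists N => n Nn.
  have -> : w j n = c n * u ^+ n * ('C(n + j - 1, j)%:R * u ^+ j) by rewrite /w exprD; ring.
  rewrite (abs_mul absC (c n * u ^+ n)).
  apply: (@le_lt_trans _ _ (abs (c n * u ^+ n) * (abs u ^+ j + 1))).
    rewrite ler_wpM2l ?(abs_nonneg absC)// (abs_mul absC) (absX absC).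
    by apply: le_trans (_ : _ <= abs u ^+ j) _; rewrite ?lerDl// ler_piMl ?exprn_ge0 ?(abs_nonneg absC) ?(abs_nat_le1 absC).
  by rewrite -ltr_pdivlMr ?hN// ltr_wpDl// exprn_ge0// (abs_nonneg absC).
pose P : {poly C} := \sum_(j < r.+1) ((-1) ^+ j * W j) *: exp_jet r ^+ j.
have jet : bigO abs r.+1 (fun x => f (z + x) - P.[x]).
  have h1 : bigO abs r.+1 (fun x => f (z + x) - \sum_(j < r.+1) ((-1) ^+ j * W j) * expC (pt * x) ^+ j).
    have [rho rho0 [N N0 hN]] := bigO_expC.
    have au := abs_gt0 absC u0.
    (* Within this radius z + x stays in the domain of the expansion and |u X| < 1. *)
    pose s := Num.min (Num.min rho B) (abs u * N)^-1.
    have s0 : 0 < s by rewrite !lt_min rho0 B0 invr_gt0 mulr_gt0.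
    exists s => //; exists (M * (abs u * N) ^+ r.+1) => [|x].
      by rewrite mulr_gt0// exprn_gt0// mulr_gt0.
    rewrite !lt_min => /andP[/andP[xr xB] xs].
    set X := expC (pt * x); have XN : abs X <= N * abs x by have := hN x xr; rewrite expr1.
    pose Y := u * X.
    have YN : abs Y <= abs u * N * abs x by rewrite (abs_mul absC) -mulrA ler_wpM2l ?(abs_nonneg absC).
    have Y1 : abs Y < 1.
      by apply: le_lt_trans YN _; rewrite mulrC -ltr_pdivlMr ?mulr_gt0// div1r.
    have uY : 1 + Y != 0.
      by apply: (abs_neq0 absC); rewrite (abs_isosceles absC) (abs1 absC).
    have zxB y : Kinf abs iota y -> B <= abs (z + x - y).
      move=> yK; have -> : z + x - y = (z - y) + x by ring.
      by rewrite (abs_isosceles absC) ?zB1//; apply: lt_le_trans xB (zB1 y yK).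
    have ux : u_param abs iota pt (z + x) = u / (1 + Y).
      rewrite /u_param mulrDr (carlitz_expD hC pF) -/X.
      have -> : expC (pt * z) = u^-1 by rewrite /u /u_param invrK.
      have -> : u^-1 + X = (1 + Y) / u by rewrite /Y; field.
      by rewrite invfM invrK mulrC.
    have hx : csum abs (fun n => c n * u ^+ n * ((1 + Y) ^+ n)^-1) (f (z + x)).
      have hx0 : csum abs (fun n => c n * u_param abs iota pt (z + x) ^+ n) (f (z + x)) by exact: hf.
      by apply: (eq_csum absC _ hx0) => n; rewrite ux expr_div_n mulrA.
    have hW2 : csum abs (fun n => \sum_(j < r.+1) ((-1) ^+ j * X ^+ j) * w j n)
        (\sum_(j < r.+1) ((-1) ^+ j * X ^+ j) * W j).
      by apply: (@csum_bigsum _ _ _ absC _ _ xpredT (fun (j : 'I_r.+1) n => ((-1) ^+ j * X ^+ j) * w j n)) => j _; exact: csumZ.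
    have hd := csumD absC hx (csumZ absC (-1) hW2).
    rewrite -[X in abs (_ - X)](_ : \sum_(j < r.+1) ((-1) ^+ j * X ^+ j) * W j = _); last first.
      by apply: eq_bigr => j _; ring.
    rewrite mulN1r in hd; apply: le_trans (csum_le absC (M := M * abs Y ^+ r.+1) _ hd _) _.
    - by rewrite mulr_ge0 ?exprn_ge0 ?(abs_nonneg absC)// ltW.
    - move=> n; have -> : c n * u ^+ n / (1 + Y) ^+ n + -1 * \sum_(j < r.+1) (-1) ^+ j * X ^+ j * w j n =
        c n * u ^+ n * (((1 + Y) ^+ n)^-1 - \sum_(j < r.+1) (-1) ^+ j * 'C(n + j - 1, j)%:R * Y ^+ j).
        rewrite mulrBr mulN1r; congr (_ - _); rewrite mulr_sumr; apply: eq_bigr => j _.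
        by rewrite /w /Y exprD exprMn; ring.
      rewrite (abs_mul absC); apply: ler_pM; rewrite ?(abs_nonneg absC)//.
      exact: inv_pow_expansion.
    - by rewrite -mulrA -exprMn ler_pM2l// lerXn2r ?nnegrE ?(abs_nonneg absC)// mulr_ge0// ?mulr_ge0 ?(abs_nonneg absC)// ltW.
  have h2 := @bigO_sum _ _ _ _ _ hC r.+1 _ (index_enum 'I_r.+1) xpredT
    (fun (j : 'I_r.+1) x => ((-1) ^+ j * W j) * (expC (pt * x) ^+ j - (exp_jet r ^+ j).[x]))
    (fun j _ => bigOZ hC _ (exp_jetX r j)).
  apply: eq_bigO (bigOD hC h1 h2); exists 1 => // x _.
  rewrite -addrA; congr (_ + _); rewrite /P horner_sum -!sumrN -big_split; apply: eq_bigr => j _ /=.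
  by rewrite hornerZ; ring.
have -> : hyperderiv abs r f z = (- pt) ^+ r * \sum_(j < r.+1) iota (goss_coef Fq r j) * W j.
  rewrite (hyperderivE hC jet)// coef_sum mulr_sumr; apply: eq_bigr => j _.
  have jr : (j <= r)%N by rewrite -ltnS.
  rewrite coefZ -(@fps_exp_poly _ (fun i => iota (carlitz_exp_fps Fq i) * pt ^+ i) (exp_jet r) j r)//; last first.
    by move=> i ir; rewrite exp_jet_coef.
  rewrite fps_exp_scale -goss_coefE//.
  have := congr1 iota (goss_coef_sign jr); rewrite !rmorphM !rmorphXn !rmorphN1 => h.
  rewrite [(- pt) ^+ r]exprNn.
  have -> : (-1) ^+ j * W j * (iota (goss_coef Fq r j) * pt ^+ r) =
     ((-1) ^+ j * iota (goss_coef Fq r j)) * W j * pt ^+ r by ring.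
  by rewrite h; ring.
have h : csum abs (fun l => \sum_(j < r.+1) iota (goss_coef Fq r j) * (if (j <= l)%N then w j (l - j)%N else 0))
    (\sum_(j < r.+1) iota (goss_coef Fq r j) * W j).
  apply: (@csum_bigsum _ _ _ absC _ _ xpredT (fun (j : 'I_r.+1) l => iota (goss_coef Fq r j) * (if (j <= l)%N then w j (l - j)%N else 0))) => j _.
  by apply: (csumZ absC); exact: csum_shift.
have h2 := csumZ absC ((- pt) ^+ r) h.
suff h3 : csum abs (fun l => (- pt) ^+ r * Theta iota r c l * u ^+ l)
    ((- pt) ^+ r * \sum_(j < r.+1) iota (goss_coef Fq r j) * W j) by exact: h3.
apply: (eq_csum absC _ h2) => l.
rewrite -mulrA; congr (_ * _); rewrite /Theta [in RHS]big_mkcond [RHS]mulr_suml; apply: eq_bigr => j _.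
case: leqP => jl; last by rewrite mulr0 mul0r.
by rewrite /w subnK//; ring.
Qed.

Lemma Theta_iota r (c : nat -> K) l : Theta iota r (iota \o c) l = iota (Theta idfun r c l).
Proof.
rewrite /Theta rmorph_sum; apply: eq_bigr => j _.
by rewrite !rmorphM rmorph_nat.
Qed.

Lemma eq_u_expansion f c c' : c =1 c' -> has_u_expansion abs iota pt f c ->
  has_u_expansion abs iota pt f c'.
Proof. by move=> /funext ->. Qed.

Lemma has_u_expansionZ a f c : has_u_expansion abs iota pt f c ->
  has_u_expansion abs iota pt (fun z => a * f z) (fun n => a * c n).
Proof.
move=> [B B0 hf]; exists B => // z zB.
have h : csum abs (fun n => c n * u_param abs iota pt z ^+ n) (f z) by exact: hf.
have h2 := csumZ absC a h.
suff : csum abs (fun n => a * c n * u_param abs iota pt z ^+ n) (a * f z) by [].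
by apply: (eq_csum absC _ h2) => n; exact: mulrA.
Qed.

Theorem theta_modular (k : int) (m : Zmod q.-1) (r M : nat) (n' : int) (c : nat -> K) :
  (0 < r)%N -> (r < p ^ M)%N -> k + r%:Z - 1 = (p ^ M)%:Z * n' ->
  modK k m c -> modK (k + (2 * r)%N%:Z) (m + Zmod_of_int q.-1 r) (Theta idfun r c).
Proof.
move=> r0 rM kr [f [fr fm _] fc].
have pt0 := period_neq0 hC pF hpt.
have e : has_u_expansion abs iota pt (fun z => ((- pt) ^+ r)^-1 * hyperderiv abs r f z) (iota \o Theta idfun r c).
  apply: eq_u_expansion (has_u_expansionZ ((- pt) ^+ r)^-1 (hyperderiv_expansion r fc)) => l.
  by rewrite Theta_iota mulKf// expf_neq0// oppr_eq0.
exists (fun z => ((- pt) ^+ r)^-1 * hyperderiv abs r f z) => //; split; last by eexists; exact: e.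
  by apply: (rigidZ hC); exact: (rigid_hyperderiv hC).
move=> g z gu zO; have := bol hC pF r0 rM kr fr fm gu zO => /= ->; ring.
Qed.

Lemma modular_mul k k' (m m' : Zmod q.-1) c c' : modK k m c -> modK k' m' c' ->
  modK (k + k') (m + m') (fps_mul c c').
Proof.
move=> [f [fr fm _] [B B0 fc]] [f' [fr' fm' _] [B' B'0 fc']].
have e : has_u_expansion abs iota pt (fun z => f z * f' z) (iota \o fps_mul c c').
  exists (Num.max B B') => [|z zB]; first by rewrite lt_max B0.
  have h : csum abs (fun n => (iota \o c) n * u_param abs iota pt z ^+ n) (f z).
    by apply: fc => x /zB; apply: le_trans; rewrite le_max lexx.
  have h' : csum abs (fun n => (iota \o c') n * u_param abs iota pt z ^+ n) (f' z).
    by apply: fc' => x /zB; apply: le_trans; rewrite le_max lexx orbT.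
  suff : csum abs (fun n => (iota \o fps_mul c c') n * u_param abs iota pt z ^+ n) (f z * f' z) by [].
  apply: (eq_csum absC _ (csumM absC h h')) => n.
  rewrite /= /fps_mul rmorph_sum mulr_suml; apply: eq_bigr => i _.
  have -> : u_param abs iota pt z ^+ n = u_param abs iota pt z ^+ i * u_param abs iota pt z ^+ (n - i).
    by rewrite -exprD subnKC// -ltnS.
  by rewrite rmorphM; ring.
exists (fun z => f z * f' z) => //; split; last by eexists; exact: e.
  exact: (rigidM hC).
move=> g z gu zO; have [D0 D1] := det_unit_pow iota gu.
have /= -> := fm g z gu zO; have /= -> := fm' g z gu zO.
have j0 := moebius_denom_neq0 hC gu zO.
have := Zmod_valD m m' D1 => /= ->; rewrite expfzDr// invfM; ring.
Qed.

Lemma modular_one : modK 0 0 (fun i => (i == 0%N)%:R).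
Proof.
have e : has_u_expansion abs iota pt (fun=> 1) (iota \o (fun i => (i == 0%N)%:R)).
  exists 1 => // z _.
  suff : csum abs (fun n => iota (n == 0%N)%:R * u_param abs iota pt z ^+ n) 1 by [].
  have := @csum_fin _ _ _ absC (fun n => iota (n == 0%N)%:R * u_param abs iota pt z ^+ n) 1.
  rewrite big_ord1 eqxx expr0 mulr1 rmorph1; apply => -[]// n _.
  by rewrite /= rmorph0 mul0r.
exists (fun=> 1) => //; split; last by eexists; exact: e.
  exact: (rigid_cst hC).
by move=> g z gu zO /=; rewrite expr0 invr1 !mulr1.
Qed.

Lemma modular_exp k c n : modK k 0 c -> modK (k * n%:Z) 0 (fps_exp c n).
Proof.
move=> h; elim: n => [|n IH]; first by rewrite mulr0; exact: modular_one.
have := modular_mul IH h; rewrite addr0; congr modK.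
by rewrite intS mulrDr mulr1 addrC.
Qed.

End Operations.

(** * Congruences modulo a prime of [A] *)

(** The residue field A/wp has q^d elements, so the class of theta is fixed by the power q^(d s). *)
Lemma dvdp_bracket (Fq : finFieldType) (wp : {poly Fq}) s :
  wp \is monic -> irreducible_poly wp -> wp %| bracket Fq ((size wp).-1 * s).
Proof.
move=> wm wi; set d := (size wp).-1.
have hI : monic_irreducible_poly wp by split.
pose L : finFieldType := {poly %/ wp with hI}.
have cL : #|L| = (#|Fq| ^ d)%N by exact: card_qfpoly.
pose x : L := in_qpoly wp 'X.
have hx : x ^+ (#|L| ^ s) = x.
  elim: s => [|s IH]; first by rewrite expn0 expr1.
  by rewrite expnS exprM expf_card.
have : in_qpoly wp (bracket Fq (d * s)) = 0.
  rewrite /bracket expnM -cL rmorphB rmorphXn /=.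
  by apply/eqP; rewrite subr_eq0; apply/eqP; exact: hx.
by move=> /(congr1 val) /=; rewrite -Pdiv.IdomainMonic.modpE mk_monicE// => /eqP.
Qed.

Lemma dvdp_log_quot (Fq : finFieldType) (wp : {poly Fq}) k i j :
  wp \is monic -> irreducible_poly wp ->
  (i < (size wp).-1 * k <= j)%N -> wp %| log_quot Fq i j.
Proof.
move=> wm wi /andP[ik kj]; set m := ((size wp).-1 * k)%N in ik kj.
rewrite /log_quot (@big_cat_nat _ _ _ m)//=; last exact: ltnW.
rewrite dvdp_mulr// -(prednK (leq_ltn_trans (leq0n i) ik)) big_nat_recr/=; last by lia.
rewrite dvdp_mull// (prednK (leq_ltn_trans (leq0n i) ik)) -mulN1r dvdp_mull//.
exact: dvdp_bracket.
Qed.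

(** Among the brackets in the product are [d (i0 + 1)], ..., [d (i0 + N)], and each of them
    contributes a factor [wp]. *)
Lemma dvdp_log_quot_pow (Fq : finFieldType) (wp : {poly Fq}) i i0 N :
  wp \is monic -> irreducible_poly wp -> (i <= i0)%N ->
  wp ^+ N %| log_quot Fq i ((size wp).-1 * (i0 + N)).
Proof.
move=> wm wi ii; set d := (size wp).-1.
have d0 : (0 < d)%N by rewrite /d; case: wi; case: (size wp) => [|[]].
elim: N => [|N IH]; first by rewrite expr0 dvd1p.
have h : (d * (i0 + N) < d * (i0 + N.+1))%N by rewrite ltn_pmul2l// addnS.
rewrite /log_quot (@big_cat_nat _ _ _ (d * (i0 + N)))//=; last exact: ltnW.
  rewrite exprSr dvdp_mul//; apply: (@dvdp_log_quot _ _ (i0 + N.+1)) => //.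
  by rewrite h leqnn.
by apply: leq_trans ii _; rewrite (leq_trans (leq_addr N i0))// leq_pmull.
Qed.

Section EisCongruence.
Variables (Fq : finFieldType) (p : nat) (pF : p \in [pchar Fq]).
Variables (wp : {poly Fq}) (wm : wp \is monic) (wi : irreducible_poly wp).
Variables (i0 N : nat) (i00 : (0 < i0)%N).
Local Notation d := (size wp).-1.
Local Notation k := (d * (i0 + N))%N.

Lemma eis_coef_mod n : wp %| eis_coef Fq k n - (n == 0%N)%:R.
Proof.
rewrite /eis_coef addrC addKr -mulN1r dvdp_mull//.
apply: (big_ind (dvdp wp)) => [|x y|i _]; [exact: dvdp0|exact: dvdp_add|].
by rewrite dvdp_mulr// (@dvdp_log_quot _ _ (i0 + N))// ltn_ord leqnn.
Qed.

(** For i <= i0 the quotient of logarithm coefficients is divisible by wp^N; for i > i0 only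
    exponents divisible by q^i, hence by q^i0, occur. *)
Lemma eis_coef_mod_pow n : ~~ (#|Fq| ^ i0 %| n)%N -> wp ^+ N %| eis_coef Fq k n.
Proof.
move=> qn; rewrite /eis_coef.
have -> : (n == 0)%N = false by apply: contraNF qn => /eqP ->; exact: dvdn0.
rewrite sub0r -mulN1r dvdp_mull//.
apply: (big_ind (dvdp (wp ^+ N))) => [|x y|i _]; [exact: dvdp0|exact: dvdp_add|].
have [ii|ii] := leqP i i0; first by rewrite dvdp_mulr// dvdp_log_quot_pow.
rewrite (eis_part_pow pF)// ?mulr0 ?dvdp0//.
by apply: contra qn; apply: dvdn_trans; rewrite dvdn_exp2l// ltnW.
Qed.

End EisCongruence.

(** * Power series over a field with a nonarchimedean absolute value *)

Lemma fps_mulA (S : comNzRingType) (f g h : nat -> S) n :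
  fps_mul (fps_mul f g) h n = fps_mul f (fps_mul g h) n.
Proof.
have ct := @coef_trunc S.
rewrite (@fps_mul_poly _ _ _ (\poly_(j < n.+1) f j * \poly_(j < n.+1) g j) (\poly_(j < n.+1) h j))//.
- rewrite -mulrA; symmetry; apply: fps_mul_poly => [i ni|i ni]; first exact: ct.
  by apply: fps_mul_poly => j ji; apply: ct; exact: leq_trans ni.
- by move=> i ni; apply: fps_mul_poly => j ji; apply: ct; exact: leq_trans ni.
- by move=> i ni; exact: ct.
Qed.

Lemma fps_expD (S : comNzRingType) (f : nat -> S) a b n :
  fps_mul (fps_exp f a) (fps_exp f b) n = fps_exp f (a + b) n.
Proof.
have h m i : (i <= n)%N -> fps_exp f m i = ((\poly_(j < n.+1) f j) ^+ m)`_i.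
  by move=> ni; apply: fps_exp_poly ni => j jn; exact: coef_trunc.
by rewrite h// exprD; apply: fps_mul_poly => i ni; exact: h.
Qed.

(** Compare coefficients of (1 + X)^(a + m), using (1 + X)^(p^e) = 1 + X^(p^e): changes occur only
    in degrees at least p^e. *)
Lemma bin_add_pchar (S : comNzRingType) p e a m j : p \in [pchar S] ->
  (p ^ e %| m)%N -> (j < p ^ e)%N -> 'C(a + m, j)%:R = 'C(a, j)%:R :> S.
Proof.
move=> pS pm je; have pP : p \in [pchar {poly S}] by rewrite pchar_poly.
have E b : 'C(b, j)%:R = ((1 + 'X : {poly S}) ^+ b)`_j.
  rewrite exprDn coef_sum; under eq_bigr do rewrite expr1n mul1r coefMn coefXn.
  have [jb|bj] := leqP j b.
    rewrite (bigD1 (Ordinal (n := b.+1) (m := j) jb))//= eqxx big1 ?addr0// => i ij.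
    by rewrite eq_sym (_ : (i == j :> nat) = false) ?mul0rn//; exact: negbTE ij.
  rewrite bin_small// big1// => i _; rewrite (_ : (j == i) = false) ?mul0rn//.
  by apply/eqP => ji; have := ltn_ord i; rewrite -ji; lia.
case/dvdnP: pm => m' ->; elim: m' => [|m' IH]; first by rewrite addn0.
rewrite mulSn addnCA addnC -IH !E exprD exprpnD// expr1n mulrDr mulr1 coefD coefMXn je.
by rewrite addr0.
Qed.

(** Forms over K are estimated over K itself, with the absolute value restricted from K_v; the
    completion enters only when passing to the limit. *)
Lemma pullback_abs (R : realType) (F L : fieldType) (abs : L -> R)
    (iota : {rmorphism F -> L}) :
  nonarchimedean_abs abs -> nonarchimedean_abs (abs \o iota).
Proof.
move=> absL; split=> [x|x|x y|x y] /=.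
- exact: abs_ge0.
- split=> [/(abs_eq0 absL)/eqP|->]; last by rewrite rmorph0; exact: abs0.
  by rewrite fmorph_eq0 => /eqP.
- by rewrite rmorphM (abs_mul absL).
- by rewrite rmorphD; exact: abs_ultra.
Qed.

Section AlmostSupported.
Variables (R : realType) (F : fieldType) (abs : F -> R).
Hypothesis absF : nonarchimedean_abs abs.

Lemma fps_mul_abs f g n A B : 0 <= A -> 0 <= B ->
  (forall i, abs (f i) <= A) -> (forall i, abs (g i) <= B) -> abs (fps_mul f g n) <= A * B.
Proof.
move=> A0 B0 fA gB; apply: (abs_sum_le absF) => [|i _]; first exact: mulr_ge0.
by rewrite (abs_mul absF); apply: ler_pM; rewrite ?(abs_nonneg absF).
Qed.

Variables (Q : nat) (e : R).

(** With e = q^(-N) this expresses, for the valuation at [wp], an integral series that is a power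
    series in u^Q modulo wp^N. *)
Definition almost_supported (f : nat -> F) :=
  (forall n, abs (f n) <= 1) /\ forall n, ~~ (Q %| n)%N -> abs (f n) <= e.

Hypothesis e0 : 0 <= e.

Lemma almost_supportedM f g : almost_supported f -> almost_supported g ->
  almost_supported (fps_mul f g).
Proof.
move=> [f1 fe] [g1 ge]; split=> n; first by rewrite -[1]mulr1; exact: fps_mul_abs.
move=> Qn; apply: (abs_sum_le absF) => // i _; rewrite (abs_mul absF).
have [Qi|Qi] := boolP (Q %| i)%N; last by rewrite -[e]mulr1; apply: ler_pM; rewrite ?(abs_nonneg absF)// fe.
rewrite -[e]mul1r; apply: ler_pM; rewrite ?(abs_nonneg absF)// ge//.
by apply: contra Qn => Qni; rewrite -(@subnK i n) -1?ltnS// dvdn_add.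
Qed.

Lemma almost_supportedX f m : almost_supported f -> almost_supported (fps_exp f m).
Proof.
move=> hf; elim: m => [|m IH]; last exact: almost_supportedM.
split=> n /=; first by case: (n == 0)%N; rewrite ?(abs1 absF) ?(abs0 absF)// ler01.
move=> Qn; have -> : (n == 0)%N = false by apply: contraNF Qn => /eqP ->; exact: dvdn0.
by rewrite (abs0 absF).
Qed.

End AlmostSupported.

Section PrimePower.
Variables (R : realType) (F : fieldType) (abs : F -> R).
Hypothesis absF : nonarchimedean_abs abs.

Lemma coef_exp_abs (P : {poly F}) e m n : 0 <= e -> (forall i, abs P`_i <= e) ->
  abs (P ^+ m)`_n <= e ^+ m.
Proof.
move=> e0 hP; elim: m n => [|m IH] n.
  by rewrite coef1 expr0; case: (n == 0)%N; rewrite ?(abs1 absF) ?(abs0 absF)// ler01.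
rewrite !exprS coefM; apply: (abs_sum_le absF) => [|i _]; first by rewrite mulr_ge0 ?exprn_ge0.
by rewrite (abs_mul absF); apply: ler_pM; rewrite ?(abs_nonneg absF).
Qed.

(** By Frobenius (1 + E)^(p^M) = 1 + E^(p^M), and the coefficients of E are at most [e]. *)
Lemma fps_exp_near_one p c e M n : p \in [pchar F] -> 0 <= e ->
  (forall i, abs (c i - (i == 0%N)%:R) <= e) ->
  abs (fps_exp c (p ^ M) n - (n == 0%N)%:R) <= e ^+ (p ^ M).
Proof.
move=> pF e0 hc; have pP : p \in [pchar {poly F}] by rewrite pchar_poly.
rewrite (@fps_exp_poly _ c _ _ n (@coef_trunc _ c n))//.
set P := \poly_(j < n.+1) c j; pose E := P - 1.
have -> : P ^+ (p ^ M) = 1 + E ^+ (p ^ M).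
  by rewrite -{1}(expr1n _ (p ^ M)) -exprpnD// /E addrC subrK.
rewrite coefD coef1 addrC addKr; apply: coef_exp_abs => // i.
rewrite /E coefB coef1 coef_poly; case: ifP => // /negbT; rewrite -leqNgt.
by case: i => // i _; rewrite subrr (abs0 absF).
Qed.

End PrimePower.

(** * [Theta] and multiplication by almost supported series *)

Section ThetaBound.
Variables (R : realType) (Fq : finFieldType) (L : fieldType) (abs : L -> R).
Variable iota : {rmorphism ratfun Fq -> L}.
Hypothesis absL : nonarchimedean_abs abs.
Variable r : nat.

(** Operator bound of Theta^r for the Gauss norm, since binomial coefficients have absolute value at
    most 1. The maximum starts at 1 so that the bound is positive. *)
Definition goss_bound : R := \big[Num.max/1]_(j < r.+1) abs (iota (goss_coef Fq r j)).

Lemma goss_bound_ge1 : 1 <= goss_bound.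
Proof. exact: bigmax_ge_id. Qed.

Lemma goss_boundP (j : 'I_r.+1) : abs (iota (goss_coef Fq r j)) <= goss_bound.
Proof. exact: (le_bigmax 1 (fun j : 'I_r.+1 => abs (iota (goss_coef Fq r j)))). Qed.

Lemma Theta_abs f B n : 0 <= B -> (forall i, abs (f i) <= B) ->
  abs (Theta iota r f n) <= goss_bound * B.
Proof.
move=> B0 fB; have g0 : 0 <= goss_bound by apply: le_trans goss_bound_ge1.
apply: (abs_sum_le absL) => [|j _]; first exact: mulr_ge0.
rewrite (abs_mul absL) mulrC; apply: ler_pM; rewrite ?(abs_nonneg absL) ?goss_boundP//.
rewrite (abs_mul absL) -[B]mulr1; apply: ler_pM; rewrite ?(abs_nonneg absL)//.
exact: abs_nat_le1.
Qed.

Lemma ThetaB f g n : Theta iota r (fun i => f i - g i) n = Theta iota r f n - Theta iota r g n.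
Proof. by rewrite /Theta -sumrB; apply: eq_bigr => j _; rewrite !mulrBl. Qed.

End ThetaBound.

Section ThetaApprox.
Variables (R : realType) (Fq : finFieldType) (p : nat) (pF : p \in [pchar Fq]).
Local Notation q := #|Fq|.
Local Notation K := (ratfun Fq).
Variable abs : K -> R.
Hypothesis absK : nonarchimedean_abs abs.
Variable r : nat.
Local Notation gB := (goss_bound abs idfun r).

Lemma fps_mul_Theta (f h : nat -> K) l : fps_mul (Theta idfun r f) h l =
  \sum_(j < r.+1 | (j <= l)%N) goss_coef Fq r j *
    \sum_(i < (l - j).+1) f i * 'C(i + j - 1, j)%:R * h (l - j - i)%N.
Proof.
rewrite /fps_mul /Theta; under eq_bigr do rewrite mulr_suml big_mkcond/=.
rewrite exchange_big/= [RHS]big_mkcond/=; apply: eq_bigr => j _.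
rewrite -big_mkcond/=; case: leqP => jl; last first.
  by rewrite big1// => i ji; have := ltn_ord i; lia.
rewrite mulr_sumr -(@sum_ord_shift _ (fun a => f (a - j)%N * 'C(a - j + j - 1, j)%:R *
  goss_coef Fq r j * h (l - a)%N) j l.+1); last exact: leqW.
rewrite subSn//; apply: eq_bigr => i _; rewrite addnK addnC subnDA; ring.
Qed.

Lemma Theta_fps_mul e a f h B l : almost_supported abs (q ^ a) e h -> 0 <= e -> 0 <= B ->
  (forall i, abs (f i) <= B) -> (r < q ^ a)%N ->
  abs (Theta idfun r (fps_mul f h) l - fps_mul (Theta idfun r f) h l) <= gB * (B * e).
Proof.
move=> [h1 he] e0 B0 fB ra; have g0 : 0 <= gB by exact: le_trans (goss_bound_ge1 abs idfun r).
rewrite fps_mul_Theta /Theta -sumrB; apply: (abs_sum_le absK) => [|j jl].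
  by rewrite !mulr_ge0.
rewrite /= mulrC -mulrBr (abs_mul absK); apply: ler_pM; rewrite ?(abs_nonneg absK) ?(goss_boundP abs idfun)//.
rewrite /fps_mul mulr_suml -sumrB; apply: (abs_sum_le absK) => [|i _]; first exact: mulr_ge0.
have il : (i <= l - j)%N by rewrite -ltnS.
have -> : f i * h (l - j - i)%N * 'C(l - j + j - 1, j)%:R - f i * 'C(i + j - 1, j)%:R * h (l - j - i)%N =
  f i * (h (l - j - i)%N * ('C(l - j + j - 1, j)%:R - 'C(i + j - 1, j)%:R)) by ring.
rewrite (abs_mul absK); apply: ler_pM; rewrite ?(abs_nonneg absK)//.
have [Qm|Qm] := boolP (q ^ a %| l - j - i)%N; last first.
  rewrite (abs_mul absK) -[e]mulr1; apply: ler_pM; rewrite ?(abs_nonneg absK) ?he//.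
  by apply: (absB_le absK); exact: abs_nat_le1.
have -> : 'C(l - j + j - 1, j)%:R = 'C(i + j - 1, j)%:R :> K.
  (* For j = 0 the truncated subtraction in n + j - 1 breaks the shift of the upper index, but both
     binomial coefficients are 1. *)
  have [j0|j0] := posnP j.
    have C1 b : 'C(b, j) = 1%N by rewrite j0 bin0.
    by rewrite !C1.
  have -> : (l - j + j - 1 = i + j - 1 + (l - j - i))%N by lia.
  have [m _ qE] := card_pchar_pow pF.
  have pK : p \in [pchar K] by exact: (pchar_ext_field idfun pF).
  have qaE : (q ^ a = p ^ (m * a))%N by rewrite expnM -qE.
  rewrite qaE in Qm ra; apply: (bin_add_pchar _ pK Qm).
  by apply: leq_ltn_trans ra; rewrite -ltnS.
by rewrite subrr mulr0 (abs0 absK).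
Qed.

(* With [x + y = P] a large power of [p], multiplying by [c^x] before [Theta]
   and by [c^y] after it changes little, because [c^P] is close to 1. *)
Lemma Theta_twist e a c x y M f B l : almost_supported abs (q ^ a) e c -> 0 <= e -> 0 <= B ->
  (forall i, abs (f i) <= B) -> (r < q ^ a)%N ->
  (x + y = p ^ M)%N -> (forall n, abs (fps_exp c (p ^ M) n - (n == 0%N)%:R) <= e) ->
  abs (fps_mul (Theta idfun r (fps_mul f (fps_exp c x))) (fps_exp c y) l - Theta idfun r f l)
    <= gB * (B * e).
Proof.
move=> hc e0 B0 fB ra xy hP; have g0 : 0 <= gB by exact: le_trans (goss_bound_ge1 abs idfun r).
have hx := almost_supportedX absK e0 x hc; have hy := almost_supportedX absK e0 y hc.
have -> : fps_mul (Theta idfun r (fps_mul f (fps_exp c x))) (fps_exp c y) l - Theta idfun r f l =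
  fps_mul (fun n => Theta idfun r (fps_mul f (fps_exp c x)) n - fps_mul (Theta idfun r f) (fps_exp c x) n)
     (fps_exp c y) l +
  fps_mul (Theta idfun r f) (fun n => fps_exp c (p ^ M) n - (n == 0%N)%:R) l.
  have Br (u v w : nat -> K) : fps_mul u (fun n => v n - w n) l = fps_mul u v l - fps_mul u w l.
    by rewrite /fps_mul -sumrB; apply: eq_bigr => i _; rewrite mulrBr.
  have Bl (u v w : nat -> K) : fps_mul (fun n => v n - w n) u l = fps_mul v u l - fps_mul w u l.
    by rewrite /fps_mul -sumrB; apply: eq_bigr => i _; rewrite mulrBl.
  rewrite Br Bl.
  have <- : fps_mul (fps_mul (Theta idfun r f) (fps_exp c x)) (fps_exp c y) l =
    fps_mul (Theta idfun r f) (fps_exp c (p ^ M)) l.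
    by rewrite fps_mulA; apply: eq_bigr => i _; rewrite fps_expD xy.
  have -> : fps_mul (Theta idfun r f) (fun n => (n == 0%N)%:R) l = Theta idfun r f l.
    rewrite /fps_mul big_ord_recr/= subnn eqxx mulr1 big1 ?add0r// => i _.
    by rewrite subn_eq0 leqNgt ltn_ord mulr0.
  ring.
apply: (absD_le absK).
  rewrite -[gB * _]mulr1; apply: (fps_mul_abs absK) => //; last by case: hy.
    by rewrite !mulr_ge0.
  by move=> i; apply: (Theta_fps_mul (a := a)).
rewrite mulrA; apply: (fps_mul_abs absK) => // [|i]; first exact: mulr_ge0.
exact: Theta_abs.
Qed.

End ThetaApprox.

(** * Convergence of [v]-adic modular forms *)

Lemma gauss_norm_cvg (R : realType) (L : fieldType) (abs : L -> R) (g : nat -> nat -> L) :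
  nonarchimedean_abs abs ->
  ((fun i => gauss_norm abs (g i)) @ \oo --> (0 : \bar R)%E)%classic <->
  forall e, 0 < e -> exists N, forall i, (N <= i)%N -> forall n, abs (g i n) <= e.
Proof.
move=> absL; split.
  move=> /fine_cvgP[[N1 _ h1] /cvgrPdist_le h2] e e0; have [N2 _ {}h2] := h2 e e0.
  exists (maxn N1 N2) => i; rewrite geq_max => /andP[i1 i2] n.
  have := h2 i i2; rewrite sub0r normrN => h.
  rewrite -lee_fin; apply: (@le_trans _ _ (gauss_norm abs (g i))).
    by apply: ereal_sup_ubound; exists n.
  by rewrite -(fineK (h1 i i1)) lee_fin; apply: le_trans (ler_norm _) h.
move=> h; have ge0 i : (0 <= gauss_norm abs (g i))%E.
  apply: (@le_trans _ _ (abs (g i 0%N))%:E); first by rewrite lee_fin (abs_nonneg absL).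
  by apply: ereal_sup_ubound; exists 0%N.
have le_e i e : (forall n, abs (g i n) <= e) -> (gauss_norm abs (g i) <= e%:E)%E.
  by move=> he; apply: ge_ereal_sup => _ [n _ <-]; rewrite lee_fin.
have fin i e : (forall n, abs (g i n) <= e) -> gauss_norm abs (g i) \is a fin_num.
  move=> /le_e he; rewrite ge0_fin_numE//; exact: le_lt_trans he (ltry _).
apply/fine_cvgP; split.
  by have [N hN] := h 1 ltr01; exists N => // i Ni; exact: (fin i 1 (hN i Ni)).
apply/cvgrPdist_le => e e0; have [N hN] := h e e0; exists N => // i Ni.
rewrite sub0r normrN /= ger0_norm ?fine_ge0// -lee_fin fineK ?(fin i e (hN i Ni))//.
exact: le_e (hN i Ni).
Qed.

Lemma Zmod_of_intD N (a b : int) : Zmod_of_int N (a + b) = Zmod_of_int N a + Zmod_of_int N b.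
Proof. exact: mulrzDr. Qed.

Lemma Zmod_of_int_dvd N (n : nat) : (N.-1.+1 %| n)%N -> Zmod_of_int N n%:Z = 0.
Proof.
case/dvdnP => m ->; rewrite /Zmod_of_int -pmulrn mulnC mulrnA.
have -> : (inZp 1 : Zmod N) *+ N.-1.+1 = 0.
  by apply: val_inj; rewrite Zp_mulrn /= modnMl.
by rewrite mul0rn.
Qed.

Section Vadic.
Variables (R : realType) (Fq : finFieldType) (p : nat) (pF : p \in [pchar Fq]).
Local Notation q := #|Fq|.
Local Notation A := {poly Fq}.
Local Notation K := (ratfun Fq).
Variables (wp : A) (wm : wp \is monic) (wi : irreducible_poly wp).
Variables (Kv : fieldType) (absv : Kv -> R) (iotav : {rmorphism K -> Kv}).
Hypothesis hv : is_completion_at wp absv iotav.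
Let absVK : nonarchimedean_abs (absv \o iotav) := pullback_abs iotav (Kv_abs hv).
Local Notation nv := (absv \o iotav).
Local Notation tf := (@FracField.tofrac A).
Local Notation d := (size wp).-1.

Lemma degree_gt0 : (0 < d)%N.
Proof. by case: wi; case: (size wp) => [|[]]. Qed.

Lemma absv_dvd N (a : A) : wp ^+ N %| a -> nv (tf a) <= q%:R ^- N.
Proof.
have q1 := ltW (card_Fq_gt1R R Fq); have q0 := card_Fq_gt0R R Fq.
move=> wa; have [->|a0] := eqVneq a 0.
  by rewrite rmorph0 (abs0 absVK) invr_ge0 exprn_ge0// ltW.
rewrite /= (Kv_norm hv)// lef_pV2 ?posrE ?exprn_gt0//; apply: ler_weXn2l => //.
(* The maximum defining [ordA] runs over exponents below [size a]; [N] is among them because wp^N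
   divides [a] and wp has positive degree. *)
have Na : (N < size a)%N.
  have := dvdp_leq a0 wa; apply: leq_trans; apply: leq_ltn_trans (leq_pmull N degree_gt0) _.
  by rewrite -size_exp ltn_predL size_poly_gt0 expf_neq0// monic_neq0.
exact: (@leq_bigmax_cond _ (fun n : 'I_(size a) => wp ^+ n %| a) (fun n => nat_of_ord n) (Ordinal Na)).
Qed.

Lemma absv_int (a : A) : nv (tf a) <= 1.
Proof. by have := @absv_dvd 0 a; rewrite !expr0 invr1; apply; exact: dvd1p. Qed.

Variables (C : fieldType) (absC : C -> R) (iotaC : {rmorphism K -> C}).
Hypothesis hC : is_Cinf absC iotaC.
Variable pt : C.
Hypothesis hpt : is_carlitz_period absC iotaC pt.
Local Notation modK := (modular_form_K absC iotaC pt).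

(** The error is linear in the bound [B] on f, and the approximating form does not depend on [B];
    thus one rate of convergence serves a bounded sequence of forms. *)
Lemma theta_approx (k : int) (m : Zmod q.-1) r N (f : nat -> K) : (0 < r)%N -> (r <= N)%N ->
  modK k m f ->
  exists h, modK (k + (2 * r)%N%:Z + ((q ^ (d * (r + N))).-1 * p ^ N)%N%:Z) (m + Zmod_of_int q.-1 r) h /\
    forall B, 0 <= B -> (forall n, nv (f n) <= B) ->
    forall n, nv (h n - Theta idfun r f n) <= goss_bound nv idfun r * (B * q%:R ^- N).
Proof.
move=> r0 rN fm; have p1 := prime_gt1 (pcharf_prime pF).
have q1 := ltW (card_Fq_gt1R R Fq); have q0 := card_Fq_gt0R R Fq.
(* Between d r and k' lie N multiples of d, each giving a factor [wp]; with i0 = r, the series c is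
   then almost supported on multiples of q^r. *)
set k' := (d * (r + N))%N; set w := (q ^ k').-1.
have d0 := degree_gt0.
have k'0 : (0 < k')%N by rewrite muln_gt0 d0 addn_gt0 r0.
pose c := tf \o eis_coef Fq k'.
have cm : modK w%:Z 0 c by exact: (eisenstein_modular hC pF hpt k'0).
set P := (p ^ N)%N; have P0 : (0 < P)%N by rewrite expn_gt0 ltnW.
have Pq : (P %| q ^ k')%N.
  have [n0 n00 ->] := card_pchar_pow pF; rewrite -expnM dvdn_exp2l//.
  apply: leq_trans (leq_pmull k' n00); apply: leq_trans (leq_pmull (r + N) d0).
  exact: leq_addl.
have wE : w%:Z + 1 = (q ^ k')%N%:Z by rewrite -PoszD addn1 prednK// (qn_gt0N Fq k').
(* As P divides q^k', the weight w is -1 modulo P, so k + w x + r - 1 is k + r - 1 - x modulo P.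
   This must be 0, and the residue in [0, P) leaves a nonnegative exponent P - x for the second
   factor. *)
pose x0 := ((k + r%:Z - 1) %% P%:Z)%Z; pose x := `|x0|%N.
have x0E : x%:Z = x0 by rewrite /x gez0_abs// modz_ge0//; lia.
have xP : (x < P)%N by rewrite -ltz_nat x0E ltz_pmod.
have [h1 hw] : exists n', k + w%:Z * x%:Z + r%:Z - 1 = P%:Z * n'.
  case/dvdnP: Pq => t qE; exists (((k + r%:Z - 1) %/ P%:Z)%Z + t%:Z * x%:Z).
  have := divz_eq (k + r%:Z - 1) P; rewrite -/x0 -x0E => e1.
  have -> : w%:Z = (t * P)%N%:Z - 1 by rewrite -qE -wE addrK.
  rewrite PoszM; move: e1; set D := (_ %/ _)%Z => e1.
  have -> : k = D * P%:Z + x%:Z - r%:Z + 1 by rewrite -e1; ring.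
  ring.
have fx := modular_mul hC fm (modular_exp hC x cm); rewrite addr0 in fx.
have rP : (r < P)%N by apply: leq_trans (ltn_expl r p1) _; rewrite leq_exp2l.
have th := theta_modular hC pF hpt r0 rP hw fx.
have := modular_mul hC th (modular_exp hC (P - x) cm); rewrite addr0 => hm.
eexists; split.
  move: hm; congr modK.
  have -> : (w * P)%N%:Z = w%:Z * x%:Z + w%:Z * (P - x)%N%:Z by rewrite -mulrDr -PoszD subnKC 1?ltnW// PoszM.
  ring.
move=> B B0 fB n; have e0 : 0 <= q%:R ^- N :> R by rewrite invr_ge0 exprn_ge0// ltW.
apply: (Theta_twist pF absVK (a := r) (M := N)) => //.
- split=> [j|j Qj]; first exact: absv_int.
  by apply: absv_dvd; exact: (eis_coef_mod_pow pF).
- by apply: ltn_expl; exact: finRing_gt1.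
- by rewrite subnKC// ltnW.
move=> j; have pK : p \in [pchar K] by exact: (pchar_ext_field idfun pF).
have := @fps_exp_near_one _ _ _ absVK p c q%:R^-1 N j pK _ _.
have q10 : 0 <= q%:R^-1 :> R by rewrite invr_ge0 ltW.
have cn i : nv (c i - (i == 0%N)%:R) <= q%:R^-1.
  have -> : c i - (i == 0%N)%:R = tf (eis_coef Fq k' i - (i == 0%N)%:R) by rewrite rmorphB rmorph_nat.
  by rewrite -[X in X^-1]expr1; apply: absv_dvd; rewrite expr1; exact: eis_coef_mod.
move=> /(_ q10 cn)/le_trans; apply; rewrite exprVn lef_pV2 ?posrE ?exprn_gt0//.
by apply: ler_weXn2l => //; apply: ltnW; exact: ltn_expl.
Qed.

End Vadic.

(** * Convergence of the weights and conclusion *)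

Lemma weight_cvgD p q d (k : nat -> int) (s : weight_space p q d) (j : int) (l : nat -> nat) :
  (forall i, ((q ^ d).-1.-1.+1 %| l i)%N) ->
  (forall n i, (n <= i)%N -> (p ^ n).-1.+1 %| l i)%N ->
  weight_cvg (fun i => weight_of_int p q d (k i)) s ->
  weight_cvg (fun i => weight_of_int p q d (k i + j + (l i)%:Z)) (s + weight_of_int p q d j).
Proof.
move=> l1 l2 [[N1 _ h1] h2]; split.
  exists N1 => // i /h1 /= h; rewrite !Zmod_of_intD (Zmod_of_int_dvd (l1 i)) addr0.
  by congr (_ + _).
move=> n; have [N2 _ {}h2] := h2 n; exists (maxn N2 n) => // i; rewrite /= geq_max => /andP[i2 ni].
rewrite !Zmod_of_intD (Zmod_of_int_dvd (l2 n i ni)) addr0.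
by have /= -> := h2 i i2.
Qed.

Lemma dvdn_pred_exp q a b : (0 < q)%N -> ((q ^ a).-1 %| (q ^ (a * b)).-1)%N.
Proof.
move=> q0; rewrite expnM -!subn1; have := subn_exp (q ^ a) 1 b.
by rewrite exp1n => ->; exact: dvdn_mulr.
Qed.

Theorem theorem6p1 (R : realType) (Fq : finFieldType) (p : nat)
    (hp : p \in [pchar Fq])
    (Cinf : fieldType) (absC : Cinf -> R)
    (iotaC : {rmorphism ratfun Fq -> Cinf})
    (hC : is_Cinf absC iotaC)
    (ptilde : Cinf) (hptilde : is_carlitz_period absC iotaC ptilde)
    (wp : {poly Fq}) (wp_monic : wp \is monic) (wp_irr : irreducible_poly wp)
    (Kv : fieldType) (absv : Kv -> R)
    (iotav : {rmorphism ratfun Fq -> Kv})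
    (hv : is_completion_at wp absv iotav)
    (s : weight_space p #|Fq| (size wp).-1) (m : Zmod #|Fq|.-1) (r : nat)
    (f : nat -> Kv) :
  vadic_modular_form absC iotaC ptilde absv iotav s m f ->
  vadic_modular_form absC iotaC ptilde absv iotav
    (s + weight_of_int p #|Fq| (size wp).-1 (2 * r)%N)
    (m + Zmod_of_int #|Fq|.-1 r)
    (Theta iotav r f).
Proof.
have absV := Kv_abs hv.
move=> [[B fB] [k [F [Fm Ff ks]]]].
(* The approximation by Bol's identity requires r > 0; for r = 0 the operator is the identity. *)
have [->|r0] := posnP r.
  have -> : Theta iotav 0 f = f.
    apply/funext => l; rewrite /Theta big_mkcond big_ord1/= subn0 bin0 mulr1.
    by rewrite goss_coefE//= rmorph1 mulr1.
  have -> : Zmod_of_int #|Fq|.-1 0%N = 0 by exact: mulr0z.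
  have -> : weight_of_int p #|Fq| (size wp).-1 (2 * 0)%N = 0.
    rewrite muln0; apply: injective_projections; first exact: mulr0z.
    by apply: padic_intP => n; exact: mulr0z.
  by rewrite !addr0; split; [exists B | exists k, F].
pose B' := Num.max B 1.
have B'0 : 0 <= B' by rewrite le_max ler01 orbT.
have fB' n : absv (f n) <= B' by rewrite le_max fB.
have g0 : 0 < goss_bound absv iotav r by apply: lt_le_trans (goss_bound_ge1 absv iotav r).
split.
  by exists (goss_bound absv iotav r * B') => n; exact: Theta_abs.
(* The i-th form is treated with precision N = i + r, which tends to infinity and satisfies r <=
   N. *)
have /choice[H hH] := fun i => theta_approx hp wp_monic wp_irr hv hC hptilde r0 (leq_addl i r) (Fm i).
exists (fun i => k i + (2 * r)%N%:Z +
  ((#|Fq| ^ ((size wp).-1 * (r + (i + r)))).-1 * p ^ (i + r))%N%:Z), H; split.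
- by move=> i; case: (hH i).
- apply/(gauss_norm_cvg _ absV) => e e0.
  move/(gauss_norm_cvg _ absV) : Ff => Ff.
  (* From [N1] on all F_i obey the bound B' of f, because B' >= 1; the error in [theta_approx] is
     then uniform. *)
  have [N1 h1] := Ff 1 ltr01.
  have [N2 h2] := Ff (e / goss_bound absv iotav r) (divr_gt0 e0 g0).
  have [N3 h3] := expq_unbounded Fq (goss_bound absv iotav r * B' / e).
  have q1 := ltW (card_Fq_gt1R R Fq); have q0 := card_Fq_gt0R R Fq.
  exists (maxn N1 (maxn N2 N3)) => i; rewrite !geq_max => /and3P[i1 i2 i3] n.
  have FB j : absv (iotav (F i j)) <= B'.
    rewrite -[iotav _](subrK (f j)); apply: (absD_le absV) => //.
    by apply: le_trans (h1 i i1 j) _; rewrite le_max lexx orbT.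
  (* The distance to Theta^r f splits into the error of the approximation for F_i and Theta^r (F_i -
     f), which is controlled by continuity. *)
  rewrite -[iotav _](subrK (Theta iotav r (iotav \o F i) n)) -addrA.
  apply: (absD_le absV).
    rewrite Theta_iota -rmorphB.
    have [_ /(_ B' B'0 FB n) h] := hH i; apply: le_trans h _.
    rewrite mulrA ler_pdivrMr ?exprn_gt0//.
    rewrite [e * _]mulrC -ler_pdivrMr//; apply/ltW/(lt_le_trans h3).
    by apply: ler_weXn2l => //; apply: leq_trans i3 (leq_addr _ _).
  rewrite -ThetaB; apply: le_trans (_ : _ <= goss_bound absv iotav r * (e / goss_bound absv iotav r)) _.
    by apply: Theta_abs => // [|j]; [rewrite divr_ge0// ltW | exact: h2].
  by rewrite mulrC divfK// gt_eqF.
(* The added weight is 0 modulo q^d - 1, since d divides k', and it tends to 0 in Z_p through its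
   factor p^(i + r). *)
apply: weight_cvgD ks => [i|n i ni].
  have d1 := degree_gt0 wp_irr.
  rewrite prednK; last first.
    have := @ltn_exp2l #|Fq| 0 (size wp).-1 (card_Fq_gt1 Fq).
    by rewrite d1 expn0; case: (_ ^ _)%N => [|[]].
  by rewrite dvdn_mulr// dvdn_pred_exp// q_gt0.
have p0 := prime_gt0 (pcharf_prime hp).
rewrite prednK ?expn_gt0 ?p0// dvdn_mull// dvdn_exp2l//.
exact: leq_trans ni (leq_addr _ _).
Qed.
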